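(* Let $X$ be a compact Hausdorff space and $\varphi: X\to X$ a continuous surjection. If the $C^*$-envelope of the semicrossed product $C(X)\rtimes_\varphi\mathbb Z^+$ is a simple $C^*$-algebra, then $C(X)\rtimes_\varphi\mathbb Z^+$ is semisimple.
   Context: Semicrossed product: let $\mathcal A_0$ be the algebra generated by $C(X)$ and a symbol $U$ subject to $fU=U(f\circ\varphi)$, $f\in C(X)$; its elements are $F=\sum_{n=0}^N U^nf_n$, $f_n\in C(X)$. A representation of $\mathcal A_0$ is a homomorphism $\pi$ into the bounded operators on a Hilbert space that restricts to a $*$-representation of $C(X)$ and for which $\pi(U)$ is an isometry. $C(X)\rtimes_\varphi\mathbb Z^+$ is the completion of $\mathcal A_0$ in the norm $\|F\|=\sup_\pi\|\pi(F)\|$ over all such representations; it is an operator algebra, with matrix norms given by the corresponding suprema. Semisimple means that the Jacobson radical is zero. *)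

(* Defs.v *)
From HB Require Import structures.
From mathcomp Require Import all_boot all_order all_algebra sesquilinear complex.
From mathcomp Require Import zify.
From mathcomp Require Import all_classical all_reals all_analysis.
Set Implicit Arguments.
Unset Strict Implicit.
Unset Printing Implicit Defensive.
Import Order.TTheory GRing.Theory Num.Theory.
Import numFieldNormedType.Exports.
Local Open Scope classical_set_scope.
Local Open Scope ring_scope.

Reserved Notation "a ** b" (at level 40, left associativity).

(* Unital associative algebras.  GRing.Algebra is not used because it excludes
   the zero algebra, which is C(X) for X empty. *)
HB.mixin Record Lmodule_isUAlgebra (K : pzRingType) A of GRing.Lmodule K A := {
  amul : A -> A -> A;
  aone : A;
  amulA : associative amul;
  amul1a : left_id aone amul;
  amula1 : right_id aone amul;
  amulDl : left_distributive amul +%R;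
  amulDr : right_distributive amul +%R;
  amulZl : forall (k : K) (a b : A), amul (k *: a) b = k *: amul a b;
  amulZr : forall (k : K) (a b : A), amul a (k *: b) = k *: amul a b
}.

#[short(type="ualgType")]
HB.structure Definition UAlgebra (K : pzRingType) :=
  {A of Lmodule_isUAlgebra K A & GRing.Lmodule K A}.

Notation "a ** b" := (amul a b) : ring_scope.

HB.mixin Record isAlgMorphism (K : pzRingType) (A B : ualgType K)
    (f : A -> B) := {
  alg_morphM : {morph f : a b / a ** b};
  alg_morph1 : f aone = aone
}.

#[short(type="algMorphism")]
HB.structure Definition AlgMorphism (K : pzRingType) (A B : ualgType K) :=
  {f of isAlgMorphism K A B f & @GRing.Linear K A B *:%R f}.

HB.mixin Record UAlgebra_isBanachAlgebra (K : numFieldType) A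
    of UAlgebra K A & CompleteNormedModule K A := {
  normrM_le : forall a b : A, `|a ** b| <= `|a| * `|b|
}.

#[short(type="banachAlgType")]
HB.structure Definition BanachAlgebra (K : numFieldType) :=
  {A of UAlgebra_isBanachAlgebra K A & UAlgebra K A &
        CompleteNormedModule K A}.

HB.mixin Record BanachAlgebra_isCstarAlgebra (K : numClosedFieldType) A
    of BanachAlgebra K A := {
  star : A -> A;
  starD : {morph star : a b / a + b};
  starZ : forall (k : K) (a : A), star (k *: a) = k^* *: star a;
  starM : forall a b : A, star (a ** b) = star b ** star a;
  starK : involutive star;
  normr_starM : forall a : A, `|star a ** a| = `|a| ^+ 2
}.

#[short(type="cstarAlgType")]
HB.structure Definition CstarAlgebra (K : numClosedFieldType) :=
  {A of BanachAlgebra_isCstarAlgebra K A & BanachAlgebra K A}.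

(* The inner product is linear in the first variable and conjugate-linear in
   the second one. *)
HB.mixin Record CompleteNormedModule_isHilbert (K : numClosedFieldType) H
    of CompleteNormedModule K H := {
  inner : {dot H for (@Num.conj K)};
  normr_inner : forall x : H, `|x| ^+ 2 = inner x x
}.

#[short(type="hilbertType")]
HB.structure Definition Hilbert (K : numClosedFieldType) :=
  {H of CompleteNormedModule_isHilbert K H & CompleteNormedModule K H}.

Section ContinuousFunctions.
Context (X : topologicalType) (K : numClosedFieldType).

Definition ctsfun : {pred X -> K} := mem [set f : X -> K | continuous f].

(* The algebra C(X) of continuous functions from X to K. *)
Definition contfun := Eval cbv [reverse_coercion] in continuousType X K.
HB.instance Definition _ := Choice.on contfun.
Local Notation T := contfun.

Let ctsfun_Sub (f : X -> K) (fP : f \in ctsfun) : T :=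
  HB.pack f (isContinuous.Build _ _ f (set_mem fP)).

Let ctsfun_rect (P : T -> Type) :
  (forall f (fP : f \in ctsfun), P (ctsfun_Sub fP)) -> forall u, P u.
Proof.
move=> Psub [f [[fc]]].
have fP : f \in ctsfun by exact: mem_set.
have := Psub f fP; congr P; exact/continuousEP.
Qed.

Let ctsfun_valP f (fP : f \in ctsfun) : ctsfun_Sub fP = f :> (X -> K).
Proof. by []. Qed.

HB.instance Definition _ := isSub.Build _ _ T ctsfun_rect ctsfun_valP.

Let ctsfun_subring_closed : subring_closed ctsfun.
Proof.
split.
- by apply/mem_set => x; exact: cvg_cst.
- move=> f g /set_mem fc /set_mem gc; apply/mem_set => x.
  by apply: cvgB; [exact: fc|exact: gc].
- move=> f g /set_mem fc /set_mem gc; apply/mem_set => x.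
  by apply: cvgM; [exact: fc|exact: gc].
Qed.

HB.instance Definition _ := GRing.isSubringClosed.Build _ ctsfun
  ctsfun_subring_closed.

HB.instance Definition _ := GRing.SubChoice_isSubComPzRing.Build _ _ T
  ctsfun_subring_closed.

Let ctsfun_scaler_closed : GRing.scaler_closed ctsfun.
Proof.
move=> k f /set_mem fc; apply/mem_set => x.
by apply: cvgZr; exact: fc.
Qed.

HB.instance Definition _ := GRing.isScaleClosed.Build _ _ ctsfun
  ctsfun_scaler_closed.
HB.instance Definition _ := GRing.SubZmodule_isSubLmodule.Build _ _ _ T
  (GRing.subsemimodClosedP _).


Let conj_continuous : continuous (@Num.conj K : K -> K).
Proof.
move=> x; apply/(@cvgrPdist_lt _ _ _ (nbhs x) (nbhs_filter x)) => e e0.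
exists e => //= y; rewrite /ball_/= -(norm_conjC (x - y)).
by rewrite [in X in X -> _]rmorphB.
Qed.

Let conj_comp_continuous (f : T) : continuous (fun x => (f x)^*).
Proof.
move=> x; apply: (@continuous_comp _ _ _ f (@Num.conj K : K -> K)).
- exact: cts_fun.
- exact: conj_continuous.
Qed.

Definition contfun_conj (f : T) : T :=
  HB.pack (fun x => (f x)^*) (isContinuous.Build _ _ _ (conj_comp_continuous (f := f))).

End ContinuousFunctions.

Section FiniteSequences.
Context (X : topologicalType) (K : numClosedFieldType).
Local Notation CX := (contfun X K).

Definition finsuppseq : {pred nat -> CX} :=
  mem [set f : nat -> CX | exists N, forall n, (N <= n)%N -> f n = 0].

Record covpoly := CovPoly {
  covcoef :> nat -> CX;
  covcoefP : covcoef \in finsuppseq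
}.

HB.instance Definition _ := [isSub for covcoef].
HB.instance Definition _ := [Choice of covpoly by <:].

Let finsuppseq_submod : GRing.subsemimod_closed finsuppseq.
Proof.
split; [split|].
- by apply/mem_set; exists 0%N.
- move=> f g /set_mem[N fN] /set_mem[M gM]; apply/mem_set.
  exists (maxn N M) => n; rewrite geq_max => /andP[Nn Mn].
  transitivity (f n + g n) => //; rewrite fN// gM//; exact: addr0.
- move=> k f /set_mem[N fN]; apply/mem_set; exists N => n Nn.
  transitivity (k *: f n) => //; rewrite fN//; exact: scaler0.
Qed.

HB.instance Definition _ := GRing.isSubmodClosed.Build _ _ finsuppseq
  finsuppseq_submod.
HB.instance Definition _ := GRing.SubChoice_isSubLmodule.Build _ _ _ covpoly
  (GRing.subsemimodClosedP _).

End FiniteSequences.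

(* The finitely supported sequence f stands for \sum_n U^n f_n in the algebra
   generated by C(X) and U subject to f U = U (f \o phi). *)
Definition covalg (X : topologicalType) (K : numClosedFieldType)
  (phi : continuousType X X) : Type := covpoly X K.
HB.instance Definition _ X K phi := GRing.Lmodule.on (@covalg X K phi).

Section PolynomialAlgebra.
Context (X : topologicalType) (K : numClosedFieldType).
Context (phi : continuousType X X).
Local Notation CX := (contfun X K).
Local Notation covalg := (covalg K phi).

Definition precomp (f : CX) : CX := f \o phi.

Let pullE n (f : CX) x : iter n precomp f x = f (iter n phi x).
Proof. by elim: n x => //= n IH x; rewrite /precomp /= IH -iterSr. Qed.

Let pullD n : {morph iter n precomp : f g / f + g}.
Proof.
move=> f g; apply/continuousEP => x; rewrite pullE.
transitivity (iter n precomp f x + iter n precomp g x) => //.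
by rewrite !pullE.
Qed.

Let pullM n : {morph iter n precomp : f g / f * g}.
Proof.
move=> f g; apply/continuousEP => x; rewrite pullE.
transitivity (iter n precomp f x * iter n precomp g x) => //.
by rewrite !pullE.
Qed.

Let pull0 n : iter n precomp 0 = 0.
Proof. by apply/continuousEP => x; rewrite pullE. Qed.

Let pull1 n : iter n precomp 1 = 1.
Proof. by apply/continuousEP => x; rewrite pullE. Qed.

Let pullZ n (k : K) f : iter n precomp (k *: f) = k *: iter n precomp f.
Proof.
apply/continuousEP => x; rewrite pullE.
transitivity (k * iter n precomp f x) => //.
by rewrite !pullE.
Qed.

Let covcoefD (f g : covalg) n : covcoef (f + g) n = covcoef f n + covcoef g n.
Proof. by []. Qed.
Let covcoefZ k (f : covalg) n : covcoef (k *: f) n = k *: covcoef f n.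
Proof. by []. Qed.

Let covalgP (f g : covalg) : (forall n, covcoef f n = covcoef g n) -> f = g.
Proof. by move=> fg; apply/val_inj/funext. Qed.

Let mul_coef (f g : covalg) (n : nat) : CX :=
  \sum_(i < n.+1) iter (n - i) precomp (covcoef f i) * covcoef g (n - i)%N.

Let mul_coefP f g : mul_coef f g \in @finsuppseq X K.
Proof.
apply/mem_set.
have /set_mem[N fN] := covcoefP f; have /set_mem[M gM] := covcoefP g.
exists (N + M)%N => n NMn; apply: big1 => i _.
have [Ni|iN] := leqP N i; first by rewrite fN// pull0; exact: mul0r.
by rewrite gM; [exact: mulr0|lia].
Qed.

(* (U^i f)(U^j g) = U^(i + j) (f \o phi^j) g *)
Definition covmul (f g : covalg) : covalg := CovPoly (mul_coefP f g).

Let monomP (f : CX) (k : nat) :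
  (fun n => if n == k then f else 0) \in @finsuppseq X K.
Proof.
by apply/mem_set; exists k.+1 => n; case: eqP => // -> /=; rewrite ltnn.
Qed.

(* U^k f *)
Definition covmonom (k : nat) (f : CX) : covalg := CovPoly (monomP f k).

Let coef_mul f g n : covcoef (covmul f g) n =
  \sum_(i < n.+1) iter (n - i) precomp (covcoef f i) * covcoef g (n - i)%N.
Proof. by []. Qed.

Let coef_mul_rev f g n : covcoef (covmul f g) n =
  \sum_(i < n.+1) iter i precomp (covcoef f (n - i)%N) * covcoef g i.
Proof.
rewrite coef_mul (reindex_inj rev_ord_inj) /=.
by apply: eq_bigr => i _; rewrite (sub_ordK i).
Qed.

Let pull_sum n I (r : seq I) (P : pred I) (F : I -> CX) :
  iter n precomp (\sum_(i <- r | P i) F i) =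
  \sum_(i <- r | P i) iter n precomp (F i).
Proof. exact: (big_morph _ (pullD n) (pull0 n)). Qed.

Let covmulA : associative covmul.
Proof.
move=> p q r; apply: covalgP => i; rewrite coef_mul coef_mul_rev.
pose coef3 j k := iter (i - j) precomp (covcoef p j) *
  (iter k precomp (covcoef q (i - j - k)%N) * covcoef r k).
transitivity (\sum_(j < i.+1) \sum_(k < i.+1 | (k <= i - j)%N) coef3 j k).
  apply: eq_bigr => j _; rewrite coef_mul_rev big_distrr /=.
  by rewrite (big_ord_narrow_leq (leq_subr _ _)).
rewrite (exchange_big_dep predT)//; apply: eq_bigr => k _.
transitivity (\sum_(j < i.+1 | (j <= i - k)%N) coef3 j k).
  apply: eq_bigl => j; rewrite -ltnS -(ltnS j) -!subSn ?leq_ord //.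
  by rewrite -subn_gt0 -(subn_gt0 j) -!subnDA addnC.
rewrite (big_ord_narrow_leq (leq_subr _ _)) coef_mul pull_sum big_distrl /=.
apply: eq_bigr => j _; rewrite /coef3 pullM -iterD mulrA.
have lej : (j <= i - k)%N by rewrite -ltnS.
have lek : (k <= i)%N by rewrite -ltnS.
by congr (iter _ _ _ * iter _ _ (covcoef q _) * _); lia.
Qed.

Let covone : covalg := covmonom 0 1.

Let covmul1 : right_id covone covmul.
Proof.
move=> p; apply: covalgP => i; rewrite coef_mul_rev big_ord_recl subn0 /=.
by rewrite big1 => [|j _]; rewrite ?mulr0// mulr1 addr0.
Qed.

Let cov1mul : left_id covone covmul.
Proof.
move=> p; apply: covalgP => i; rewrite coef_mul big_ord_recl subn0 /=.
by rewrite big1 => [|j _]; rewrite ?pull0 ?mul0r// pull1 mul1r addr0.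
Qed.

Let covmulDl : left_distributive covmul +%R.
Proof.
move=> p q r; apply: covalgP => i; rewrite covcoefD !coef_mul -big_split.
by apply: eq_bigr => j _; rewrite covcoefD pullD mulrDl.
Qed.

Let covmulDr : right_distributive covmul +%R.
Proof.
move=> p q r; apply: covalgP => i; rewrite covcoefD !coef_mul -big_split.
by apply: eq_bigr => j _; rewrite covcoefD mulrDr.
Qed.

Let cts_scalerAl (k : K) (f g : CX) : (k *: f) * g = k *: (f * g).
Proof. by apply/continuousEP => x; rewrite -[RHS]/(k * (f x * g x)) mulrA. Qed.

Let cts_scalerAr (k : K) (f g : CX) : f * (k *: g) = k *: (f * g).
Proof. by rewrite mulrC cts_scalerAl mulrC. Qed.

Let covmulZl (k : K) p q : covmul (k *: p) q = k *: covmul p q.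
Proof.
apply: covalgP => i; rewrite covcoefZ !coef_mul scaler_sumr.
by apply: eq_bigr => j _; rewrite covcoefZ pullZ cts_scalerAl.
Qed.

Let covmulZr (k : K) p q : covmul p (k *: q) = k *: covmul p q.
Proof.
apply: covalgP => i; rewrite covcoefZ !coef_mul scaler_sumr.
by apply: eq_bigr => j _; rewrite covcoefZ cts_scalerAr.
Qed.

HB.instance Definition _ := Lmodule_isUAlgebra.Build K covalg
  covmulA cov1mul covmul1 covmulDl covmulDr covmulZl covmulZr.

End PolynomialAlgebra.

Section Representations.
Context (R : realType).

Definition cplx : numClosedFieldType :=
  Eval cbv [reverse_coercion] in (R[i] : numClosedFieldType).

(* The library norm takes its values in the field of scalars. *)
Definition rnorm (V : normedModType cplx) (x : V) : R := complex.Re `|x|.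

Definition opnorm (H : hilbertType cplx) (T : H -> H) : \bar R :=
  ereal_sup [set (rnorm (T x))%:E | x in [set x : H | rnorm x <= 1]].

(* Norm of the operator matrix T acting on the direct sum of n copies of H. *)
Definition mx_opnorm (H : hilbertType cplx) n (T : 'M[H -> H]_n) : \bar R :=
  ereal_sup
    [set (Num.sqrt (\sum_i rnorm (\sum_j T i j (x j)) ^+ 2))%:E |
      x in [set x : 'I_n -> H | \sum_j rnorm (x j) ^+ 2 <= 1]].

(* Homomorphisms into the bounded operators on H, not assumed unital; for
   is_cov_rep below, being unital follows from U 1 = U and U being isometric. *)
Record is_hom (A : ualgType cplx) (H : hilbertType cplx) (pi : A -> H -> H)
    : Prop := IsHom {
  hom_op_linear : forall a, linear (pi a);
  hom_op_bounded : forall a, exists M : R,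
    forall x, rnorm (pi a x) <= M * rnorm x;
  hom_linear : forall (k : cplx) a b x,
    pi (k *: a + b) x = k *: pi a x + pi b x;
  hom_mul : forall a b x, pi (a ** b) x = pi a (pi b x)
}.

Definition adjoint_ops (H : hilbertType cplx) (S T : H -> H) : Prop :=
  forall x y, inner (S x) y = inner x (T y).

Section Semicrossed.
Context (X : topologicalType) (phi : continuousType X X).

Definition cov_fun (f : contfun X cplx) : covalg cplx phi := covmonom phi 0 f.
Definition cov_gen : covalg cplx phi := covmonom phi 1 1.

Record is_cov_rep (H : hilbertType cplx) (pi : covalg cplx phi -> H -> H)
    : Prop := IsCovRep {
  cov_rep_hom : is_hom pi;
  cov_rep_star : forall f,
    adjoint_ops (pi (cov_fun f)) (pi (cov_fun (contfun_conj f)));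
  cov_rep_isometry : forall x, rnorm (pi cov_gen x) = rnorm x
}.

Definition cov_norm (F : covalg cplx phi) : \bar R :=
  ereal_sup [set r | exists (H : hilbertType cplx)
    (pi : covalg cplx phi -> H -> H), is_cov_rep pi /\ r = opnorm (pi F)].

(* A, together with iota, is the completion of the algebra of polynomials. *)
Definition is_semicrossed (A : banachAlgType cplx)
    (iota : algMorphism (covalg cplx phi) A) : Prop :=
  (forall F, (rnorm (iota F))%:E = cov_norm F) /\ dense (range iota).

(* The representations of the completion A are the continuous extensions of
   those of the algebra of polynomials. *)
Definition is_semicrossed_rep (A : banachAlgType cplx)
    (iota : algMorphism (covalg cplx phi) A)
    (H : hilbertType cplx) (pi : A -> H -> H) : Prop :=
  [/\ is_hom pi, is_cov_rep (pi \o iota) &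
      forall a x, rnorm (pi a x) <= rnorm a * rnorm x].

Definition semicrossed_mxnorm (A : banachAlgType cplx)
    (iota : algMorphism (covalg cplx phi) A) n (F : 'M[A]_n) : \bar R :=
  ereal_sup [set r | exists (H : hilbertType cplx) (pi : A -> H -> H),
    is_semicrossed_rep iota pi /\ r = mx_opnorm (map_mx pi F)].

End Semicrossed.

Definition is_star_rep (B : cstarAlgType cplx) (H : hilbertType cplx)
    (pi : B -> H -> H) : Prop :=
  is_hom pi /\ forall b, adjoint_ops (pi b) (pi (star b)).

(* The C*-norm of n x n matrices over B, which the supremum over all
   *-representations computes because faithful ones are isometric. *)
Definition cstar_mxnorm (B : cstarAlgType cplx) n (F : 'M[B]_n) : \bar R :=
  ereal_sup [set r | exists (H : hilbertType cplx) (pi : B -> H -> H),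
    is_star_rep pi /\ r = mx_opnorm (map_mx pi F)].

Definition mxnorms (A : Type) := forall n, 'M[A]_n -> \bar R.

Definition completely_isometric (A B : Type) (NA : mxnorms A) (NB : mxnorms B)
    (j : A -> B) : Prop :=
  forall n (F : 'M[A]_n), NB n (map_mx j F) = NA n F.

Definition star_subalgebra (B : cstarAlgType cplx) (S : set B) : Prop :=
  [/\ forall (k : cplx) a b, S a -> S b -> S (k *: a + b),
      forall a b, S a -> S b -> S (a ** b) &
      forall a, S a -> S (star a)].

Definition generates (B : cstarAlgType cplx) (G : set B) : Prop :=
  forall S : set B, star_subalgebra S -> closed S -> G `<=` S -> S = setT.

(* No generality is lost in considering only unital covers: the image of the
   unit of A is a unit for the C*-algebra generated by the image of A. *)
Definition is_cstar_cover (A : ualgType cplx) (NA : mxnorms A)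
    (B : cstarAlgType cplx) (j : algMorphism A B) : Prop :=
  completely_isometric NA (@cstar_mxnorm B) j /\ generates (range j).

(* The C*-envelope is the smallest C*-cover: every other one maps onto it. *)
Definition is_cstar_envelope (A : ualgType cplx) (NA : mxnorms A)
    (E : cstarAlgType cplx) (j : algMorphism A E) : Prop :=
  is_cstar_cover NA j /\
  forall (D : cstarAlgType cplx) (i : algMorphism A D), is_cstar_cover NA i ->
    exists q : algMorphism D E,
      {morph q : d / star d} /\ forall a, q (i a) = j a.

Definition is_left_ideal (A : ualgType cplx) (I : set A) : Prop :=
  [/\ I 0, forall a b, I a -> I b -> I (a + b) &
      forall a b, I b -> I (a ** b)].

Definition is_right_ideal (A : ualgType cplx) (I : set A) : Prop :=
  [/\ I 0, forall a b, I a -> I b -> I (a + b) &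
      forall a b, I a -> I (a ** b)].

(* The zero algebra is not excluded. *)
Definition is_simple (B : cstarAlgType cplx) : Prop :=
  forall I : set B, is_left_ideal I -> is_right_ideal I -> closed I ->
    I = [set 0] \/ I = setT.

Definition is_maximal_left_ideal (A : ualgType cplx) (I : set A) : Prop :=
  [/\ is_left_ideal I, I <> setT &
      forall J, is_left_ideal J -> I `<=` J -> J = I \/ J = setT].

Definition jacobson_radical (A : ualgType cplx) : set A :=
  [set a | forall I : set A, is_maximal_left_ideal I -> I a].

Definition is_semisimple (A : ualgType cplx) : Prop :=
  @jacobson_radical A = [set 0].

End Representations.

(* Main.v *)
(* The envelope E is a quotient of a concrete C*-cover in which U is an
   isometry and the functions are *-represented, so these relations hold in E.
   If f <> 0 vanished along the forward orbit of a point x, the elements b of E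
   such that b U^L is approximated by polynomials with coefficients vanishing
   on this orbit would form a proper closed ideal of E containing f; hence, E
   being simple, every orbit visits the set f <> 0, and by compactness it does so
   at a uniformly bounded time.

   The gauge automorphisms U -> t U, |t| = 1, preserve the Jacobson radical, which is
   closed, so it contains the Fourier component U^n f_n of each of its elements,
   and some f_n <> 0 unless the element is zero.  Multiplying by U if n = 0, the
   radical contains c = \sum_(k < N) U^n |f_n|^2 U^k.  If 1 - z c is invertible
   then, in an orbit representation, w = (1 - z c)^-1 e_0 has nonnegative
   coordinates and satisfies w = e_0 + z c w; when z is large, uniform return
   forces the partial sums of w to grow exponentially, although w is bounded. *)
From HB Require Import structures.
From mathcomp Require Import all_boot all_order all_algebra sesquilinear complex.
From mathcomp Require Import zify ring lra.
From mathcomp Require Import all_classical all_reals all_analysis.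
Require Import Defs.
Set Implicit Arguments.
Unset Strict Implicit.
Unset Printing Implicit Defensive.
Import Order.TTheory GRing.Theory Num.Theory.
Import numFieldNormedType.Exports.
Local Open Scope classical_set_scope.
Local Open Scope ring_scope.
Local Notation "x %:C" := (real_complex _ x) : ring_scope.

(** * Norms, sequential limits and completeness *)

Section Basics.
Context (R : realType).
Local Notation K := (cplx R).

(** The obstacle is that an orbit representation is defined on the semicrossed product but need not
    extend to the envelope, where U^* and simplicity are available. Its kernel is therefore
    transported by hand, and the factor U^L is what allows this: left multiplication by U^* leaves
    the polynomials, but F U = U G makes U^* F U = G a polynomial again, so each U^* costs one more
    U on the right. The resulting ideal is proper because U^L has coefficient 1 in degree L at x,
    and coefficients at x are bounded by norms computed in A.

    Norms in the envelope are taken in its universal *-representation, since complete isometry is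
    expressed through representations; contractivity of *-representations links them to the norm of
    E.

    The return time depends on the point. Summing over all delays k < N in c lets every return feed
    a single recurrence, and positivity excludes the cancellations that could hide its growth. A
    positive power of U makes the recurrence strictly backward.

    The circle action is probed along the powers of one rotation of infinite order, Cesaro means
    replacing integration over the circle. *)

Lemma half_gt0 (e : R) : 0 < e -> 0 < e / 2.
Proof. by move=> e0; rewrite divr_gt0. Qed.

Definition cabs (k : K) : R := complex.Re `|k|.

Lemma normr_rnorm (V : normedModType K) (x : V) : `|x| = (rnorm x)%:C :> K.
Proof. by rewrite /rnorm (RRe_real (normr_real x)). Qed.

Lemma normr_cabs (k : K) : `|k| = (cabs k)%:C :> K.
Proof. by rewrite /cabs (RRe_real (normr_real k)). Qed.

Lemma cabsE (k : K) : cabs k = Num.sqrt (complex.Re k ^+ 2 + complex.Im k ^+ 2).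
Proof. by rewrite /cabs normc_def. Qed.

Lemma cabs_ge0 k : 0 <= cabs k.
Proof. by rewrite -lecR -normr_cabs normr_ge0. Qed.

Lemma cabsM k l : cabs (k * l) = cabs k * cabs l.
Proof. by apply: complexI; rewrite -normr_cabs normrM !normr_cabs rmorphM. Qed.

Lemma cabsD k l : cabs (k + l) <= cabs k + cabs l.
Proof.
by rewrite -lecR -normr_cabs rmorphD /= -!normr_cabs ler_normD.
Qed.

Lemma cabs0 : cabs 0 = 0.
Proof. by apply: complexI; rewrite -normr_cabs normr0. Qed.

Lemma cabs1 : cabs 1 = 1.
Proof. by apply: complexI; rewrite -normr_cabs normr1. Qed.

Lemma cabsN k : cabs (- k) = cabs k.
Proof. by apply: complexI; rewrite -!normr_cabs normrN. Qed.

Lemma cabsC (k l : K) : cabs (k - l) = cabs (l - k).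
Proof. by rewrite -cabsN opprB. Qed.

Lemma cabsX k n : cabs (k ^+ n) = cabs k ^+ n.
Proof. by elim: n => [|n IH]; rewrite ?expr0 ?cabs1// !exprS cabsM IH. Qed.

Lemma cabsV k : cabs k^-1 = (cabs k)^-1.
Proof.
by apply: complexI; rewrite -normr_cabs normfV normr_cabs fmorphV.
Qed.

Lemma cabs_conj (k : K) : cabs k^* = cabs k.
Proof. by apply: complexI; rewrite -!normr_cabs norm_conjC. Qed.

Lemma cabs_real (r : R) : cabs r%:C = `|r|.
Proof. by rewrite cabsE /= expr0n /= addr0 sqrtr_sqr. Qed.

Lemma cabs_eq0 k : cabs k = 0 -> k = 0.
Proof. by move=> k0; apply/eqP; rewrite -normr_eq0 normr_cabs k0. Qed.

Lemma cabs_sqr (k : K) : (cabs k ^+ 2)%:C = k * k^*.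
Proof. by rewrite rmorphXn /= -normr_cabs normCK. Qed.

Lemma Re_cabs (k : K) : complex.Re k <= cabs k.
Proof.
rewrite cabsE (le_trans (ler_norm _))// -sqrtr_sqr ler_wsqrtr//.
by rewrite lerDl sqr_ge0.
Qed.

Lemma norm_Re_cabs (k : K) : `|complex.Re k| <= cabs k.
Proof.
by rewrite cabsE -sqrtr_sqr ler_wsqrtr// lerDl sqr_ge0.
Qed.

Lemma norm_Im_cabs (k : K) : `|complex.Im k| <= cabs k.
Proof.
by rewrite cabsE -sqrtr_sqr ler_wsqrtr// lerDr sqr_ge0.
Qed.

Lemma cReD (k l : K) : complex.Re (k + l) = complex.Re k + complex.Re l.
Proof. by case: k; case: l. Qed.
Lemma cReN (k : K) : complex.Re (- k) = - complex.Re k.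
Proof. by case: k. Qed.
Lemma cImD (k l : K) : complex.Im (k + l) = complex.Im k + complex.Im l.
Proof. by case: k; case: l. Qed.
Lemma cImN (k : K) : complex.Im (- k) = - complex.Im k.
Proof. by case: k. Qed.
Lemma cReZ (r : R) (k : K) : complex.Re (r%:C * k) = r * complex.Re k.
Proof. by case: k => a b /=; rewrite mul0r subr0. Qed.
Lemma cReJ (k : K) : complex.Re k^* = complex.Re k.
Proof. by case: k. Qed.

Lemma conj_real (r : R) : (r%:C : K)^* = r%:C.
Proof. exact: conjc_real. Qed.

Section Rnorm.
Context (V : normedModType K).
Implicit Types x y z : V.

Lemma rnorm_ge0 x : 0 <= rnorm x.
Proof. by rewrite -lecR -normr_rnorm normr_ge0. Qed.

Lemma rnormD x y : rnorm (x + y) <= rnorm x + rnorm y.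
Proof. by rewrite -lecR -normr_rnorm rmorphD /= -!normr_rnorm ler_normD. Qed.

Lemma rnorm0 : rnorm (0 : V) = 0.
Proof. by rewrite /rnorm normr0. Qed.

Lemma rnormN x : rnorm (- x) = rnorm x.
Proof. by rewrite /rnorm normrN. Qed.

Lemma rnormC x y : rnorm (x - y) = rnorm (y - x).
Proof. by rewrite -rnormN opprB. Qed.

Lemma rnormZ (k : K) x : rnorm (k *: x) = cabs k * rnorm x.
Proof.
apply: complexI; rewrite -normr_rnorm normrZ normr_cabs normr_rnorm.
by rewrite -rmorphM.
Qed.

Lemma rnorm_eq0 x : rnorm x = 0 -> x = 0.
Proof. by move=> x0; apply/eqP; rewrite -normr_eq0 normr_rnorm x0. Qed.

Lemma rnorm_le0 x : rnorm x <= 0 -> x = 0.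
Proof. by move=> x0; apply/rnorm_eq0/le_anti; rewrite x0 rnorm_ge0. Qed.

Lemma rnorm_tri z x y : rnorm (x - y) <= rnorm (x - z) + rnorm (z - y).
Proof. by rewrite -[x - y](subrKA z) rnormD. Qed.

Lemma rnorm_sum (I : Type) (r : seq I) (P : pred I) (F : I -> V) :
  rnorm (\sum_(i <- r | P i) F i) <= \sum_(i <- r | P i) rnorm (F i).
Proof.
elim/big_rec2 : _ => [|i y x _ yx]; first by rewrite rnorm0.
by rewrite (le_trans (rnormD _ _))// lerD2l.
Qed.

Lemma rnorm_lb x y : rnorm x <= rnorm y + rnorm (x - y).
Proof. by rewrite -{1}(subrK y x) addrC rnormD. Qed.

Definition cvs (u : nat -> V) (l : V) : Prop :=
  forall e : R, 0 < e -> exists n0, forall n, (n0 <= n)%N -> rnorm (u n - l) <= e.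

Definition cauchys (u : nat -> V) : Prop :=
  forall e : R, 0 < e -> exists n0, forall n m, (n0 <= n)%N -> (n0 <= m)%N ->
    rnorm (u n - u m) <= e.

Definition adh (S : set V) (x : V) : Prop :=
  forall e : R, 0 < e -> exists2 y, S y & rnorm (y - x) <= e.

Lemma small_eq0 x : (forall e : R, 0 < e -> rnorm x <= e) -> x = 0.
Proof. by move=> h; apply/rnorm_le0/ler_addgt0Pr => e e0; rewrite add0r h. Qed.

Lemma cvs_unique u l l' : cvs u l -> cvs u l' -> l = l'.
Proof.
move=> ul ul'; apply/subr0_eq/small_eq0 => e e0.
have [n nP] := ul (e / 2) (half_gt0 e0).
have [m mP] := ul' (e / 2) (half_gt0 e0).
rewrite (le_trans (rnorm_tri (u (maxn n m)) _ _))// rnormC [leRHS]splitr.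
by rewrite lerD ?nP ?mP ?leq_maxl ?leq_maxr.
Qed.

Lemma cvs_cauchy u l : cvs u l -> cauchys u.
Proof.
move=> ul e e0; have [n0 nP] := ul (e / 2) (half_gt0 e0).
exists n0 => n m nn nm; rewrite (le_trans (rnorm_tri l _ _))// [leRHS]splitr.
by rewrite lerD ?nP// rnormC nP.
Qed.

Lemma cvs_cst l : cvs (fun=> l) l.
Proof. by move=> e e0; exists 0%N => n _; rewrite subrr rnorm0 ltW. Qed.

Lemma cvsD u v l m : cvs u l -> cvs v m -> cvs (fun n => u n + v n) (l + m).
Proof.
move=> ul vm e e0; have [n nP] := ul (e / 2) (half_gt0 e0).
have [m' mP] := vm (e / 2) (half_gt0 e0).
exists (maxn n m') => k; rewrite geq_max => /andP[nk mk].
by rewrite opprD addrACA (le_trans (rnormD _ _))// [leRHS]splitr lerD ?nP ?mP.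
Qed.

Lemma cvs_le u l (M : R) : cvs u l -> (exists n0, forall n, (n0 <= n)%N -> rnorm (u n) <= M) ->
  rnorm l <= M.
Proof.
move=> ul [n0 uM]; apply/ler_addgt0Pr => e e0.
have [n nP] := ul e e0; rewrite (le_trans (rnorm_lb l (u (maxn n0 n))))//.
by rewrite lerD ?uM ?leq_maxl// rnormC nP// leq_maxr.
Qed.

Lemma adh_cvs (S : set V) x : adh S x ->
  exists u : nat -> V, (forall n, S (u n)) /\ cvs u x.
Proof.
move=> Sx; have H n : {y | S y /\ rnorm (y - x) <= n.+1%:R^-1}.
  by apply: cid; have [|y Sy yx] := Sx n.+1%:R^-1; [rewrite invr_gt0|exists y].
exists (fun n => sval (H n)); split=> [n|e e0]; first by case: (svalP (H n)).
exists (Num.truncn e^-1) => n en; have [_ /le_trans->]// := svalP (H n).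
rewrite invf_ple ?posrE// ltW//; apply: (lt_le_trans (truncnS_gt _)).
by rewrite ler_nat ltnS.
Qed.

(** Bridge between the topology, whose balls have radii in [K], and the weak real inequalities used
    below; halving the radius absorbs the strictness. *)
Lemma nbhs_rnorm (S : set V) x :
  nbhs x S <-> exists2 e : R, 0 < e & forall y, rnorm (y - x) <= e -> S y.
Proof.
split=> [/nbhs_ballP[e /= e0 eS]|[e e0 eS]].
  have /complex_realP[r re] := gtr0_real e0.
  move: e0; rewrite re ltcR => r0; exists (r / 2); first exact: divr_gt0.
  move=> y yx; apply: eS; rewrite -ball_normE /= normr_rnorm re ltcR rnormC.
  by rewrite (le_lt_trans yx)// ltr_pdivrMr// ltr_pMr// ltr1n.
apply/nbhs_ballP; exists e%:C => /=; first by rewrite ltcR.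
move=> y; rewrite -ball_normE /= normr_rnorm ltcR rnormC => /ltW.
exact: eS.
Qed.

Lemma closedP (S : set V) : closed S <-> forall x, adh S x -> S x.
Proof.
split=> [cS x Sx|h x Sx].
  apply: cS => B /nbhs_rnorm[e e0 eB]; have [y Sy yx] := Sx e e0.
  by exists y; split=> //; exact: eB.
apply: h => e e0; have [|y [Sy By]] := Sx [set y | rnorm (y - x) <= e].
  by apply/nbhs_rnorm; exists e.
by exists y.
Qed.

Lemma dense_adh (S : set V) x : dense S -> adh S x.
Proof.
move=> dS e e0.
(* A hand-made interior of the closed [e]-ball: the points around which some closed ball fits inside
   it, an open condition by halving that ball. *)
have [||y [By Sy]] := dS [set y | exists2 d, 0 < d & forall z, rnorm (z - y) <= d -> rnorm (z - x) <= e].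
- by exists x, e.
- rewrite openE => y [d d0 dP]; apply/nbhs_rnorm.
  exists (d / 2); first exact: divr_gt0.
  move=> z zy; exists (d / 2); first exact: divr_gt0.
  move=> t tz; apply: dP; rewrite (le_trans (rnorm_tri z _ _))// [leRHS]splitr.
  by rewrite lerD.
- exists y => //; case: By => d d0; apply; by rewrite subrr rnorm0 ltW.
Qed.

End Rnorm.

Lemma cauchys_cvg (V : completeNormedModType K) (u : nat -> V) :
  cauchys u -> exists l, cvs u l.
Proof.
move=> cu; have /cauchy_cvg : cauchy (u @ \oo).
  apply/cauchy_ballP => e e0; rewrite near_simpl.
  have /complex_realP[r re] := gtr0_real e0.
  move: e0; rewrite re ltcR => r0.
  have [|n0 nP] := cu (r / 2); first exact: divr_gt0.
  near=> n m => /=; rewrite -ball_normE /= normr_rnorm ltcR.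
  rewrite (le_lt_trans (nP _ _ _ _))//; try by near: n; exists n0.
    by near: m; exists n0.
  by rewrite ltr_pdivrMr// ltr_pMr// ltr1n.
move=> /cvg_ex[l ul]; exists l => e e0.
have : \forall n \near \oo, rnorm (u n - l) <= e.
  by apply: (ul [set y | rnorm (y - l) <= e]); apply/nbhs_rnorm; exists e.
by case=> n0 _ nP; exists n0.
Unshelve. all: by end_near. Qed.

(** The filter contains sets [A n] of diameter at most 1/(n+1). Points [u n] common to the first of
    them form a Cauchy sequence, and its limit is the limit of the filter. *)
Lemma cauchy_cvg_seq (V : normedModType K) :
  (forall u : nat -> V, cauchys u -> exists l, cvs u l) ->
  forall F : set_system V, ProperFilter F -> cauchy F -> cvg F.
Proof.
move=> cV F FF /cauchy_ballP cF.
have H n : {A : set V | F A /\ forall x y, A x -> A y -> rnorm (x - y) <= n.+1%:R^-1}.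
  apply: cid; have /cF : 0 < (n.+1%:R^-1)%:C :> K by rewrite ltcR invr_gt0.
  case=> [[A B] /= [FA FB] AB]; exists (A `&` B); split; first exact: filterI.
  move=> x y [Ax _] [_ By]; have := AB (x, y) (conj Ax By).
  by rewrite /= -ball_normE /= normr_rnorm ltcR => /ltW.
pose A n := sval (H n); have FA n : F (A n) by case: (svalP (H n)).
have AP n x y : A n x -> A n y -> rnorm (x - y) <= n.+1%:R^-1.
  by case: (svalP (H n)) => _; exact.
have FI n : F [set x | forall k, (k <= n)%N -> A k x].
  elim: n => [|n IH].
    by apply: filterS (FA 0%N) => x Ax k; rewrite leqn0 => /eqP ->.
  apply: filterS (filterI IH (FA n.+1)) => x [Ax Anx] k.
  by rewrite leq_eqVlt => /predU1P[->//|]; rewrite ltnS; exact: Ax.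
have /choice[u uP] : forall n, exists x, forall k, (k <= n)%N -> A k x.
  by move=> n; exact: filter_ex (FI n).
have arch e : 0 < e -> exists n, n.+1%:R^-1 <= e :> R.
  move=> e0; exists (Num.truncn e^-1).
  by rewrite invf_ple ?posrE// ltW// truncnS_gt.
have [e e0|l ul] := cV u.
  have [n ne] := arch e e0; exists n => i j ni nj; apply: le_trans ne.
  by apply: AP; exact: uP.
apply/cvg_ex; exists l => B /nbhs_rnorm[e e0 eB].
have [n ne] := arch (e / 2) (half_gt0 e0).
have [m mP] := ul (e / 2) (half_gt0 e0).
apply: (filterS _ (FA n)) => x Ax; apply: eB.
rewrite (le_trans (rnorm_tri (u (maxn n m)) _ _))// [leRHS]splitr lerD//.
  by rewrite (le_trans _ ne)// AP//; apply: uP; rewrite leq_maxl.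
by rewrite mP// leq_maxr.
Qed.

End Basics.

(** * Banach spaces from gauges *)

Section GaugeSpace.
Context (R : realType).
Local Notation K := (cplx R).

(* [gle x r] reads "the norm of x is at most r", the elements without finite
   bound being discarded. *)
Record gauge (M : lmodType K) := Gauge {
  gle :> M -> R -> Prop;
  gle_ge0 : forall x r, gle x r -> 0 <= r;
  gle_sep : forall x, gle x 0 -> x = 0;
  gle_lim : forall x r, (forall e, 0 < e -> gle x (r + e)) -> gle x r;
  gle0 : gle 0 0;
  gleD : forall x y r s, gle x r -> gle y s -> gle (x + y) (r + s);
  gleZ : forall k x r, gle x r -> gle (k *: x) (cabs k * r);
  gle_mono : forall x r s, gle x r -> r <= s -> gle x s;
  gle_complete : forall u : nat -> M,
    (forall n, exists r, gle (u n) r) ->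
    (forall e, 0 < e -> exists n0, forall n m, (n0 <= n)%N -> (n0 <= m)%N ->
      gle (u n - u m) e) ->
    exists l, forall e, 0 < e -> exists n0, forall n, (n0 <= n)%N ->
      gle (u n - l) e
}.

Context (M : lmodType K) (g : gauge M).

Definition gdom : {pred M} := mem [set x | exists r, g x r].

Record gspace := GSpace { gval :> M; gvalP : gval \in gdom }.

HB.instance Definition _ := [isSub for gval].
HB.instance Definition _ := [Choice of gspace by <:].

Let gdom_submod : GRing.subsemimod_closed gdom.
Proof.
split; [split|].
- by apply/mem_set; exists 0; exact: gle0.
- move=> x y /set_mem[r xr] /set_mem[s ys]; apply/mem_set.
  by exists (r + s); exact: gleD.
- move=> k x /set_mem[r xr]; apply/mem_set.
  by exists (cabs k * r); exact: gleZ.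
Qed.

HB.instance Definition _ := GRing.isSubmodClosed.Build _ _ gdom gdom_submod.
HB.instance Definition _ := GRing.SubChoice_isSubLmodule.Build _ _ _ gspace
  (GRing.subsemimodClosedP _).

Lemma gvalD (x y : gspace) : gval (x + y) = gval x + gval y.
Proof. by []. Qed.
Lemma gvalZ k (x : gspace) : gval (k *: x) = k *: gval x.
Proof. by []. Qed.
Lemma gval0 : gval 0 = 0.
Proof. by []. Qed.
Lemma gval_sum I (r : seq I) (P : pred I) (F : I -> gspace) :
  gval (\sum_(i <- r | P i) F i) = \sum_(i <- r | P i) gval (F i).
Proof. exact: (big_morph gval gvalD gval0). Qed.

Let rn (x : gspace) : R := inf [set r | g x r].

(** By [gle_lim] the infimum is attained, so norm bounds and gauge bounds are interchangeable. *)
Let rnP x r : rn x <= r <-> g x r.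
Proof.
have lb : lbound [set r | g x r] 0 by move=> s /= /gle_ge0.
have ne : [set r | g x r] !=set0 by have /set_mem[s xs] := gvalP x; exists s.
have hi : has_inf [set r | g x r] by split=> //; exists 0.
split=> [xr|xr]; last by apply: ge_inf => //; exists 0.
apply: gle_lim => e e0.
have [s /= xs sr] := inf_adherent e0 hi.
by apply: (gle_mono xs); rewrite (le_trans (ltW sr))// lerD2r.
Qed.

Let rn_ge0 x : 0 <= rn x.
Proof. by apply: gle_ge0; apply/rnP. Qed.

Let gn (x : gspace) : K := (rn x)%:C.

Let gnD x y : gn (x + y) <= gn x + gn y.
Proof.
by rewrite /gn -rmorphD lecR; apply/rnP; apply: gleD; exact/rnP.
Qed.

Let gnZ k x : gn (k *: x) = `|k| * gn x.
Proof.
have le k' y : rn (k' *: y) <= cabs k' * rn y.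
  by apply/rnP; apply: gleZ; exact/rnP.
rewrite /gn normr_cabs -rmorphM; congr (_%:C); apply/le_anti; rewrite le/=.
have [->|k0] := eqVneq k 0; first by rewrite cabs0 mul0r.
have ck : 0 < cabs k.
  by rewrite lt_neqAle cabs_ge0 andbT eq_sym; apply: contra_neq k0 => /cabs_eq0.
(* The reverse inequality is the same one for [k^-1], applied to [k *: x]. *)
have := le k^-1 (k *: x); rewrite scalerA mulVf// scale1r cabsV.
by rewrite ler_pdivlMl.
Qed.

Let gn_eq0 x : gn x = 0 -> x = 0.
Proof.
move=> /complexI xn; apply/val_inj; apply: (gle_sep (g := g)).
by apply/rnP; rewrite xn.
Qed.

HB.instance Definition _ := Lmodule_isNormed.Build K gspace gnD gnZ gn_eq0.

Lemma rnormP (x : gspace) r : rnorm x <= r <-> g x r.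
Proof. by rewrite -rnP. Qed.

Lemma gval_rnorm (x : gspace) : g x (rnorm x).
Proof. exact/rnormP. Qed.

Let gspace_complete (u : nat -> gspace) : cauchys u -> exists l, cvs u l.
Proof.
move=> cu.
have [||l lP] := @gle_complete _ g (fun n => gval (u n)).
- by move=> n; exists (rnorm (u n)); exact: gval_rnorm.
- move=> e e0; have [n0 nP] := cu e e0; exists n0 => n m n0n n0m.
  by apply/(rnormP (u n - u m)); exact: nP.
have ld : l \in gdom.
  apply/mem_set; have [n nP] := lP 1 ltr01.
  exists (rnorm (u n) + cabs (- 1) * 1).
  have := gleD (gval_rnorm (u n)) (gleZ (-1) (nP n (leqnn n))).
  by rewrite scaleN1r opprB addrCA subrr addr0.
exists (GSpace ld) => e e0; have [n0 nP] := lP e e0.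
by exists n0 => n n0n; apply/rnormP; exact: nP.
Qed.

HB.instance Definition _ := Uniform_isComplete.Build gspace
  (cauchy_cvg_seq gspace_complete).

End GaugeSpace.

(** * Hilbert spaces and adjoints *)

Section HilbertTheory.
Context (R : realType) (H : hilbertType (cplx R)).
Local Notation K := (cplx R).
Implicit Types x y z v w : H.

Lemma innerDl x y z : inner (x + y) z = inner x z + inner y z.
Proof. exact: (linearDl inner z x y). Qed.
Lemma innerDr x y z : inner z (x + y) = inner z x + inner z y.
Proof. exact: (linearDr inner z x y). Qed.
Lemma innerZl (k : K) x z : inner (k *: x) z = k * inner x z.
Proof. exact: (linearZl_LR inner z k x). Qed.
Lemma innerZr (k : K) x z : inner z (k *: x) = k^* * inner z x.
Proof. exact: (linearZr_LR inner z k x). Qed.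
Lemma innerNl x z : inner (- x) z = - inner x z.
Proof. by rewrite -scaleN1r innerZl mulN1r. Qed.
Lemma innerNr x z : inner z (- x) = - inner z x.
Proof. by rewrite -scaleN1r innerZr rmorphN rmorph1 mulN1r. Qed.
Lemma innerBr x y z : inner z (x - y) = inner z x - inner z y.
Proof. by rewrite innerDr innerNr. Qed.
Lemma inner0r z : inner z 0 = 0.
Proof. by rewrite -(scale0r (0 : H)) innerZr rmorph0 mul0r. Qed.
Lemma inner_conj x y : inner x y = (inner y x)^*.
Proof. by have := @hermitian_subproof _ _ _ _ inner x y; rewrite expr0 mul1r. Qed.

Lemma inner_rnorm x : inner x x = (rnorm x ^+ 2)%:C.
Proof. by rewrite -normr_inner normr_rnorm rmorphXn. Qed.

Lemma rnorm_sqr x : rnorm x ^+ 2 = complex.Re (inner x x).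
Proof. by rewrite inner_rnorm. Qed.

Lemma Re_innerC x y : complex.Re (inner x y) = complex.Re (inner y x).
Proof. by rewrite inner_conj cReJ. Qed.

Lemma rnorm_sqrD x y :
  rnorm (x + y) ^+ 2 = rnorm x ^+ 2 + rnorm y ^+ 2 + 2 * complex.Re (inner x y).
Proof.
rewrite !rnorm_sqr innerDl !innerDr !cReD (Re_innerC y x); ring.
Qed.

Lemma rnorm_sqrB x y :
  rnorm (x - y) ^+ 2 = rnorm x ^+ 2 + rnorm y ^+ 2 - 2 * complex.Re (inner x y).
Proof. by rewrite rnorm_sqrD rnormN innerNr cReN mulrN. Qed.

Lemma cauchy_schwarz x y : cabs (inner x y) <= rnorm x * rnorm y.
Proof.
have [->|y0] := eqVneq y 0; first by rewrite inner0r cabs0 rnorm0 mulr0.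
have ny : 0 < rnorm y.
  by rewrite lt_neqAle rnorm_ge0 andbT eq_sym; apply: contra_neq y0 => /rnorm_eq0.
(* Expanded, this reads |y|^2 (|x|^2 |y|^2 - |<x, y>|^2) >= 0. *)
have := sqr_ge0 (rnorm ((rnorm y ^+ 2)%:C *: x - inner x y *: y)).
rewrite rnorm_sqrB !rnormZ cabs_real ger0_norm ?sqr_ge0//.
rewrite innerZl innerZr cReZ mulrC -[(inner x y)^* * _]mulrC -cabs_sqr /=.
set a := cabs _; set b := rnorm x; set c := rnorm y => h.
rewrite -ler_sqr ?nnegrE ?mulr_ge0 ?rnorm_ge0 ?cabs_ge0//.
rewrite -subr_ge0 -(pmulr_rge0 _ (exprn_gt0 2 ny)).
apply: le_trans h _; rewrite -subr_ge0.
by rewrite le_eqVlt; apply/orP; left; apply/eqP; ring.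
Qed.

Lemma inner_inj v w : (forall x, inner x v = inner x w) -> v = w.
Proof.
move=> vw; apply/subr0_eq/rnorm_eq0/eqP; rewrite -sqrf_eq0 rnorm_sqr.
by rewrite innerBr vw subrr.
Qed.

(** Reduces complex identities to real parts, which is where polarisation and variational arguments
    give information. *)
Lemma complex_eqP (a b : K) : complex.Re a = complex.Re b ->
  complex.Re ('i%C * a) = complex.Re ('i%C * b) -> a = b.
Proof.
case: a b => [a a'] [b b'] /= -> /eqP.
by rewrite !mul0r !mul1r !sub0r eqr_opp => /eqP ->.
Qed.

(** Variational proof: the representing vector maximises the concave functional [G]. A maximising
    sequence converges, and the first variation at its limit gives an inequality of real parts in
    every direction [y]; replacing [y] by [- y] and multiplying by i gives equality. *)
Lemma riesz (psi : H -> K) (M : R) :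
  (forall k x y, psi (k *: x + y) = k * psi x + psi y) ->
  (forall x, cabs (psi x) <= M * rnorm x) ->
  exists v, forall x, psi x = inner x v.
Proof.
move=> psiL psiM.
have psiD x y : psi (x + y) = psi x + psi y.
  by rewrite -[x]scale1r psiL mul1r scale1r.
have psi0 : psi 0 = 0.
  by apply/(@addrI _ (psi 0)); rewrite -psiD !addr0.
have psiZ k x : psi (k *: x) = k * psi x.
  by rewrite -[k *: x]addr0 psiL psi0 addr0.
pose G v := complex.Re (psi v) - rnorm v ^+ 2 / 2.
have GM v : G v <= M ^+ 2 / 2.
  have := le_trans (Re_cabs (psi v)) (psiM v).
  by have := sqr_ge0 (M - rnorm v); rewrite /G; nra.
pose m := sup (range G).
have hs : has_sup (range G).
  by split; [exists (G 0), 0|exists (M ^+ 2 / 2) => _ [v _ <-]].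
have Gm v : G v <= m by apply: ub_le_sup; [case: hs|exists v].
pose t n : R := n.+1%:R^-1.
have t0 n : 0 < t n by rewrite invr_gt0.
have /choice[v vP] n : exists v, m - t n ^+ 2 < G v.
  have [_ [v _ <-]] := sup_adherent (exprn_gt0 2 (t0 n)) hs.
  by exists v.
have ts e : 0 < e -> exists n0, forall n, (n0 <= n)%N -> t n <= e.
  move=> e0; exists (Num.truncn e^-1) => n en.
  rewrite /t invf_ple ?posrE// ltW//; apply: (lt_le_trans (truncnS_gt _)).
  by rewrite ler_nat ltnS.
(* [G] at the midpoint is at most [m]; the parallelogram law turns this into a bound on the
   distance. *)
have vdist i j : rnorm (v i - v j) ^+ 2 <= 4 * (t i ^+ 2 + t j ^+ 2).
  have := Gm (2^-1%:C *: (v i + v j)).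
  have := vP i; have := vP j.
  rewrite /G rnormZ cabs_real ger0_norm ?invr_ge0// psiZ cReZ psiD cReD.
  rewrite exprMn !rnorm_sqrD rnormN innerNr cReN; lra.
have [e e0|l lP] := @cauchys_cvg _ _ v.
  have [n0 nP] := ts (e / 3) (divr_gt0 e0 (ltr0n _ 3)).
  exists n0 => i j ni nj.
  rewrite -ler_sqr ?nnegrE ?rnorm_ge0 ?(ltW e0)//.
  apply: (le_trans (vdist i j)).
  by have := nP i ni; have := nP j nj; have := t0 i; have := t0 j; nra.
exists l => x.
have main y : complex.Re (psi y) <= complex.Re (inner y l).
  apply/ler_addgt0Pr => e e0.
  pose C := 1 + rnorm y ^+ 2 / 2 + rnorm y.
  have ny := rnorm_ge0 y.
  have C0 : 0 < C by rewrite /C; nra.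
  have [n0 nP] := ts (e / 2 / C) (divr_gt0 (half_gt0 e0) C0).
  have [n1 mP] := lP (e / 2 / C) (divr_gt0 (half_gt0 e0) C0).
  pose n := maxn n0 n1.
  have tn : t n * C <= e / 2 by rewrite -ler_pdivlMr// nP// leq_maxl.
  have ln : rnorm (v n - l) * C <= e / 2 by rewrite -ler_pdivlMr// mP// leq_maxr.
  (* [v n] is within [t n ^+ 2] of the supremum, so a move by [t n] along [y] gains at most that
     much; dividing by [t n] leaves an error of order [t n]. *)
  have step : t n * (complex.Re (psi y) - complex.Re (inner y (v n))) <=
     t n * (t n * (1 + rnorm y ^+ 2 / 2)).
    have := Gm (v n + (t n)%:C *: y); have := vP n.
    rewrite /G psiD psiZ cReD cReZ rnorm_sqrD rnormZ cabs_real.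
    rewrite innerZr conj_real cReZ (Re_innerC (v n)).
    rewrite ger0_norm ?(ltW (t0 _))//; lra.
  move: step; rewrite ler_pM2l// => step.
  have cs : complex.Re (inner y (v n)) - complex.Re (inner y l) <=
      rnorm y * rnorm (v n - l).
    by rewrite -cReN -cReD -innerBr (le_trans (Re_cabs _))// cauchy_schwarz.
  have tb : 0 <= t n * rnorm y by rewrite mulr_ge0// ltW.
  have ab : 0 <= rnorm (v n - l) * (1 + rnorm y ^+ 2 / 2).
    by rewrite mulr_ge0 ?rnorm_ge0// addr_ge0// divr_ge0// sqr_ge0.
  by move: tn ln tb ab step cs; rewrite /C; lra.
have main2 z : complex.Re (psi z) = complex.Re (inner z l).
  apply/le_anti; rewrite main/= -lerN2 -!cReN -innerNl.
  by rewrite -[- psi z]mulN1r -psiZ scaleN1r main.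
by apply: complex_eqP => //; rewrite -psiZ -innerZl main2.
Qed.

Definition bounded_op (S : H -> H) : Prop :=
  linear S /\ exists M : R, forall x, rnorm (S x) <= M * rnorm x.

(** Made total by the default 0, which is reached only when no representing vector exists, hence
    never for a bounded operator. *)
Definition adj (S : H -> H) : H -> H :=
  fun y => xget 0 [set z | forall x, inner (S x) y = inner x z].

Lemma adjP (S : H -> H) : bounded_op S -> adjoint_ops S (adj S).
Proof.
move=> [Slin [M SM]] x y; rewrite /adj.
case: xgetP => [z _ ->//|/= Nz]; exfalso.
have [||z zP] := @riesz (fun x => inner (S x) y) (M * rnorm y).
- by move=> k u v; rewrite Slin innerDl innerZl.
- move=> u; apply: (le_trans (cauchy_schwarz _ _)).
  by rewrite mulrAC ler_wpM2r ?rnorm_ge0.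
- exact: (Nz z zP).
Qed.

Lemma adjoint_unique (S T T' : H -> H) :
  adjoint_ops S T -> adjoint_ops S T' -> T = T'.
Proof. by move=> ST ST'; apply/funext => y; apply: inner_inj => x; rewrite -ST. Qed.

Lemma adjoint_sym (S T : H -> H) : adjoint_ops S T -> adjoint_ops T S.
Proof. by move=> ST x y; rewrite inner_conj -ST -inner_conj. Qed.

Lemma adjoint_linear (S T : H -> H) : adjoint_ops S T -> linear T.
Proof.
move=> ST k x y; apply: inner_inj => z.
by rewrite -ST !innerDr !innerZr -!ST.
Qed.

Lemma adjoint_bounded (S T : H -> H) (M : R) : adjoint_ops S T ->
  (forall x, rnorm (S x) <= M * rnorm x) ->
  (forall x, rnorm (T x) <= M * rnorm x).
Proof.
move=> ST SM x; have [Tx0|Tx0] := eqVneq (T x) 0.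
  by rewrite Tx0 rnorm0 (le_trans (rnorm_ge0 (S x))).
have nx : 0 < rnorm (T x).
  by rewrite lt_neqAle rnorm_ge0 andbT eq_sym; apply: contra_neq Tx0 => /rnorm_eq0.
rewrite -(ler_pM2l nx) -expr2 rnorm_sqr -ST.
rewrite (le_trans (Re_cabs _))// (le_trans (cauchy_schwarz _ _))//.
by rewrite mulrA ler_wpM2r ?rnorm_ge0// mulrC SM.
Qed.

End HilbertTheory.

(** * Unital algebras, Neumann series and *-representations *)

Section UAlgebraTheory.
Context (K : pzRingType) (A : ualgType K).
Implicit Types a b c : A.

Lemma amul0l a : (0 : A) ** a = 0.
Proof. by apply: (@addrI _ (0 ** a)); rewrite -amulDl !addr0. Qed.
Lemma amul0r a : a ** (0 : A) = 0.
Proof. by apply: (@addrI _ (a ** 0)); rewrite -amulDr !addr0. Qed.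
Lemma amulNl a b : (- a) ** b = - (a ** b).
Proof. by rewrite -scaleN1r amulZl scaleN1r. Qed.
Lemma amulNr a b : a ** (- b) = - (a ** b).
Proof. by rewrite -scaleN1r amulZr scaleN1r. Qed.
Lemma amulBl a b c : (a - b) ** c = a ** c - b ** c.
Proof. by rewrite amulDl amulNl. Qed.
Lemma amulBr a b c : c ** (a - b) = c ** a - c ** b.
Proof. by rewrite amulDr amulNr. Qed.

Fixpoint apow a n : A := if n is n'.+1 then a ** apow a n' else aone.

Lemma apowD a m n : apow a (m + n) = apow a m ** apow a n.
Proof. by elim: m => [|m IH] /=; rewrite ?amul1a// IH amulA. Qed.
Lemma apowSr a n : apow a n.+1 = apow a n ** a.
Proof. by rewrite -addn1 apowD /= amula1. Qed.

End UAlgebraTheory.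

Lemma geometric_small (R : realType) (q e : R) : 0 <= q -> q < 1 -> 0 < e ->
  exists n0, forall n, (n0 <= n)%N -> q ^+ n <= e.
Proof.
move=> q0 q1 e0.
have /cvgrPdist_le/(_ e e0)[n0 _ nP] : (fun n => q ^+ n) @ \oo --> (0 : R).
  by apply: cvg_expr; rewrite ger0_norm.
exists n0 => n /nP /=; rewrite sub0r normrN ger0_norm//; exact: exprn_ge0.
Qed.

Section BanachAlgebra.
Context (R : realType) (A : banachAlgType (cplx R)).
Implicit Types a b c : A.

Lemma rnormM a b : rnorm (a ** b) <= rnorm a * rnorm b.
Proof. by rewrite -lecR rmorphM /= -!normr_rnorm normrM_le. Qed.

Lemma cvsMr a (u : nat -> A) l : cvs u l -> cvs (fun n => a ** u n) (a ** l).
Proof.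
move=> ul e e0.
have C0 : 0 < rnorm a + 1 by have := rnorm_ge0 a; lra.
have [n0 nP] := ul (e / (rnorm a + 1)) (divr_gt0 e0 C0); exists n0 => n n0n.
rewrite -amulBr (le_trans (rnormM _ _))//.
have := nP n n0n; rewrite ler_pdivlMr//.
by have := rnorm_ge0 (u n - l); nra.
Qed.

Lemma cvsMl a (u : nat -> A) l : cvs u l -> cvs (fun n => u n ** a) (l ** a).
Proof.
move=> ul e e0.
have C0 : 0 < rnorm a + 1 by have := rnorm_ge0 a; lra.
have [n0 nP] := ul (e / (rnorm a + 1)) (divr_gt0 e0 C0); exists n0 => n n0n.
rewrite -amulBl (le_trans (rnormM _ _))//.
have := nP n n0n; rewrite ler_pdivlMr//.
by have := rnorm_ge0 (u n - l); nra.
Qed.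

Lemma neumann b : rnorm b < 1 ->
  exists c, c ** (aone - b) = aone /\ (aone - b) ** c = aone.
Proof.
move=> b1; have b0 := rnorm_ge0 b.
(* Partial sums of the geometric series in Horner form. The norm of [aone] need not be 1 here, so it
   enters the constant [C]. *)
pose s := fix s n := if n is n'.+1 then aone + b ** s n' else 0.
have sE n : (aone - b) ** s n = aone - apow b n.
  elim: n => [|n IH] /=; first by rewrite amul0r subrr.
  have bC : (aone - b) ** b = b ** (aone - b).
    by rewrite amulBl amulBr amul1a amula1.
  by rewrite amulDr amulA bC -amulA IH amulBr !amula1 addrA subrK.
have sE' n : s n ** (aone - b) = aone - apow b n.
  elim: n => [|n IH] /=; first by rewrite amul0l subrr.
  by rewrite amulDl -amulA IH amulBr amul1a amula1 addrA subrK.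
have powb n : rnorm (apow b n) <= rnorm b ^+ n * rnorm (aone : A).
  elim: n => [|n IH] /=; first by rewrite mul1r.
  by rewrite (le_trans (rnormM _ _))// exprS -mulrA ler_wpM2l.
pose C := rnorm (aone : A) / (1 - rnorm b).
have C0 : 0 <= C by rewrite divr_ge0 ?rnorm_ge0// subr_ge0 ltW.
have CE : rnorm (aone : A) = C * (1 - rnorm b) by rewrite /C; field; lra.
have sC n : rnorm (s n) <= C.
  elim: n => [|n IH] /=; first by rewrite rnorm0.
  rewrite (le_trans (rnormD _ _))// CE.
  by have := rnormM b (s n); have := rnorm_ge0 (s n); nra.
have sD m n : s (m + n)%N = s m + apow b m ** s n.
  elim: m => [|m IH] /=; first by rewrite add0r amul1a.
  by rewrite IH amulDr addrA amulA.
have small e : 0 < e -> exists n0, forall n, (n0 <= n)%N ->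
    rnorm (apow b n) * (C + 1) <= e.
  move=> e0; have D0 : 0 < (rnorm (aone : A) + 1) * (C + 1).
    by have := rnorm_ge0 (aone : A); nra.
  have [n0 nP] := geometric_small b0 b1 (divr_gt0 e0 D0).
  exists n0 => n n0n; have := nP n n0n; rewrite ler_pdivlMr// => h.
  apply: le_trans h; rewrite mulrA ler_wpM2r//; first by lra.
  rewrite (le_trans (powb n))// ler_wpM2l ?exprn_ge0//; lra.
have [e e0|c cP] := @cauchys_cvg _ _ s.
  have [n0 nP] := small e e0.
  have key n m : (n0 <= n)%N -> (n <= m)%N -> rnorm (s m - s n) <= e.
    move=> n0n nm; rewrite -(subnKC nm) sD addrAC subrr add0r.
    rewrite (le_trans (rnormM _ _))//; apply: le_trans (nP n n0n).
    by rewrite ler_wpM2l ?rnorm_ge0// (le_trans (sC _))// lerDl.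
  exists n0 => n m n0n n0m; have [nm|/ltnW mn] := leqP n m.
    by rewrite rnormC key.
  by rewrite key.
have lim1 : cvs (fun n => aone - apow b n) (aone : A).
  move=> e e0; have [n0 nP] := small e e0; exists n0 => n n0n.
  rewrite addrAC subrr sub0r rnormN; apply: le_trans (nP n n0n).
  by rewrite ler_peMr ?rnorm_ge0//; lra.
exists c; split.
  apply: cvs_unique lim1; have := cvsMl (aone - b) cP.
  by congr cvs; apply/funext => n; exact: sE'.
apply: cvs_unique lim1; have := cvsMr (aone - b) cP.
by congr cvs; apply/funext => n; exact: sE.
Qed.

End BanachAlgebra.

Section StarRep.
Context (R : realType) (B : cstarAlgType (cplx R)).
Local Notation K := (cplx R).

Lemma star1 : star aone = aone :> B.
Proof. by rewrite -[LHS]amul1a -{1}(starK aone) -starM amul1a starK. Qed.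

Lemma starN (b : B) : star (- b) = - star b.
Proof. by rewrite -scaleN1r starZ rmorphN rmorph1 scaleN1r. Qed.

Lemma starB (a b : B) : star (a - b) = star a - star b.
Proof. by rewrite starD starN. Qed.

Lemma rnorm_starM (b : B) : rnorm (star b ** b) = rnorm b ^+ 2.
Proof.
by apply: complexI; rewrite -normr_rnorm normr_starM normr_rnorm rmorphXn.
Qed.

Section Hom.
Context (A : ualgType K) (H : hilbertType K) (pi : A -> H -> H).
Hypothesis pih : is_hom pi.

Lemma homD a b x : pi (a + b) x = pi a x + pi b x.
Proof. by have := hom_linear pih 1 a b x; rewrite !scale1r. Qed.
Lemma hom0 x : pi 0 x = 0.
Proof. by apply: (@addrI _ (pi 0 x)); rewrite -homD !addr0. Qed.
Lemma homZ k a x : pi (k *: a) x = k *: pi a x.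
Proof. by have := hom_linear pih k a 0 x; rewrite hom0 !addr0. Qed.
Lemma homN a x : pi (- a) x = - pi a x.
Proof. by rewrite -scaleN1r homZ scaleN1r. Qed.
Lemma homB a b x : pi (a - b) x = pi a x - pi b x.
Proof. by rewrite homD homN. Qed.
Lemma hom_opD a x y : pi a (x + y) = pi a x + pi a y.
Proof. by have := hom_op_linear pih a 1 x y; rewrite !scale1r. Qed.
Lemma hom_op0 a : pi a 0 = 0.
Proof. by apply: (@addrI _ (pi a 0)); rewrite -hom_opD !addr0. Qed.
Lemma hom_opZ k a x : pi a (k *: x) = k *: pi a x.
Proof. by have := hom_op_linear pih a k x 0; rewrite hom_op0 !addr0. Qed.
Lemma hom_opN a x : pi a (- x) = - pi a x.
Proof. by rewrite -scaleN1r hom_opZ scaleN1r. Qed.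
Lemma hom_opB a x y : pi a (x - y) = pi a x - pi a y.
Proof. by rewrite hom_opD hom_opN. Qed.
Lemma hom_sum (I : Type) (r : seq I) (P : pred I) (F : I -> A) x :
  pi (\sum_(i <- r | P i) F i) x = \sum_(i <- r | P i) pi (F i) x.
Proof. exact: (big_morph (fun a => pi a x) (fun a b => homD a b x) (hom0 x)). Qed.

End Hom.

Context (H : hilbertType K) (pi : B -> H -> H).
Hypothesis pis : is_star_rep pi.
Let pih : is_hom pi := pis.1.

Lemma star_rep_sqr b x :
  (rnorm (pi b x) ^+ 2)%:C = inner (pi (star b ** b) x) x.
Proof. by rewrite (hom_mul pih) -inner_rnorm (pis.2 (star b)) starK. Qed.

(** A *-representation may be non-unital, but [pi aone] is a self-adjoint idempotent p, so |p x|^2 =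
    <p x, x>. *)
Lemma star_rep_unit_le x : rnorm (pi aone x) <= rnorm x.
Proof.
have [h|h] := eqVneq (rnorm (pi aone x)) 0; first by rewrite h rnorm_ge0.
have p0 : 0 < rnorm (pi aone x) by rewrite lt_neqAle eq_sym h rnorm_ge0.
rewrite -(ler_pM2l p0) -expr2.
have := star_rep_sqr aone x; rewrite star1 amul1a => /(congr1 (@complex.Re R)) /= ->.
by rewrite (le_trans (Re_cabs _))// cauchy_schwarz.
Qed.

(* If [t = norm (pi b)] exceeded [norm b], then [1 - t^-2 b^* b] would be
   invertible, whereas [t^2] is an approximate eigenvalue of [pi (b^* b)]. *)
Lemma star_rep_contractive b x : rnorm (pi b x) <= rnorm b * rnorm x.
Proof.
have [M MP] := hom_op_bounded pih b.
pose S := [set rnorm (pi b y) | y in [set y | rnorm y <= 1]].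
have hs : has_sup S.
  split; first by exists (rnorm (pi b 0)), 0 => //=; rewrite rnorm0.
  exists `|M| => _ [y /= y1 <-]; rewrite (le_trans (MP y))//.
  by rewrite (le_trans (ler_norm _))// normrM (ger0_norm (rnorm_ge0 y)) ler_piMr.
pose t := sup S.
have St y : rnorm y <= 1 -> rnorm (pi b y) <= t.
  by move=> y1; apply: ub_le_sup; [case: hs|exists y].
have t0 : 0 <= t by rewrite (le_trans _ (St 0 _)) ?rnorm_ge0// rnorm0.
have tP y : rnorm (pi b y) <= t * rnorm y.
  have [->|y0] := eqVneq y 0; first by rewrite (hom_op0 pih) !rnorm0 mulr0.
  have ny : 0 < rnorm y.
    by rewrite lt_neqAle rnorm_ge0 andbT eq_sym; apply: contra_neq y0 => /rnorm_eq0.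
  have := St ((rnorm y)^-1%:C *: y).
  rewrite (hom_opZ pih) !rnormZ !cabs_real ger0_norm ?invr_ge0 ?rnorm_ge0//.
  by rewrite mulVf ?gt_eqF// lexx ler_pdivrMl// mulrC; apply.
apply: (le_trans (tP x)); rewrite ler_wpM2r ?rnorm_ge0// leNgt; apply/negP => bt.
have tp : 0 < t by rewrite (le_lt_trans (rnorm_ge0 b)).
have [|c [cP _]] := @neumann _ B ((t ^- 2)%:C *: (star b ** b)).
  rewrite rnormZ cabs_real ger0_norm ?invr_ge0 ?exprn_ge0// rnorm_starM.
  by rewrite ltr_pdivrMl ?exprn_gt0// mulr1 ltr_sqr ?nnegrE// rnorm_ge0.
have [L LP] := hom_op_bounded pih c.
(* From |bz|^2 <= t^2 L^2 |w|^2 and |w|^2 <= 2 - 2 t^-2 |bz|^2 one gets |bz|^2 W <= 2 L^2 t^2. This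
   bounds |bz| by a number [r] strictly below [t], against the choice of [t] as a supremum. *)
pose W := 1 + 2 * L ^+ 2.
have W0 : 0 < W by rewrite /W; have := sqr_ge0 L; lra.
have key y : rnorm y <= 1 -> rnorm (pi b y) ^+ 2 * W <= 2 * L ^+ 2 * t ^+ 2.
  (* Projecting by [pi aone] does not change [pi b y], and on the projected vector [pi c] undoes 1 -
     t^-2 b^* b. *)
  move=> y1; pose z := pi aone y.
  have z1 : rnorm z <= 1 by rewrite (le_trans (star_rep_unit_le y)).
  have bz : pi b y = pi b z by rewrite /z -(hom_mul pih) amula1.
  pose w := z - (t ^- 2)%:C *: pi (star b) (pi b z).
  have zw : z = pi c w.
    rewrite /w /z -!(hom_mul pih) amula1 -(homZ pih) -(homB pih) -(hom_mul pih).
    by rewrite cP.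
  have w2 : rnorm w ^+ 2 <= 2 - 2 * t ^- 2 * rnorm (pi b z) ^+ 2.
    rewrite /w rnorm_sqrB rnormZ cabs_real innerZr conj_real cReZ.
    rewrite -(pis.2 b) inner_rnorm ger0_norm ?invr_ge0 ?exprn_ge0//=.
    have z2 : rnorm z ^+ 2 <= 1 by rewrite expr_le1// rnorm_ge0.
    suff : (t ^- 2 * rnorm (pi (star b) (pi b z))) ^+ 2 <= 1 by lra.
    rewrite expr_le1 ?mulr_ge0 ?invr_ge0 ?exprn_ge0 ?rnorm_ge0//.
    rewrite ler_pdivrMl ?exprn_gt0// mulr1 expr2.
    rewrite (le_trans (adjoint_bounded (pis.2 b) tP _))// ler_pM2l//.
    by rewrite -bz; exact: St.
  have wL : rnorm (pi b z) ^+ 2 <= t ^+ 2 * L ^+ 2 * rnorm w ^+ 2.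
    have h : rnorm (pi b z) <= t * (L * rnorm w).
      by rewrite (le_trans (tP z))// ler_pM2l// {1}zw.
    rewrite -!exprMn -mulrA ler_sqr ?nnegrE ?rnorm_ge0//.
    by rewrite (le_trans (rnorm_ge0 _) h).
  rewrite bz /W mulrDr mulr1; apply: (@le_trans _ _
    (t ^+ 2 * L ^+ 2 * (2 - 2 * t ^- 2 * rnorm (pi b z) ^+ 2) +
     rnorm (pi b z) ^+ 2 * (2 * L ^+ 2))).
    by rewrite lerD2r (le_trans wL)// ler_wpM2l// mulr_ge0 ?sqr_ge0.
  rewrite le_eqVlt; apply/orP; left; apply/eqP; field; lra.
pose r := Num.sqrt (2 * L ^+ 2 * t ^+ 2 / W).
have r2 : r ^+ 2 = 2 * L ^+ 2 * t ^+ 2 / W.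
  by rewrite sqr_sqrtr// divr_ge0 ?(ltW W0)// mulr_ge0 ?sqr_ge0// mulr_ge0 ?sqr_ge0.
have rt : r < t.
  rewrite -ltr_sqr ?nnegrE ?sqrtr_ge0// r2 ltr_pdivrMr//.
  have : 0 < t ^+ 2 by rewrite exprn_gt0.
  by rewrite /W; nra.
have tr : 0 < t - r by rewrite subr_gt0.
have [_ [y /= y1 <-]] := sup_adherent tr hs.
rewrite -/t opprB addrCA subrr addr0 => ry.
have := key y y1; rewrite -ler_pdivlMr// -r2 ler_sqr ?nnegrE ?sqrtr_ge0 ?rnorm_ge0//.
by rewrite leNgt ry.
Qed.

End StarRep.

(** * Closed subspaces and the space of square-summable sequences *)

Section ClosedSubspace.
Context (R : realType) (H : hilbertType (cplx R)).
Local Notation K := (cplx R).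

Record closed_subspace := ClosedSubspace {
  cs_set :> H -> Prop;
  cs_0 : cs_set 0;
  cs_lin : forall k x y, cs_set x -> cs_set y -> cs_set (k *: x + y);
  cs_adh : forall x, adh cs_set x -> cs_set x
}.

Context (S : closed_subspace).

Let csD x y : S x -> S y -> S (x + y).
Proof. by move=> Sx Sy; rewrite -[x]scale1r; exact: cs_lin. Qed.
Let csZ k x : S x -> S (k *: x).
Proof. by move=> Sx; rewrite -[_ *: _]addr0; apply: cs_lin => //; exact: cs_0. Qed.

(** Membership in [S] is part of the bound, so the elements of finite gauge are exactly those of
    [S]. *)
Program Definition sub_gauge : gauge H :=
  @Gauge R H (fun x r => S x /\ rnorm x <= r) _ _ _ _ _ _ _ _.
Next Obligation. by move=> x r [_]; apply: le_trans; exact: rnorm_ge0. Qed.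
Next Obligation. by move=> x [_ /rnorm_le0]. Qed.
Next Obligation.
move=> x r h; split; first by case: (h 1 ltr01).
by apply/ler_addgt0Pr => e /h[].
Qed.
Next Obligation. by split; [exact: cs_0|rewrite rnorm0]. Qed.
Next Obligation.
move=> x y r s [Sx xr] [Sy ys]; split; first exact: csD.
by rewrite (le_trans (rnormD _ _))// lerD.
Qed.
Next Obligation.
move=> k x r [Sx xr]; split; first exact: csZ.
by rewrite rnormZ ler_wpM2l// cabs_ge0.
Qed.
Next Obligation. by move=> x r s [Sx xr] rs; split=> //; exact: le_trans rs. Qed.
Next Obligation.
move=> u uS cu.
have [e e0|l lP] := @cauchys_cvg _ _ u.
  have [n0 nP] := cu e e0; exists n0 => n m n0n n0m.
  by case: (nP n m n0n n0m).
exists l => e e0; have [n0 nP] := lP e e0; exists n0 => n n0n; split.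
  have Sl : S l.
    apply: cs_adh => d d0; have [m mP] := lP d d0.
    by exists (u m); [case: (uS m) => ? []|exact: mP].
  have Su : S (u n) by case: (uS n) => ? [].
  by rewrite addrC -scaleN1r; exact: cs_lin.
exact: nP.
Qed.

Definition subhilbert := gspace sub_gauge.
HB.instance Definition _ := CompleteNormedModule.on subhilbert.

Let ip (x y : subhilbert) : K := inner (gval x) (gval y).

Lemma sub_rnorm (x : subhilbert) : rnorm x = rnorm (gval x).
Proof.
apply/le_anti/andP; split.
  by apply/rnormP; split=> //; case: (gval_rnorm x).
by case: (gval_rnorm x).
Qed.

Lemma sub_mem (x : subhilbert) : S (gval x).
Proof. by case: (gval_rnorm x). Qed.

Let mkP (x : H) (Sx : S x) : x \in gdom sub_gauge.
Proof. by apply/mem_set; exists (rnorm x). Qed.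

Definition sub_mk x (Sx : S x) : subhilbert := GSpace (mkP Sx).

Let ip_bilinear : bilinear_for *%R (@Num.conj K \; *%R) ip.
Proof.
split=> [y k x x'|x k y y'] /=; rewrite /ip gvalD gvalZ.
  by rewrite innerDl innerZl.
by rewrite innerDr innerZr.
Qed.
HB.instance Definition _ := bilinear_isBilinear.Build K _ _ _ _ _ ip ip_bilinear.

Let ip_hermitian x y : ip x y = (-1) ^+ false * (ip y x)^*.
Proof. by rewrite expr0 mul1r /ip inner_conj. Qed.
HB.instance Definition _ := isHermitianSesquilinear.Build K _ _ _ ip ip_hermitian.

Let ip_norm (x : subhilbert) : `|x| ^+ 2 = ip x x.
Proof. by rewrite /ip inner_rnorm normr_rnorm sub_rnorm rmorphXn. Qed.

Let ip_dot (x : subhilbert) : x != 0 -> 0 < ip x x.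
Proof. by move=> x0; rewrite -ip_norm exprn_gt0// normr_gt0. Qed.
HB.instance Definition _ := isDotProduct.Build K _ ip ip_dot.

HB.instance Definition _ := CompleteNormedModule_isHilbert.Build K subhilbert
  ip_norm.

Lemma sub_inner (x y : subhilbert) : inner x y = inner (gval x) (gval y).
Proof. by []. Qed.

End ClosedSubspace.

Section Ell2.
Context (R : realType).
Local Notation K := (cplx R).
Implicit Types u v w : nat -> K^o.

Lemma cabs_sqrE (k : K) : cabs k ^+ 2 = complex.Re k ^+ 2 + complex.Im k ^+ 2.
Proof. by rewrite cabsE sqr_sqrtr// addr_ge0 ?sqr_ge0. Qed.

Lemma cvsZ (V : normedModType K) (k : K) (u : nat -> V) l :
  cvs u l -> cvs (fun n => k *: u n) (k *: l).
Proof.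
move=> ul e e0.
have C0 : 0 < cabs k + 1 by have := cabs_ge0 k; lra.
have [n0 nP] := ul (e / (cabs k + 1)) (divr_gt0 e0 C0); exists n0 => n n0n.
rewrite -scalerBr rnormZ.
have := nP n n0n; rewrite ler_pdivlMr//.
by have := rnorm_ge0 (u n - l); have := cabs_ge0 k; nra.
Qed.

Lemma real_cauchy (x : nat -> R) :
  (forall e : R, 0 < e -> exists n0, forall n m, (n0 <= n)%N -> (n0 <= m)%N ->
     `|x n - x m| <= e) ->
  exists l, forall e : R, 0 < e -> exists n0, forall n, (n0 <= n)%N ->
     `|x n - l| <= e.
Proof.
move=> cx; have /cauchy_cvg/cvg_ex[l xl] : cauchy (x @ \oo).
  apply/cauchy_ballP => e e0; rewrite near_simpl.
  have [n0 nP] := cx (e / 2) (half_gt0 e0).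
  near=> n m => /=; rewrite -ball_normE /=.
  rewrite (le_lt_trans (nP _ _ _ _))//; try by near: n; exists n0.
    by near: m; exists n0.
  by rewrite ltr_pdivrMr// ltr_pMr// ltr1n.
exists l => e e0.
have /cvgrPdist_le/(_ e e0)[n0 _ nP] : x @ \oo --> l by [].
by exists n0 => n /nP /=; rewrite distrC.
Unshelve. all: by end_near. Qed.

Lemma cplx_cauchy (x : nat -> K^o) : cauchys x -> exists l, cvs x l.
Proof.
move=> cx.
have [e e0|a aP] := @real_cauchy (fun n => complex.Re (x n)).
  have [n0 nP] := cx e e0; exists n0 => n m n0n n0m.
  by rewrite -cReN -cReD (le_trans (norm_Re_cabs _))//; exact: nP.
have [e e0|b bP] := @real_cauchy (fun n => complex.Im (x n)).
  have [n0 nP] := cx e e0; exists n0 => n m n0n n0m.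
  by rewrite -cImN -cImD (le_trans (norm_Im_cabs _))//; exact: nP.
exists (Complex a b) => e e0.
have [n0 nP] := aP (e / 2) (half_gt0 e0); have [m0 mP] := bP (e / 2) (half_gt0 e0).
exists (maxn n0 m0) => n; rewrite geq_max => /andP[/nP n0n /mP m0n].
rewrite -[rnorm _]/(cabs (x n - Complex a b)).
rewrite -ler_sqr ?nnegrE ?cabs_ge0 ?(ltW e0)// cabs_sqrE cReD cImD cReN cImN /=.
have : `|complex.Re (x n) - a| ^+ 2 <= (e / 2) ^+ 2.
  by rewrite ler_sqr ?nnegrE// ltW// half_gt0.
have : `|complex.Im (x n) - b| ^+ 2 <= (e / 2) ^+ 2.
  by rewrite ler_sqr ?nnegrE// ltW// half_gt0.
by rewrite !real_normK ?num_real//; nra.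
Qed.

Definition psum N u : R := \sum_(i < N) cabs (u i) ^+ 2.

Lemma psum_ge0 N u : 0 <= psum N u.
Proof. by apply: sumr_ge0 => i _; rewrite sqr_ge0. Qed.

Lemma psum_mono u N M : (N <= M)%N -> psum N u <= psum M u.
Proof.
move=> /subnKC <-; rewrite /psum big_split_ord /= lerDl.
by apply: sumr_ge0 => i _; rewrite sqr_ge0.
Qed.

(** The weighted inequality (a + b)^2 <= (r + s) (a^2 / r + b^2 / s) is summed termwise, so no inner
    product is needed yet. Its weights require [r] and [s] to be nonzero, hence the two separate
    cases. *)
Lemma psum_minkowski N u v r s : 0 <= r -> 0 <= s -> psum N u <= r ^+ 2 ->
  psum N v <= s ^+ 2 -> psum N (u + v) <= (r + s) ^+ 2.
Proof.
move=> r0 s0 ur vs.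
have zero w : psum N w <= 0 -> forall i : 'I_N, w i = 0.
  move=> w0 i; apply/cabs_eq0/eqP; rewrite -sqrf_eq0; apply/eqP/le_anti.
  rewrite sqr_ge0 andbT; apply: le_trans w0.
  rewrite /psum (bigD1 i)//= lerDl; apply: sumr_ge0 => j _; exact: sqr_ge0.
have [r00|rn0] := eqVneq r 0.
  rewrite r00 add0r (_ : psum N (u + v) = psum N v)//.
  apply: eq_bigr => i _; rewrite -[(u + v) i]/(u i + v i) (zero u) ?add0r//.
  by rewrite (le_trans ur)// r00 expr0n.
have [s00|sn0] := eqVneq s 0.
  rewrite s00 addr0 (_ : psum N (u + v) = psum N u)//.
  apply: eq_bigr => i _; rewrite -[(u + v) i]/(u i + v i) (zero v) ?addr0//.
  by rewrite (le_trans vs)// s00 expr0n.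
have {}r0 : 0 < r by rewrite lt_neqAle eq_sym rn0.
have {}s0 : 0 < s by rewrite lt_neqAle eq_sym sn0.
apply: (@le_trans _ _ ((r + s) * (r^-1 * psum N u + s^-1 * psum N v))).
  rewrite /psum !mulr_sumr -big_split mulr_sumr; apply: ler_sum => i _ /=.
  rewrite -[(u + v) i]/(u i + v i).
  apply: (@le_trans _ _ ((cabs (u i) + cabs (v i)) ^+ 2)).
    by rewrite ler_sqr ?nnegrE ?addr_ge0 ?cabs_ge0 ?cabsD.
  set a := cabs _; set b := cabs _; rewrite -subr_ge0.
  have -> : (r + s) * (r^-1 * a ^+ 2 + s^-1 * b ^+ 2) - (a + b) ^+ 2 =
    (s * a - r * b) ^+ 2 / (r * s) by field; rewrite !gt_eqF.
  by rewrite divr_ge0 ?sqr_ge0// mulr_ge0// ltW.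
have -> : (r + s) ^+ 2 = (r + s) * (r^-1 * r ^+ 2 + s^-1 * s ^+ 2).
  by field; rewrite !gt_eqF.
by rewrite ler_pM2l ?addr_gt0// lerD// ler_pM2l ?invr_gt0.
Qed.

Lemma sqr_lim (x r : R) : (forall e, 0 < e -> 0 <= r + e /\ x <= (r + e) ^+ 2) ->
  0 <= r /\ x <= r ^+ 2.
Proof.
move=> h; have r0 : 0 <= r by apply/ler_addgt0Pr => e /h[].
split=> //; have [x0|x0] := ltP x 0; first by rewrite (le_trans (ltW x0))// sqr_ge0.
rewrite -(sqr_sqrtr x0) ler_sqr ?nnegrE ?sqrtr_ge0//.
apply/ler_addgt0Pr => e e0; have [re0 xe] := h e e0.
by rewrite -(ger0_norm re0) -sqrtr_sqr ler_wsqrtr.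
Qed.

Program Definition ell2_gauge : gauge (nat -> K^o) :=
  @Gauge R _ (fun u r => 0 <= r /\ forall N, psum N u <= r ^+ 2) _ _ _ _ _ _ _ _.
Next Obligation. by move=> u r []. Qed.
Next Obligation.
move=> u [_ u0]; apply/funext => i; apply/cabs_eq0/eqP; rewrite -sqrf_eq0.
apply/eqP/le_anti; rewrite sqr_ge0 andbT.
have := u0 i.+1; rewrite expr0n /=; apply: le_trans.
by rewrite /psum big_ord_recr lerDr; apply: sumr_ge0 => j _; exact: sqr_ge0.
Qed.
Next Obligation.
move=> u r h; have r0 : 0 <= r by apply/ler_addgt0Pr => e /h[].
split=> // N; have [|_ ->//] := @sqr_lim (psum N u) r.
by move=> e /h[re0 uN]; split.
Qed.
Next Obligation.
split=> // N; rewrite [leRHS]expr0n /psum big1// => i _.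
by rewrite -[0 _]/(0 : K) cabs0 expr0n.
Qed.
Next Obligation.
move=> u v r s [r0 ur] [s0 vs]; split=> [|N]; first exact: addr_ge0.
exact: psum_minkowski.
Qed.
Next Obligation.
move=> k u r [r0 ur]; split=> [|N]; first by rewrite mulr_ge0// cabs_ge0.
have -> : psum N (k *: u) = cabs k ^+ 2 * psum N u.
  by rewrite /psum mulr_sumr; apply: eq_bigr => i _; rewrite -exprMn -cabsM.
by rewrite exprMn ler_wpM2l// sqr_ge0.
Qed.
Next Obligation.
move=> u r s [r0 ur] rs; split=> [|N]; first exact: le_trans rs.
by rewrite (le_trans (ur N))// ler_sqr ?nnegrE// (le_trans r0).
Qed.
Next Obligation.
move=> u _ cu.
have coord i : cauchys (fun n => u n i).
  move=> e e0; have [n0 nP] := cu e e0; exists n0 => n m n0n n0m.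
  rewrite -ler_sqr ?nnegrE ?rnorm_ge0 ?(ltW e0)//.
  have [_ /(_ i.+1)] := nP n m n0n n0m; apply: le_trans.
  rewrite /psum big_ord_recr lerDr; apply: sumr_ge0 => j _; exact: sqr_ge0.
have /choice[l lP] := fun i => cplx_cauchy (coord i).
exists l => e e0; have [n0 nP] := cu e e0; exists n0 => n n0n.
suff : forall N, 0 <= e /\ psum N (u n - l) <= e ^+ 2.
  by move=> h; split=> [|N]; [exact: ltW|case: (h N)].
move=> N; apply: sqr_lim => d d0; split; first by rewrite addr_ge0 ?ltW.
(* Only [N] coordinates are involved; an error of d/(N+1) in each keeps the sum of squares below
   d^2. *)
have [m [n0m mP]] : exists m, (n0 <= m)%N /\ forall i, (i < N)%N ->
    cabs (u m i - l i) <= d / N.+1%:R.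
  have D0 : 0 < d / N.+1%:R by rewrite divr_gt0.
  have /choice[f fP] : forall i, exists m0, forall m, (m0 <= m)%N ->
      cabs (u m i - l i) <= d / N.+1%:R by move=> i; exact: lP.
  exists (maxn n0 (\max_(i < N) f i)); split=> [|i iN]; first exact: leq_maxl.
  apply: fP; rewrite (leq_trans _ (leq_maxr _ _))//.
  exact: (@leq_bigmax _ (fun i : 'I_N => f i) (Ordinal iN)).
have -> : u n - l = (u n - u m) + (u m - l) by rewrite addrA subrK.
apply: psum_minkowski; rewrite ?(ltW e0) ?(ltW d0)//.
  by case: (nP n m n0n n0m).
apply: (@le_trans _ _ (\sum_(i < N) (d / N.+1%:R) ^+ 2)).
  apply: ler_sum => i _; rewrite ler_sqr ?nnegrE ?cabs_ge0 ?divr_ge0 ?(ltW d0)//.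
  exact: mP.
rewrite sumr_const card_ord -[leLHS]mulr_natr.
have -> : (d / N.+1%:R) ^+ 2 * N%:R = d ^+ 2 * (N%:R / N.+1%:R ^+ 2).
  by field; rewrite nat1r pnatr_eq0.
apply: ler_piMr; first exact: sqr_ge0.
rewrite ler_pdivrMr ?exprn_gt0// mul1r -natrX ler_nat expnS expn1; nia.
Qed.

Definition ell2 := gspace ell2_gauge.
HB.instance Definition _ := CompleteNormedModule.on ell2.
Definition ell2_fun (x : ell2) : nat -> K^o := gval x.
Coercion ell2_fun : ell2 >-> Funclass.
Implicit Types x y z : ell2.

Lemma ell2_psum x N : psum N x <= rnorm x ^+ 2.
Proof. by have [_] := gval_rnorm x. Qed.

Lemma ell2_le x r : rnorm x <= r <-> 0 <= r /\ forall N, psum N x <= r ^+ 2.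
Proof. exact: rnormP. Qed.

Lemma ell2_coord x i : cabs (x i) <= rnorm x.
Proof.
rewrite -ler_sqr ?nnegrE ?cabs_ge0 ?rnorm_ge0//; apply: le_trans (ell2_psum x i.+1).
by rewrite /psum big_ord_recr lerDr; apply: sumr_ge0 => j _; exact: sqr_ge0.
Qed.

Lemma psum_cvs x : cvs (fun n => ((psum n x)%:C : K^o)) (rnorm x ^+ 2)%:C.
Proof.
move=> e e0.
(* If all partial sums stayed below |x|^2 - e, the gauge would allow a smaller norm. *)
have [n0 nP] : exists n0, rnorm x ^+ 2 - e <= psum n0 x.
  apply: contrapT => /forallNP h.
  have h' n : psum n x <= rnorm x ^+ 2 - e by rewrite ltW// ltNge; apply/negP.
  have d0 : 0 <= rnorm x ^+ 2 - e by rewrite (le_trans _ (h' 0%N))// psum_ge0.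
  have : rnorm x <= Num.sqrt (rnorm x ^+ 2 - e).
    by apply/ell2_le; split=> [|n]; rewrite ?sqrtr_ge0// sqr_sqrtr.
  rewrite -ler_sqr ?nnegrE ?sqrtr_ge0 ?rnorm_ge0// sqr_sqrtr//; lra.
exists n0 => n n0n; rewrite -[rnorm _]/(cabs _) -rmorphB cabs_real.
rewrite distrC ger0_norm; last by rewrite subr_ge0 ell2_psum.
by have := psum_mono x n0n; lra.
Qed.

(** Polarisation defines the inner product from norms alone, before any series is known to converge.
    [ipP] then recognises it as the limit of [ipsum], through which the algebraic laws pass. *)
Let ip x y : K := 4^-1 * ((rnorm (x + y) ^+ 2)%:C - (rnorm (x - y) ^+ 2)%:C +
  'i%C * (rnorm (x + 'i%C *: y) ^+ 2)%:C - 'i%C * (rnorm (x - 'i%C *: y) ^+ 2)%:C).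

Definition ipsum N u v : K^o := \sum_(i < N) u i * (v i : K)^*.

Let polar (a b : K) : a * b^* = 4^-1 * ((cabs (a + b) ^+ 2)%:C - (cabs (a - b) ^+ 2)%:C +
  'i%C * (cabs (a + 'i%C * b) ^+ 2)%:C - 'i%C * (cabs (a - 'i%C * b) ^+ 2)%:C).
Proof.
apply: (@mulfI _ (4 : K)); first by rewrite pnatr_eq0.
rewrite [RHS]mulrA mulfV ?pnatr_eq0// mul1r !cabs_sqr.
rewrite !rmorphB !rmorphD !rmorphM /=.
have -> : ('i%C : K)^* = - 'i%C by apply/eqP; rewrite eq_complex /= oppr0 !eqxx.
have ii : ('i%C : K) * 'i%C = -1 by rewrite -expr2 sqr_i.
set I : K := 'i%C in ii *; set c := a^*; set d := b^*.
transitivity (2 * (a * d + b * c) - (I * I) * (2 * (a * d - b * c))); last by ring.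
by rewrite ii; ring.
Qed.

Let ipP x y : cvs (fun n => ipsum n x y) (ip x y : K^o).
Proof.
have -> : (fun n => ipsum n x y) = (fun n => (4^-1 : K) *:
  ((((psum n (ell2_fun (x + y)))%:C + (-1 : K) *: ((psum n (ell2_fun (x - y)))%:C : K^o)) +
  ('i%C : K) *: ((psum n (ell2_fun (x + 'i%C *: y)))%:C : K^o)) +
  (- 'i%C : K) *: ((psum n (ell2_fun (x - 'i%C *: y)))%:C : K^o))).
  apply/funext => n; rewrite /ipsum /psum !rmorph_sum /= !scaler_sumr -!big_split /=.
  rewrite scaler_sumr; apply: eq_bigr => i _.
  rewrite polar; congr (_ * (_ + _ + _ + _)).
    exact: (esym (mulN1r _)).
  exact: (esym (mulNr _ _)).
have -> : ip x y = (4^-1 : K) *: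
  ((((rnorm (x + y) ^+ 2)%:C + (-1 : K) *: ((rnorm (x - y) ^+ 2)%:C : K^o)) +
  ('i%C : K) *: ((rnorm (x + 'i%C *: y) ^+ 2)%:C : K^o)) +
  (- 'i%C : K) *: ((rnorm (x - 'i%C *: y) ^+ 2)%:C : K^o)).
  rewrite /ip; congr (_ * (_ + _ + _ + _)).
    exact: (esym (mulN1r _)).
  exact: (esym (mulNr _ _)).
apply: cvsZ; apply: cvsD; last by apply: cvsZ; exact: psum_cvs.
apply: cvsD; last by apply: cvsZ; exact: psum_cvs.
by apply: cvsD; [|apply: cvsZ]; exact: psum_cvs.
Qed.

Let ip_lin y k x z : ip (k *: x + z) y = k * ip x y + ip z y.
Proof.
apply: (cvs_unique (ipP _ _)).
have := cvsD (cvsZ k (ipP x y)) (ipP z y); congr cvs; apply/funext => n.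
rewrite /ipsum scaler_sumr -big_split; apply: eq_bigr => i _ /=.
by rewrite [RHS](_ : _ = (k * x i + z i) * (y i : K)^*)// mulrDl -mulrA.
Qed.

Let ip_herm x y : ip x y = (ip y x)^*.
Proof.
apply: (cvs_unique (ipP _ _)) => e e0; have [n0 nP] := ipP y x e0.
exists n0 => n /nP; rewrite -![rnorm _]/(cabs _) -cabs_conj.
congr (cabs _ <= _); rewrite rmorphB rmorph_sum; congr (_ - _).
by apply: eq_bigr => i _; rewrite rmorphM /= conjCK mulrC.
Qed.

Let ip_self x : ip x x = (rnorm x ^+ 2)%:C.
Proof.
apply: (cvs_unique (ipP _ _)); have := psum_cvs x; congr cvs; apply/funext => n.
by rewrite /ipsum /psum rmorph_sum; apply: eq_bigr => i _; rewrite /= cabs_sqr.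
Qed.

Let ip_bilinear : bilinear_for *%R (@Num.conj K \; *%R) ip.
Proof.
split=> [y k x x'|x k y y'] /=; first by rewrite ip_lin.
rewrite ip_herm ip_lin rmorphD rmorphM /=.
by congr (_ * _ + _); symmetry; apply: ip_herm.
Qed.
HB.instance Definition _ := bilinear_isBilinear.Build K _ _ _ _ _ ip ip_bilinear.

Let ip_hermitian x y : ip x y = (-1) ^+ false * (ip y x)^*.
Proof. by rewrite expr0 mul1r ip_herm. Qed.
HB.instance Definition _ := isHermitianSesquilinear.Build K _ _ _ ip ip_hermitian.

Let ip_norm x : `|x| ^+ 2 = ip x x.
Proof. by rewrite ip_self normr_rnorm rmorphXn. Qed.

Let ip_dot x : x != 0 -> 0 < ip x x.
Proof. by move=> x0; rewrite -ip_norm exprn_gt0// normr_gt0. Qed.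
HB.instance Definition _ := isDotProduct.Build K _ ip ip_dot.

HB.instance Definition _ := CompleteNormedModule_isHilbert.Build K ell2 ip_norm.

Lemma ell2_inner x y : cvs (fun n => ipsum n x y) (inner x y : K^o).
Proof. exact: ipP. Qed.

End Ell2.

(** * The C*-algebra generated by a family of representations *)

Section OperatorFamilies.
Context (R : realType).
Local Notation K := (cplx R).
Context (I : Type) (H : I -> hilbertType K).

Definition opfam := forall i, H i -> H i.
Implicit Types b c d : opfam.

HB.instance Definition _ := gen_eqMixin opfam.
HB.instance Definition _ := gen_choiceMixin opfam.

Lemma opfamP b c : (forall i x, b i x = c i x) -> b = c.
Proof.
move=> bc; apply: functional_extensionality_dep => i.
by apply/funext => x; exact: bc.
Qed.

Let opadd b c : opfam := fun i x => b i x + c i x.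
Let opopp b : opfam := fun i x => - b i x.
Let opzero : opfam := fun i x => 0.
Let opscale (k : K) b : opfam := fun i x => k *: b i x.

Let opaddA : associative opadd.
Proof. by move=> b c d; apply: opfamP => i x; exact: addrA. Qed.
Let opaddC : commutative opadd.
Proof. by move=> b c; apply: opfamP => i x; exact: addrC. Qed.
Let opadd0 : left_id opzero opadd.
Proof. by move=> b; apply: opfamP => i x; exact: add0r. Qed.
Let opaddN : left_inverse opzero opopp opadd.
Proof. by move=> b; apply: opfamP => i x; exact: addNr. Qed.
HB.instance Definition _ := GRing.isZmodule.Build opfam opaddA opaddC opadd0 opaddN.

Let opscaleA k l b : opscale k (opscale l b) = opscale (k * l) b.
Proof. by apply: opfamP => i x; exact: scalerA. Qed.
Let opscale1 : left_id 1 opscale.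
Proof. by move=> b; apply: opfamP => i x; exact: scale1r. Qed.
Let opscaleDr : right_distributive opscale +%R.
Proof. by move=> k b c; apply: opfamP => i x; exact: scalerDr. Qed.
Let opscaleDl b : {morph opscale^~ b : k l / k + l}.
Proof. by move=> k l; apply: opfamP => i x; exact: scalerDl. Qed.
HB.instance Definition _ := GRing.Zmodule_isLmodule.Build K opfam
  opscaleA opscale1 opscaleDr opscaleDl.

Lemma opfamDE b c i x : (b + c) i x = b i x + c i x. Proof. by []. Qed.
Lemma opfamBE b c i x : (b - c) i x = b i x - c i x. Proof. by []. Qed.
Lemma opfamZE k b i x : (k *: b) i x = k *: b i x. Proof. by []. Qed.

Definition opmul b c : opfam := fun i x => b i (c i x).
Definition opone : opfam := fun i x => x.
Definition opstar b : opfam := fun i => adj (b i).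
Arguments opstar : clear implicits.

Definition opbound b (r : R) : Prop :=
  [/\ 0 <= r, forall i, linear (b i) &
      forall i x, rnorm (b i x) <= r * rnorm x].

Definition opbounded b : Prop := exists r, opbound b r.

Lemma opbounded_op b i : opbounded b -> bounded_op (b i).
Proof. by move=> [r [_ bl br]]; split=> //; exists r. Qed.

Lemma opstarP b i : opbounded b -> adjoint_ops (b i) (opstar b i).
Proof. by move=> bb; apply: adjP; exact: opbounded_op. Qed.

Lemma opbound0 : opbound 0 0.
Proof.
split=> // [i k x y|i x]; first by rewrite scaler0 addr0.
by rewrite rnorm0 mul0r.
Qed.

Lemma opboundD b c r s : opbound b r -> opbound c s -> opbound (b + c) (r + s).
Proof.
move=> [r0 bl br] [s0 cl cs]; split=> [|i k x y|i x]; first exact: addr_ge0.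
  by rewrite !opfamDE bl cl scalerDr addrACA.
by rewrite (le_trans (rnormD _ _))// mulrDl lerD.
Qed.

Lemma opboundZ k b r : opbound b r -> opbound (k *: b) (cabs k * r).
Proof.
move=> [r0 bl br]; split=> [|i l x y|i x].
- by rewrite mulr_ge0// cabs_ge0.
- by rewrite !opfamZE bl scalerDr !scalerA mulrC.
- by rewrite rnormZ -mulrA ler_wpM2l// cabs_ge0.
Qed.

Lemma opbound_mono b r s : opbound b r -> r <= s -> opbound b s.
Proof.
move=> [r0 bl br] rs; split=> [|//|i x]; first exact: le_trans rs.
by rewrite (le_trans (br i x))// ler_wpM2r// rnorm_ge0.
Qed.

Lemma opboundM b c r s : opbound b r -> opbound c s -> opbound (opmul b c) (r * s).
Proof.
move=> [r0 bl br] [s0 cl cs]; split=> [|i k x y|i x]; first exact: mulr_ge0.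
  by rewrite /opmul cl bl.
by rewrite (le_trans (br _ _))// -mulrA ler_wpM2l.
Qed.

Lemma opbound_star b r : opbound b r -> opbound (opstar b) r.
Proof.
move=> br; have bb : opbounded b by exists r.
case: br => r0 bl br; split=> // [i|i]; first exact: adjoint_linear (opstarP (i := i) bb).
exact: adjoint_bounded (opstarP (i := i) bb) (br i).
Qed.

(** The substantial half of the C*-identity, from |b x|^2 = <x, b^* b x> and Cauchy-Schwarz. *)
Lemma opbound_sqr b r : 0 <= r -> opbounded b -> opbound (opmul (opstar b) b) (r ^+ 2) ->
  opbound b r.
Proof.
move=> r0 bb [_ _ bs]; have [s [_ bl _]] := bb; split=> // i x.
rewrite -ler_sqr ?nnegrE ?mulr_ge0 ?rnorm_ge0// rnorm_sqr (opstarP (i := i) bb).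
rewrite Re_innerC (le_trans (Re_cabs _))// (le_trans (cauchy_schwarz _ _))//.
by rewrite exprMn (expr2 (rnorm x)) mulrA ler_wpM2r ?rnorm_ge0//; exact: bs.
Qed.

End OperatorFamilies.

Section OperatorAlgebra.
Context (R : realType).
Local Notation K := (cplx R).
Context (I : Type) (H : I -> hilbertType K) (A : ualgType K) (N : A -> R).
Context (pi : forall i, A -> H i -> H i).
Arguments pi : clear implicits.

Record unital_reps : Prop := UnitalReps {
  ur_hom : forall i, is_hom (pi i);
  ur_one : forall i x, pi i aone x = x;
  ur_le : forall i a x, rnorm (pi i a x) <= N a * rnorm x;
  ur_ge0 : forall a, 0 <= N a
}.

Definition repfam (a : A) : opfam H := fun i x => pi i a x.

Record op_closed (T : set (opfam H)) : Prop := OpClosed {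
  oc_lin : forall k b c, T b -> T c -> T (k *: b + c);
  oc_mul : forall b c, T b -> T c -> T (opmul b c);
  oc_star : forall b, T b -> T (opstar b);
  oc_lim : forall b, (forall e, 0 < e -> exists2 c, T c & opbound (c - b) e) -> T b;
  oc_gen : forall a, T (repfam a)
}.

(** Being an intersection, it carries its own induction principle: a property holds on it once the
    families having that property are [op_closed]. *)
Definition opgen (b : opfam H) : Prop := forall T, op_closed T -> T b.

Context (U : unital_reps).

Lemma repfam_bound a : opbound (repfam a) (N a).
Proof.
split=> [|i|i x]; [exact: (ur_ge0 U)|exact: (hom_op_linear (ur_hom U i))|].
exact: (ur_le U).
Qed.

Lemma op_closed_gen : op_closed opgen.
Proof.
split=> [k b c bg cg|b c bg cg|b bg|b bl|a] T Tc.
- by apply: (oc_lin Tc); [exact: bg|exact: cg].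
- by apply: (oc_mul Tc); [exact: bg|exact: cg].
- by apply: (oc_star Tc); exact: bg.
- by apply: (oc_lim Tc) => e /bl[c cg cb]; exists c => //; exact: cg.
- exact: (oc_gen Tc).
Qed.

Lemma opgen_bounded b : opgen b -> opbounded b.
Proof.
apply; split=> [k c d [r cr] [s ds]|c d [r cr] [s ds]|c [r cr]|c cl|a].
- by exists (cabs k * r + s); apply: opboundD => //; exact: opboundZ.
- by exists (r * s); exact: opboundM.
- by exists r; exact: opbound_star.
- have [d [r dr] dc] := cl 1 ltr01.
  exists (r + cabs (-1) * 1); have := opboundD dr (opboundZ (-1) dc).
  by rewrite scaleN1r opprB addrC subrK.
- by exists (N a); exact: repfam_bound.
Qed.

Let gen0 : opgen 0.
Proof.
have -> : 0 = repfam 0 by apply: opfamP => i x; rewrite /repfam (hom0 (ur_hom U i)).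
exact: (oc_gen op_closed_gen).
Qed.
Let genZ k b : opgen b -> opgen (k *: b).
Proof. by move=> bg; rewrite -[k *: b]addr0; exact: (oc_lin op_closed_gen). Qed.
Let genD b c : opgen b -> opgen c -> opgen (b + c).
Proof. by move=> bg cg; rewrite -[b]scale1r; exact: (oc_lin op_closed_gen). Qed.
Let genN b : opgen b -> opgen (- b).
Proof. by move=> bg; rewrite -scaleN1r; exact: genZ. Qed.

Let gle b r := opgen b /\ opbound b r.

Let gsep b : gle b 0 -> b = 0.
Proof.
move=> [_ [_ _ b0]]; apply: opfamP => i x; apply/rnorm_le0.
by rewrite (le_trans (b0 i x))// mul0r.
Qed.

Let glim b r : (forall e, 0 < e -> gle b (r + e)) -> gle b r.
Proof.
move=> h; split; first by case: (h 1 ltr01).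
split=> [|i|i x].
- by apply/ler_addgt0Pr => e /h[_ []].
- by case: (h 1 ltr01) => _ [].
have [x0|x0] := eqVneq (rnorm x) 0.
  by case: (h 1 ltr01) => _ [_ _ /(_ i x)]; rewrite x0 !mulr0.
have xp : 0 < rnorm x by rewrite lt_neqAle eq_sym x0 rnorm_ge0.
rewrite -ler_pdivrMr//; apply/ler_addgt0Pr => e e0; rewrite ler_pdivrMr//.
by case: (h e e0) => _ [_ _]; exact.
Qed.

Let gcomplete (u : nat -> opfam H) : (forall n, exists r, gle (u n) r) ->
  (forall e, 0 < e -> exists n0, forall n m, (n0 <= n)%N -> (n0 <= m)%N ->
      gle (u n - u m) e) ->
  exists l, forall e, 0 < e -> exists n0, forall n, (n0 <= n)%N -> gle (u n - l) e.
Proof.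
move=> uU cu.
have ug n : opgen (u n) by case: (uU n) => ? [].
have ul n i : linear (u n i) by case: (uU n) => ? [_ []].
have lim i x : exists y, cvs (fun n => u n i x) y.
  apply: cauchys_cvg => e e0.
  have D0 : 0 < rnorm x + 1 by have := rnorm_ge0 x; lra.
  have [n0 nP] := cu _ (divr_gt0 e0 D0); exists n0 => n m n0n n0m.
  case: (nP n m n0n n0m) => _ [_ _ /(_ i x)] h.
  rewrite -[u n i x - _]/((u n - u m) i x) (le_trans h)//.
  by rewrite mulrAC ler_pdivrMr// ler_pM2l//; lra.
pose l : opfam H := fun i x => sval (cid (lim i x)).
have lP i x : cvs (fun n => u n i x) (l i x) by exact: (svalP (cid (lim i x))).
have ll i : linear (l i).
  move=> k x y; apply: (cvs_unique (lP i _)).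
  have := cvsD (cvsZ k (lP i x)) (lP i y); congr cvs; apply/funext => n.
  by rewrite ul.
have lB e : 0 < e -> exists n0, forall n, (n0 <= n)%N -> opbound (u n - l) e.
  move=> e0; have [n0 nP] := cu e e0; exists n0 => n n0n.
  split=> [|i k x y|i x]; first exact: ltW.
    by rewrite !opfamBE ul ll scalerBr opprD addrACA.
  have := cvsD (cvs_cst (u n i x)) (cvsZ (-1) (lP i x)).
  rewrite scaleN1r => /cvs_le; apply; exists n0 => m n0m.
  by rewrite scaleN1r; case: (nP n m n0n n0m) => _ [_ _]; exact.
have gl : opgen l.
  apply: (oc_lim op_closed_gen) => e /lB[n0 nP].
  by exists (u n0); [exact: ug|exact: nP].
exists l => e /lB[n0 nP]; exists n0 => n n0n; split; last exact: nP.
by apply: genD => //; exact: genN.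
Qed.

Definition op_gauge : gauge (opfam H) := Gauge
  (fun b r (h : gle b r) => let: conj _ (And3 r0 _ _) := h in r0)
  gsep glim (conj gen0 (opbound0 H))
  (fun b c r s (br : gle b r) (cs : gle c s) =>
     conj (genD br.1 cs.1) (opboundD br.2 cs.2))
  (fun k b r (br : gle b r) => conj (genZ k br.1) (opboundZ k br.2))
  (fun b r s (br : gle b r) rs => conj br.1 (opbound_mono br.2 rs))
  gcomplete.

Definition opalg := gspace op_gauge.
HB.instance Definition _ := CompleteNormedModule.on opalg.
Implicit Types b c d : opalg.

Lemma opalg_gen b : opgen (gval b).
Proof. by case: (gval_rnorm b). Qed.

Lemma opalg_bound b : opbound (gval b) (rnorm b).
Proof. by case: (gval_rnorm b). Qed.

Lemma opalg_bounded b : opbounded (gval b).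
Proof. by exists (rnorm b); exact: opalg_bound. Qed.

Lemma opalg_le b r : rnorm b <= r <-> opbound (gval b) r.
Proof.
split=> [/rnormP[]//|br]; apply/rnormP; split=> //; exact: opalg_gen.
Qed.

Lemma opgen_gdom f : opgen f -> f \in gdom op_gauge.
Proof.
by move=> fg; apply/mem_set; have [r fr] := opgen_bounded fg; exists r.
Qed.

Definition opalg_mk f (fg : opgen f) : opalg := GSpace (opgen_gdom fg).

Lemma opalgP b c : (forall i x, gval b i x = gval c i x) -> b = c.
Proof. by move=> bc; apply/val_inj; exact: opfamP. Qed.

Let mul b c : opalg :=
  opalg_mk (oc_mul op_closed_gen (opalg_gen b) (opalg_gen c)).

Let one_gen : opgen (@opone _ _ H).
Proof.
have -> : @opone _ _ H = repfam aone.
  by apply: opfamP => i x; rewrite /repfam (ur_one U).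
exact: (oc_gen op_closed_gen).
Qed.
Let one : opalg := opalg_mk one_gen.

Let lin b i k x y : gval b i (k *: x + y) = k *: gval b i x + gval b i y.
Proof. by have [_ bl _] := opalg_bound b; rewrite bl. Qed.

Let mulA : associative mul. Proof. by move=> b c d; apply: opalgP. Qed.
Let mul1 : left_id one mul. Proof. by move=> b; apply: opalgP. Qed.
Let mulr1 : right_id one mul. Proof. by move=> b; apply: opalgP. Qed.
Let mulDl : left_distributive mul +%R.
Proof. by move=> b c d; apply: opalgP. Qed.
Let mulDr : right_distributive mul +%R.
Proof.
move=> b c d; apply: opalgP => i x.
transitivity (gval b i (1 *: gval c i x + gval d i x)).
  by rewrite scale1r.
by rewrite lin scale1r.
Qed.
Let mulZl k b c : mul (k *: b) c = k *: mul b c.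
Proof. exact: opalgP. Qed.
Let mulZr k b c : mul b (k *: c) = k *: mul b c.
Proof.
apply: opalgP => i x; transitivity (gval b i (k *: gval c i x)) => //.
have lin0 : gval b i 0 = 0.
  by have := @lin b i (-1) 0 0; rewrite scaler0 addr0 scaleN1r addNr.
by rewrite -[k *: _]addr0 lin lin0 addr0.
Qed.

HB.instance Definition _ := Lmodule_isUAlgebra.Build K opalg
  mulA mul1 mulr1 mulDl mulDr mulZl mulZr.

Let normM b c : `|b ** c| <= `|b| * `|c|.
Proof.
rewrite !normr_rnorm -rmorphM lecR; apply/opalg_le.
by apply: opboundM; exact: opalg_bound.
Qed.
HB.instance Definition _ := UAlgebra_isBanachAlgebra.Build K opalg normM.

Let st b : opalg := opalg_mk (oc_star op_closed_gen (opalg_gen b)).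

Let stP b i : adjoint_ops (gval b i) (gval (st b) i).
Proof. by apply: opstarP; exact: opalg_bounded. Qed.

Let st_unique b c : (forall i, adjoint_ops (gval b i) (gval c i)) -> st b = c.
Proof.
move=> bc; apply: opalgP => i x.
by rewrite (adjoint_unique (@stP b i) (bc i)).
Qed.

Let stD : {morph st : b c / b + c}.
Proof.
move=> b c; apply: st_unique => i x y.
rewrite -[gval (b + c) i x]/(gval b i x + gval c i x).
rewrite -[gval (st b + st c) i y]/(gval (st b) i y + gval (st c) i y).
by rewrite innerDl innerDr (stP b) (stP c).
Qed.
Let stZ (k : K) b : st (k *: b) = k^* *: st b.
Proof.
apply: st_unique => i x y.
rewrite -[gval (k *: b) i x]/(k *: gval b i x).
rewrite -[gval (_ *: st b) i y]/(k^* *: gval (st b) i y).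
by rewrite innerZl innerZr conjCK (stP b).
Qed.
Let stM b c : st (b ** c) = st c ** st b.
Proof.
apply: st_unique => i x y.
rewrite -[gval (b ** c) i x]/(gval b i (gval c i x)).
rewrite -[gval (st c ** st b) i y]/(gval (st c) i (gval (st b) i y)).
by rewrite (stP b) (stP c).
Qed.
Let stK : involutive st.
Proof. by move=> b; apply: st_unique => i; apply: adjoint_sym; exact: stP. Qed.

Let normst b : `|st b ** b| = `|b| ^+ 2.
Proof.
rewrite !normr_rnorm -rmorphXn; congr (_%:C); apply/le_anti/andP; split.
  apply/opalg_le; rewrite expr2; apply: opboundM; last exact: opalg_bound.
  by apply: opbound_star; exact: opalg_bound.
have r0 : 0 <= rnorm (st b ** b) by exact: rnorm_ge0.
rewrite -[leRHS](sqr_sqrtr r0) ler_sqr ?nnegrE ?rnorm_ge0 ?sqrtr_ge0//.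
apply/opalg_le; apply: opbound_sqr; first exact: sqrtr_ge0.
  exact: opalg_bounded.
rewrite sqr_sqrtr//; exact: (opalg_bound (st b ** b)).
Qed.

HB.instance Definition _ := BanachAlgebra_isCstarAlgebra.Build K opalg
  stD stZ stM stK normst.

Lemma opalg_star b c : (forall i, adjoint_ops (gval b i) (gval c i)) -> star b = c.
Proof. exact: st_unique. Qed.

Lemma opalg_eval i : is_star_rep (fun b : opalg => gval b i).
Proof.
split; last by move=> b; exact: stP.
split=> [b|b|k b c x|b c x].
- by have [] := opalg_bound b.
- by exists (rnorm b) => x; have [_ _] := opalg_bound b; apply.
- by [].
- by [].
Qed.

Lemma opalg_mulE b c i x : gval (b ** c) i x = gval b i (gval c i x).
Proof. by []. Qed.

Definition op_incl (a : A) : opalg := opalg_mk (oc_gen op_closed_gen a).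

Let inclM : {morph op_incl : a b / a ** b}.
Proof.
by move=> a b; apply: opalgP => i x; rewrite /= /repfam (hom_mul (ur_hom U i)).
Qed.
Let incl1 : op_incl aone = aone.
Proof. by apply: opalgP => i x; rewrite /= /repfam (ur_one U). Qed.
Let incl_lin : linear op_incl.
Proof.
by move=> k a b; apply: opalgP => i x; rewrite /= /repfam (hom_linear (ur_hom U i)).
Qed.
HB.instance Definition _ := GRing.isLinear.Build K A opalg *:%R op_incl incl_lin.
HB.instance Definition _ := isAlgMorphism.Build K A opalg op_incl inclM incl1.

Definition op_incl_morphism : algMorphism A opalg := op_incl.

Lemma op_incl_le a : rnorm (op_incl a) <= N a.
Proof. by apply/opalg_le; exact: repfam_bound. Qed.

(** Polarisation: isometry on sums preserves real parts of inner products, and multiplication by i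
    recovers the imaginary parts. *)
Lemma op_incl_isometry a : (forall i x, rnorm (pi i a x) = rnorm x) ->
  star (op_incl a) ** op_incl a = aone.
Proof.
move=> aiso; have S := @opalg_eval.
apply: opalgP => i x; apply: inner_inj => y.
rewrite opalg_mulE -[gval (op_incl a) i x]/(pi i a x).
have key z : complex.Re (inner z (gval (star (op_incl a)) i (pi i a x))) =
    complex.Re (inner z x).
  rewrite -((S i).2 (op_incl a)) /=.
  have := rnorm_sqrD (pi i a z) (pi i a x).
  have := rnorm_sqrD z x.
  by rewrite -(hom_opD (ur_hom U i)) !aiso => ->; lra.
by apply: complex_eqP => //; rewrite -!innerZl key.
Qed.

(** The families underlying elements of a closed *-subalgebra [T] are [op_closed], so the induction
    principle of [opgen] puts everything in [T]. *)
Lemma op_incl_generates : generates (range op_incl_morphism).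
Proof.
move=> T [Tlin Tmul Tstar] Tcl Tsub; apply/seteqP; split=> // b _.
have : op_closed [set f | exists2 d : opalg, T d & gval d = f].
  split=> [k _ _ [c Tc <-] [d Td <-]|_ _ [c Tc <-] [d Td <-]|_ [c Tc <-]|f fl|a].
  - by exists (k *: c + d) => //; exact: Tlin.
  - by exists (c ** d) => //; exact: Tmul.
  - by exists (star c) => //; exact: Tstar.
  - have fg : opgen f.
      apply: (oc_lim op_closed_gen) => e /fl[_ [d _ <-] df].
      by exists (gval d) => //; exact: opalg_gen.
    exists (opalg_mk fg) => //; move/closedP : Tcl; apply => e /fl[_ [d Td <-] df].
    by exists d => //; apply/opalg_le.
  - by exists (op_incl a) => //; apply: Tsub; exists a.
move/(opalg_gen b) => [d Td] /val_inj db; by rewrite -db.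
Qed.

End OperatorAlgebra.

(** * A C*-cover in which U is an isometry *)

Section MatrixNorm.
Context (R : realType).
Local Notation K := (cplx R).

Lemma mx_opnorm_le (H : hilbertType K) n (T : 'M[H -> H]_n) (r : \bar R) :
  (forall x : 'I_n -> H, \sum_j rnorm (x j) ^+ 2 <= 1 ->
    ((Num.sqrt (\sum_i rnorm (\sum_j T i j (x j)) ^+ 2))%:E <= r)%E) ->
  (mx_opnorm T <= r)%E.
Proof. by move=> h; apply: ge_ereal_sup => _ [x x1 <-]; exact: h. Qed.

Lemma mx_opnorm_ge (H : hilbertType K) n (T : 'M[H -> H]_n) (x : 'I_n -> H) :
  \sum_j rnorm (x j) ^+ 2 <= 1 ->
  ((Num.sqrt (\sum_i rnorm (\sum_j T i j (x j)) ^+ 2))%:E <= mx_opnorm T)%E.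
Proof. by move=> x1; apply: ereal_sup_ubound; exists x. Qed.

Lemma mx_opnorm1_le (H : hilbertType K) (T : 'M[H -> H]_1) (r : R) :
  (mx_opnorm T <= r%:E)%E <-> forall x, rnorm x <= 1 -> rnorm (T 0 0 x) <= r.
Proof.
have e1 (x : 'I_1 -> H) : Num.sqrt (\sum_i rnorm (\sum_j T i j (x j)) ^+ 2) =
    rnorm (T 0 0 (x 0)).
  by rewrite !big_ord1 sqrtr_sqr ger0_norm ?rnorm_ge0.
split=> [Tr x x1|Tr].
  have := le_trans (@mx_opnorm_ge H 1 T (fun=> x) _) Tr.
  by rewrite e1 lee_fin big_ord1; apply; rewrite expr_le1// rnorm_ge0.
apply: mx_opnorm_le => x; rewrite big_ord1 e1 lee_fin => x1; apply: Tr.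
by rewrite -(expr_le1 (n := 2))// rnorm_ge0.
Qed.

Lemma ball_bound (H : hilbertType K) (T : H -> H) (r : R) : 
  (forall k x, T (k *: x) = k *: T x) ->
  (forall x, rnorm x <= 1 -> rnorm (T x) <= r) ->
  forall x, rnorm (T x) <= r * rnorm x.
Proof.
move=> TZ Tr x; have [x0|x0] := eqVneq x 0.
  have := TZ 0 0; rewrite !scale0r x0 => ->; by rewrite rnorm0 mulr0.
have nx : 0 < rnorm x.
  by rewrite lt_neqAle rnorm_ge0 andbT eq_sym; apply: contra_neq x0 => /rnorm_eq0.
have := Tr ((rnorm x)^-1%:C *: x).
rewrite TZ !rnormZ !cabs_real ger0_norm ?invr_ge0 ?rnorm_ge0//.
by rewrite mulVf ?gt_eqF// lexx ler_pdivrMl// mulrC; apply.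
Qed.

End MatrixNorm.

Section CovariantRep.
Context (R : realType) (X : topologicalType) (phi : continuousType X X).
Local Notation K := (cplx R).
Context (H : hilbertType K) (pi : covalg K phi -> H -> H).
Hypothesis pic : is_cov_rep pi.

Lemma cov_rep_one x : pi aone x = x.
Proof.
have ph := cov_rep_hom pic.
apply/subr0_eq/rnorm_eq0; rewrite -(cov_rep_isometry pic) (hom_opB ph).
by rewrite -(hom_mul ph) amula1 subrr rnorm0.
Qed.

End CovariantRep.

Section Restriction.
Context (R : realType) (X : topologicalType) (phi : continuousType X X).
Local Notation K := (cplx R).
Context (A : banachAlgType K) (iota : algMorphism (covalg K phi) A).
Context (B : cstarAlgType K) (i : algMorphism A B).
Hypothesis i_le : forall a, rnorm (i a) <= rnorm a.
Hypothesis i_star : forall f,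
  star (i (iota (cov_fun phi f))) = i (iota (cov_fun phi (contfun_conj f))).
Hypothesis i_iso : star (i (iota (cov_gen R phi))) ** i (iota (cov_gen R phi)) = aone.
Context (H : hilbertType K) (rho : B -> H -> H).
Hypothesis rhos : is_star_rep rho.
Let rhoh : is_hom rho := rhos.1.

Let S x := rho aone x = x.

Let S0 : S 0. Proof. exact: hom_op0 rhoh aone. Qed.
Let Slin (k : K) x y : S x -> S y -> S (k *: x + y).
Proof. by rewrite /S (hom_op_linear rhoh) => -> ->. Qed.
Let Sadh x : adh S x -> S x.
Proof.
move=> Sx; apply/subr0_eq/small_eq0 => e e0.
have [y Sy yx] := Sx (e / 2) (half_gt0 e0).
rewrite (le_trans (rnorm_tri y _ _))// [leRHS]splitr lerD//.
rewrite -{1}Sy -(hom_opB rhoh) (le_trans (star_rep_unit_le rhos _))//.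
by rewrite rnormC.
Qed.

(** The range of the projection [rho aone]. When [rho] is not unital, U acts on [H] only as a
    partial isometry; on this subspace it is an isometry and the unit acts as the identity. *)
Definition unit_range : closed_subspace H := ClosedSubspace S0 Slin Sadh.

Let Srho b x : S (rho b x).
Proof. by rewrite /S -(hom_mul rhoh) amul1a. Qed.

Definition compress (b : B) (x : subhilbert unit_range) : subhilbert unit_range :=
  sub_mk (S := unit_range) (Srho b (gval x)).

Lemma compress_semicrossed : is_semicrossed_rep iota (compress \o i).
Proof.
split.
- split=> [a k x y|a|k a b x|a b x].
  + by apply: val_inj => /=; rewrite (hom_op_linear rhoh).
  + exists (rnorm (i a)) => x; rewrite !sub_rnorm.
    exact: star_rep_contractive.
  + by apply: val_inj; rewrite /= linearP (hom_linear rhoh).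
  + by apply: val_inj; rewrite /= alg_morphM (hom_mul rhoh).
- split; first split=> [a k x y|a|k a b x|a b x].
  + by apply: val_inj => /=; rewrite (hom_op_linear rhoh).
  + exists (rnorm (i (iota a))) => x; rewrite !sub_rnorm.
    exact: star_rep_contractive.
  + by apply: val_inj; rewrite /= !linearP (hom_linear rhoh).
  + by apply: val_inj; rewrite /= !alg_morphM (hom_mul rhoh).
  + move=> f x y; rewrite !sub_inner /= -i_star; exact: rhos.2.
  + move=> x; rewrite !sub_rnorm /=; apply/eqP.
    rewrite -(eqrXn2 (n := 2)) ?rnorm_ge0//; apply/eqP; apply: complexI.
    have xS : rho aone (gval x) = gval x := sub_mem x.
    by rewrite star_rep_sqr// i_iso xS -inner_rnorm.
- move=> a x; rewrite !sub_rnorm (le_trans (star_rep_contractive rhos _ _))//.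
  by rewrite ler_wpM2r// rnorm_ge0.
Qed.

Lemma compress_mxnorm n (F : 'M[A]_n) :
  (mx_opnorm (map_mx rho (map_mx i F)) <= semicrossed_mxnorm iota F)%E.
Proof.
apply: le_trans (_ : mx_opnorm (map_mx (compress \o i) F) <= _)%E; last first.
  apply: ereal_sup_ubound; exists (subhilbert unit_range), (compress \o i).
  by split=> //; exact: compress_semicrossed.
apply: mx_opnorm_le => x x1.
(* Projecting the test vectors does not change their images under [rho] and does not increase their
   norms. *)
pose y j := sub_mk (S := unit_range) (Srho aone (x j)).
apply: le_trans (@mx_opnorm_ge _ _ _ _ y _).
  rewrite lee_fin ler_wsqrtr//; apply: ler_sum => k _.
  rewrite sub_rnorm gval_sum le_eqVlt; apply/orP; left; apply/eqP.
  congr (rnorm _ ^+ 2); apply: eq_bigr => l _; rewrite !mxE /= -(hom_mul rhoh).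
  by rewrite amula1.
rewrite (le_trans _ x1)//; apply: ler_sum => j _.
rewrite sub_rnorm ler_sqr ?nnegrE ?rnorm_ge0//.
exact: star_rep_unit_le.
Qed.

End Restriction.

Section Cover.
Context (R : realType) (X : topologicalType) (phi : continuousType X X).
Local Notation K := (cplx R).
Context (A : banachAlgType K) (iota : algMorphism (covalg K phi) A).

Definition near_norming (t : {n : nat & 'M[A]_n} * \bar R) : Prop :=
  exists (H : hilbertType K) (pi : A -> H -> H),
    is_semicrossed_rep iota pi /\ (t.2 < mx_opnorm (map_mx pi (projT2 t.1)))%E.

(* One near-norming representation for each matrix and each bound: all the
   representations together would not form a small family. *)
Definition cover_index := {t | near_norming t}.

Let hilb (t : cover_index) : hilbertType K := projT1 (cid (svalP t)).
Let rep (t : cover_index) : A -> hilb t -> hilb t :=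
  projT1 (cid (projT2 (cid (svalP t)))).
Arguments rep : clear implicits.
Let repP t : is_semicrossed_rep iota (rep t) /\
  ((sval t).2 < mx_opnorm (map_mx (rep t) (projT2 (sval t).1)))%E.
Proof. exact: projT2 (cid (projT2 (cid (svalP t)))). Qed.

Lemma semicrossed_rep_one (H : hilbertType K) (pi : A -> H -> H) x :
  is_semicrossed_rep iota pi -> pi aone x = x.
Proof.
by move=> [_ pc _]; have := cov_rep_one pc x; rewrite /= alg_morph1.
Qed.

Let reps : unital_reps (@rnorm R A) rep.
Proof.
split=> [t|t x|t a x|a].
- by have [[]] := repP t.
- by apply: semicrossed_rep_one; have [] := repP t.
- by have [[]] := repP t.
- exact: rnorm_ge0.
Qed.

Lemma exists_cover : exists (D : cstarAlgType K) (i : algMorphism A D),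
  [/\ is_cstar_cover (semicrossed_mxnorm iota) i,
      forall f, star (i (iota (cov_fun phi f))) =
                i (iota (cov_fun phi (contfun_conj f))) &
      star (i (iota (cov_gen R phi))) ** i (iota (cov_gen R phi)) = aone].
Proof.
exists (opalg reps), (op_incl_morphism reps).
have istar f : star (op_incl_morphism reps (iota (cov_fun phi f))) =
    op_incl_morphism reps (iota (cov_fun phi (contfun_conj f))).
  apply: opalg_star => t; have [[_ pc _] _] := repP t.
  exact: (cov_rep_star pc).
have iiso : star (op_incl_morphism reps (iota (cov_gen R phi))) **
    op_incl_morphism reps (iota (cov_gen R phi)) = aone.
  apply: op_incl_isometry => t x; have [[_ pc _] _] := repP t.
  exact: (cov_rep_isometry pc).
split=> //; split; last exact: op_incl_generates.
move=> n F; apply/le_anti/andP; split.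
  apply: ge_ereal_sup => _ [H [rho [rhos ->]]].
  apply: compress_mxnorm => // a; exact: op_incl_le.
rewrite leNgt; apply/negP => lt.
have [_ [H [pi [pis ->]]] ltpi] := ereal_sup_gt lt.
(* The index uses the supposedly too small C*-norm itself as its bound: evaluation at that index
   exceeds it. *)
have nn : near_norming (existT _ n F, cstar_mxnorm (map_mx (op_incl_morphism reps) F)).
  by exists H, pi.
have [_ /=] := repP (exist _ _ nn); apply/negP; rewrite -leNgt.
apply: ereal_sup_ubound.
exists (hilb (exist _ _ nn)), (fun b : opalg reps => gval b (exist _ _ nn)).
split; first exact: opalg_eval.
by congr mx_opnorm; apply/matrixP => k l; rewrite !mxE.
Qed.

End Cover.

(** * Extension by density and orbit representations *)

Section Extension.
Context (R : realType).
Local Notation K := (cplx R).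

Lemma cvs_bounded (V W : normedModType K) (f : V -> W) (C : R) (u : nat -> V) l :
  0 <= C -> (forall x y, rnorm (f x - f y) <= C * rnorm (x - y)) ->
  cvs u l -> cvs (f \o u) (f l).
Proof.
move=> C0 fC ul e e0.
have D0 : 0 < C + 1 by lra.
have [n0 nP] := ul _ (divr_gt0 e0 D0); exists n0 => n /nP.
rewrite ler_pdivlMr// => h; rewrite (le_trans (fC _ _))//.
by have := rnorm_ge0 (u n - l); nra.
Qed.

Lemma cvs_ext (V : normedModType K) (u v : nat -> V) l :
  (forall n, u n = v n) -> cvs u l -> cvs v l.
Proof. by move=> /funext ->. Qed.

(** [i] may have a kernel: the bound makes the limit of [T (u n)] depend only on the limit of
    [i (u n)]. The middle conclusion is kept because algebraic identities are later transferred
    along such sequences. *)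
Lemma extend_bounded (P : lmodType K) (V : normedModType K)
    (W : completeNormedModType K) (i : {linear P -> V}) (T : {linear P -> W}) (C : R) :
  0 <= C -> dense (range i) -> (forall F, rnorm (T F) <= C * rnorm (i F)) ->
  exists S : V -> W,
    [/\ forall F, S (i F) = T F,
        forall (u : nat -> P) a, cvs (i \o u) a -> cvs (T \o u) (S a) &
        forall a, rnorm (S a) <= C * rnorm a].
Proof.
move=> C0 di TC.
have TB F G : rnorm (T F - T G) <= C * rnorm (i F - i G).
  by rewrite -!raddfB; exact: TC.
have lim a : exists y, forall u : nat -> P, cvs (i \o u) a -> cvs (T \o u) y.
  have [v [vr va]] := adh_cvs (dense_adh a di).
  have /choice[u uv] : forall n, exists F, i F = v n.
    by move=> n; have [F _ <-] := vr n; exists F.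
  have [|y yP] := @cauchys_cvg _ _ (T \o u).
    move=> e e0; have D0 : 0 < C + 1 by lra.
    have [n0 nP] := cvs_cauchy va (divr_gt0 e0 D0); exists n0 => n m n0n n0m.
    have := nP n m n0n n0m; rewrite -!uv ler_pdivlMr// => h.
    rewrite (le_trans (TB _ _))//.
    by have := rnorm_ge0 (i (u n) - i (u m)); nra.
  exists y => w wa e e0.
  have D0 : 0 < 2 * C + 1 by lra.
  have [n0 nP] := yP _ (half_gt0 e0).
  have [n1 mP] := va _ (divr_gt0 (half_gt0 e0) D0).
  have [n2 lP] := wa _ (divr_gt0 (half_gt0 e0) D0).
  exists (maxn n0 (maxn n1 n2)) => n; rewrite !geq_max => /and3P[/nP h0 /mP h1 /lP h2].
  rewrite (le_trans (rnorm_tri (T (u n)) _ _))// [leRHS]splitr lerD// ?h0//=.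
  rewrite (le_trans (TB _ _))//.
  move: h1 h2; rewrite -uv /= !ler_pdivlMr// => h1 h2.
  have := rnorm_tri a (i (w n)) (i (u n)); rewrite [rnorm (a - _)]rnormC => h3.
  have := rnorm_ge0 (i (w n) - a); have := rnorm_ge0 (i (u n) - a); nra.
pose S a := sval (cid (lim a)).
have SP u a : cvs (i \o u) a -> cvs (T \o u) (S a).
  by move=> ua; exact: (svalP (cid (lim a))).
have Si F : S (i F) = T F.
  by apply: (cvs_unique (SP (fun=> F) (i F) _)); exact: cvs_cst.
exists S; split=> // a; apply/ler_addgt0Pr => e e0.
have [v [vr va]] := adh_cvs (dense_adh a di).
have /choice[u uv] : forall n, exists F, i F = v n.
  by move=> n; have [F _ <-] := vr n; exists F.
have ua : cvs (i \o u) a by apply: cvs_ext va => n; rewrite /= uv.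
apply: (cvs_le (SP _ _ ua)).
have D0 : 0 < C + 1 by lra.
have [n0 nP] := ua _ (divr_gt0 e0 D0); exists n0 => n /nP /=.
rewrite ler_pdivlMr// => h; rewrite (le_trans (TC _))//.
have := rnorm_lb (i (u n)) a; have := rnorm_ge0 (i (u n) - a); nra.
Qed.

End Extension.

Section ExtendRep.
Context (R : realType) (X : topologicalType) (phi : continuousType X X).
Local Notation K := (cplx R).
Context (A : banachAlgType K) (iota : algMorphism (covalg K phi) A).
Hypothesis sc : is_semicrossed iota.

Lemma cov_rep_le (H : hilbertType K) (pi : covalg K phi -> H -> H) F x :
  is_cov_rep pi -> rnorm (pi F x) <= rnorm (iota F) * rnorm x.
Proof.
move=> pic; have ph := cov_rep_hom pic.
apply: ball_bound => [k y|y y1]; first exact: hom_opZ.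
rewrite -lee_fin (sc.1 F).
apply: (@le_trans _ _ (opnorm (pi F))).
  by apply: ereal_sup_ubound; exists y.
by apply: ereal_sup_ubound; exists H, pi.
Qed.

Lemma semicrossed_le F (r : R) :
  (forall (H : hilbertType K) (pi : covalg K phi -> H -> H), is_cov_rep pi ->
     forall x, rnorm (pi F x) <= r * rnorm x) -> 0 <= r ->
  rnorm (iota F) <= r.
Proof.
move=> h r0; rewrite -lee_fin (sc.1 F).
apply: ge_ereal_sup => _ [H [pi [pic ->]]].
apply: ge_ereal_sup => _ [x /= x1 <-]; rewrite lee_fin.
by rewrite (le_trans (h _ _ pic x))// ler_piMr.
Qed.

Lemma dense_seq (a : A) : exists u : nat -> covalg K phi, cvs (iota \o u) a.
Proof.
have [v [vr va]] := adh_cvs (dense_adh a sc.2).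
have /choice[u uv] : forall n, exists F, iota F = v n.
  by move=> n; have [F _ <-] := vr n; exists F.
by exists u; apply: cvs_ext va => n; rewrite /= uv.
Qed.

Lemma extend_cov_rep (H : hilbertType K) (pi : covalg K phi -> H -> H) :
  is_cov_rep pi -> exists rho : A -> H -> H,
    is_semicrossed_rep iota rho /\ forall F, rho (iota F) = pi F.
Proof.
move=> pic; have ph := cov_rep_hom pic.
pose ev x F := pi F x.
have evL x : linear (ev x) by move=> k a b; exact: hom_linear.
pose evl x : {linear covalg K phi -> H} :=
  HB.pack (ev x) (GRing.isLinear.Build _ _ _ _ (ev x) (evL x)).
have ex x := @extend_bounded _ _ _ H iota (evl x) (rnorm x) (rnorm_ge0 x) sc.2.
have {}ex x : exists S : A -> H,
    [/\ forall F, S (iota F) = pi F x,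
        forall (u : nat -> covalg K phi) a, cvs (iota \o u) a ->
          cvs (fun n => pi (u n) x) (S a) &
        forall a, rnorm (S a) <= rnorm x * rnorm a].
  by apply: ex => F; rewrite mulrC; exact: cov_rep_le.
have [S SP] := choice ex.
pose rho a x := S x a.
have rhoi F x : rho (iota F) x = pi F x by rewrite /rho; case: (SP x).
have rhoc u a x : cvs (iota \o u) a -> cvs (fun n => pi (u n) x) (rho a x).
  by rewrite /rho; case: (SP x) => _ + _; apply.
have rhole a x : rnorm (rho a x) <= rnorm a * rnorm x.
  by rewrite mulrC /rho; case: (SP x).
have rhoiE F : rho (iota F) = pi F by apply/funext => x; rewrite rhoi.
have rhoLin k a b x : rho (k *: a + b) x = k *: rho a x + rho b x.
  have [u ua] := dense_seq a; have [v vb] := dense_seq b.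
  apply: (cvs_unique (rhoc (fun n => k *: u n + v n) _ x _)).
    apply: cvs_ext (cvsD (cvsZ k ua) vb) => n /=; by rewrite linearP.
  apply: cvs_ext (cvsD (cvsZ k (rhoc _ _ x ua)) (rhoc _ _ x vb)) => n.
  by rewrite (hom_linear ph).
have rhoB a b x : rho (a - b) x = rho a x - rho b x.
  by rewrite addrC -scaleN1r rhoLin scaleN1r addrC.
have rhoOp a k x y : rho a (k *: x + y) = k *: rho a x + rho a y.
  have [u ua] := dense_seq a; apply: (cvs_unique (rhoc _ _ _ ua)).
  apply: cvs_ext (cvsD (cvsZ k (rhoc _ _ x ua)) (rhoc _ _ y ua)) => n.
  by rewrite (hom_op_linear ph).
have rhoOpB a x y : rho a (x - y) = rho a x - rho a y.
  by rewrite addrC -scaleN1r rhoOp scaleN1r addrC.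
(* Multiplicativity is obtained one factor at a time: here the right factor is a polynomial, and the
   second limit uses boundedness of [rho a]. *)
have rhoM1 a G x : rho (a ** iota G) x = rho a (pi G x).
  have [u ua] := dense_seq a.
  apply: (cvs_unique (rhoc (fun n => u n ** G) _ x _)).
    by apply: cvs_ext (cvsMl (iota G) ua) => n /=; rewrite alg_morphM.
  by apply: cvs_ext (rhoc _ _ (pi G x) ua) => n; rewrite (hom_mul ph).
exists rho; split=> //; split=> //.
- split=> // [a|a b x]; first by exists (rnorm a).
  have [v vb] := dense_seq b.
  have c1 : cvs (fun n => rho (a ** iota (v n)) x) (rho (a ** b) x).
    apply: (@cvs_bounded _ _ _ (fun c => rho c x) (rnorm x) (fun n => a ** iota (v n))).
    - exact: rnorm_ge0.
    - by move=> c d; rewrite -rhoB mulrC.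
    - exact: cvsMr.
  apply: (cvs_unique c1).
  apply: cvs_ext (@cvs_bounded _ _ _ (rho a) (rnorm a) _ _ _ _ (rhoc _ _ x vb)).
  - by move=> n /=; rewrite rhoM1.
  - exact: rnorm_ge0.
  - by move=> c d; rewrite -rhoOpB.
- by rewrite (_ : rho \o iota = pi)//; apply/funext => F; exact: rhoiE.
Qed.

End ExtendRep.

Section ContinuousFunctions.
Context (R : realType) (X : topologicalType).
Local Notation K := (cplx R).
Local Notation CX := (contfun X K).

Lemma cabs_lip (a b : K) : `|cabs a - cabs b| <= cabs (a - b).
Proof.
rewrite ler_norml; apply/andP; split.
  by rewrite lerNl opprB lerBlDr cabsC -{1}(subrK a b) cabsD.
by rewrite lerBlDr -{1}(subrK b a) cabsD.
Qed.

Lemma cts_near (f : CX) x (e : R) : 0 < e ->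
  \forall z \near x, cabs (f z - f x) <= e.
Proof.
move=> e0; have fc : {for x, continuous f} by exact: cts_fun.
apply: (fc [set w | cabs (w - f x) <= e]).
by apply/(@nbhs_rnorm R K^o); exists e.
Qed.

Lemma cabs_continuous (f : CX) : continuous (fun x => cabs (f x) : R).
Proof.
move=> x; apply/cvgrPdist_le => e e0; have := cts_near f x e0.
by apply: filterS => z zx; rewrite (le_trans (cabs_lip _ _))// cabsC.
Qed.

Lemma cts_bounded (f : CX) : compact [set: X] -> exists2 B : R, 0 <= B &
  forall x, cabs (f x) <= B.
Proof.
move=> cX.
have cf : compact ((fun x => cabs (f x) : R) @` [set: X]).
  apply: continuous_compact => //; apply: continuous_subspaceT.
  exact: cabs_continuous.
have [m [_ mP]] := compact_bounded cf.
exists (`|m| + 1) => [|x]; first by rewrite addr_ge0.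
have m1 : m < `|m| + 1 by rewrite (le_lt_trans (ler_norm _))// ltrDl.
have /= := mP _ m1 (cabs (f x)); rewrite (ger0_norm (cabs_ge0 _)).
by apply; exists x.
Qed.

Lemma contD (f g : CX) x : (f + g) x = f x + g x. Proof. by []. Qed.
Lemma contM (f g : CX) x : (f * g) x = f x * g x. Proof. by []. Qed.
Lemma contN (f : CX) x : (- f) x = - f x. Proof. by []. Qed.
Lemma contZ (k : K) (f : CX) x : (k *: f) x = k * f x. Proof. by []. Qed.
Lemma cont0 x : (0 : CX) x = 0. Proof. by []. Qed.
Lemma cont1 x : (1 : CX) x = 1. Proof. by []. Qed.
Lemma cont_conj (f : CX) x : contfun_conj f x = (f x)^*. Proof. by []. Qed.
Lemma cont_sum I (r : seq I) (P : pred I) (F : I -> CX) x :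
  (\sum_(i <- r | P i) F i) x = \sum_(i <- r | P i) F i x.
Proof. exact: (big_morph (fun f : CX => f x) (fun f g => contD f g x) (cont0 x)). Qed.

Context (phi : continuousType X X).

Lemma precomp_iter n (f : CX) x : iter n (@precomp X K phi) f x = f (iter n phi x).
Proof. by elim: n x => //= n IH x; rewrite /precomp /= IH -iterSr. Qed.

Lemma covcoefD (F G : covalg K phi) n : covcoef (F + G) n = covcoef F n + covcoef G n.
Proof. by []. Qed.
Lemma covcoefZ k (F : covalg K phi) n : covcoef (k *: F) n = k *: covcoef F n.
Proof. by []. Qed.
Lemma covcoefN (F : covalg K phi) n : covcoef (- F) n = - covcoef F n.
Proof. by []. Qed.
Lemma covcoef0 n : covcoef (0 : covalg K phi) n = 0.
Proof. by []. Qed.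
Lemma covcoefM (F G : covalg K phi) n x : covcoef (F ** G) n x =
  \sum_(i < n.+1) covcoef F i (iter (n - i) phi x) * covcoef G (n - i)%N x.
Proof.
rewrite [covcoef _ n](_ : _ = \sum_(i < n.+1)
  iter (n - i) (@precomp X K phi) (covcoef F i) * covcoef G (n - i)%N)//.
by rewrite cont_sum; apply: eq_bigr => i _; rewrite contM precomp_iter.
Qed.
Lemma covcoef_mono k (f : CX) n : covcoef (covmonom phi k f) n = if n == k then f else 0.
Proof. by []. Qed.
Lemma covcoef_sum I (r : seq I) (P : pred I) (F : I -> covalg K phi) n :
  covcoef (\sum_(i <- r | P i) F i) n = \sum_(i <- r | P i) covcoef (F i) n.
Proof.
exact: (big_morph (fun F : covalg K phi => covcoef F n)
  (fun F G => covcoefD F G n) (covcoef0 n)).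
Qed.
Lemma covcoef_fin (F : covalg K phi) : exists N, forall n, (N <= n)%N -> covcoef F n = 0.
Proof. by have /set_mem := covcoefP F. Qed.
Lemma covalgP (F G : covalg K phi) :
  (forall n x, covcoef F n x = covcoef G n x) -> F = G.
Proof.
move=> FG; apply/val_inj/funext => n; apply/continuousEP => x; exact: FG.
Qed.

End ContinuousFunctions.

Section Orbit.
Context (R : realType) (X : topologicalType) (phi : continuousType X X).
Local Notation K := (cplx R).
Hypothesis cX : compact [set: X].
Context (x : X).
Local Notation y k := (iter k phi x).
Implicit Types (F G : covalg K phi) (u v w : nat -> K^o).

(** In matrix form, U is the unilateral shift and f the diagonal operator with entries f(phi^m x);
    the entry (l, m) of F is then its coefficient of degree l - m at phi^m x. *)
Let orb F u : nat -> K^o := fun l => \sum_(m < l.+1) covcoef F (l - m)%N (y m) * u m.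

Let shift n (f : contfun X K) u : nat -> K^o :=
  fun l => if (n <= l)%N then f (y (l - n)%N) * u (l - n)%N else 0.

Let shift_bound n (f : contfun X K) u (r B : R) : 0 <= B -> (forall z, cabs (f z) <= B) ->
  ell2_gauge R u r -> ell2_gauge R (shift n f u) (B * r).
Proof.
move=> B0 fB [r0 ur]; split=> [|N]; first exact: mulr_ge0.
rewrite exprMn; apply: (@le_trans _ _ (B ^+ 2 * psum N u)); last first.
  by rewrite ler_wpM2l ?sqr_ge0.
have [Nn|nN] := leqP N n.
  rewrite /psum big1 ?mulr_ge0 ?sqr_ge0 ?psum_ge0// => i _.
  by rewrite /shift leqNgt (leq_trans (ltn_ord i) Nn) cabs0 expr0n.
apply: (@le_trans _ _ (B ^+ 2 * psum (N - n) u)); last first.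
  by rewrite ler_wpM2l ?sqr_ge0// psum_mono// leq_subr.
rewrite -{1}(subnKC (ltnW nN)) /psum big_split_ord /= big1 ?add0r; last first.
  by move=> i _; rewrite /shift leqNgt ltn_ord cabs0 expr0n.
rewrite mulr_sumr; apply: ler_sum => i _; rewrite /shift leq_addr addKn cabsM.
rewrite exprMn ler_wpM2r ?sqr_ge0// ler_sqr ?nnegrE ?cabs_ge0//.
Qed.

Let orb_shift F u N : (forall n, (N <= n)%N -> covcoef F n = 0) ->
  orb F u = \sum_(n < N) shift n (covcoef F n) u.
Proof.
move=> FN; apply/funext => l; rewrite fct_sumE.
transitivity (\sum_(0 <= n < l.+1) covcoef F n (y (l - n)%N) * u (l - n)%N).
  rewrite /orb (reindex_inj rev_ord_inj) /= big_mkord; apply: eq_bigr => i _.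
  by rewrite subSS subKn// -ltnS.
rewrite -(big_mkord xpredT (fun n => shift n (covcoef F n) u l)).
pose t n := shift n (covcoef F n) u l.
have tN n : (N <= n)%N -> t n = 0.
  by move=> Nn; rewrite /t /shift FN// cont0 mul0r; case: ifP.
have tl n : (l < n)%N -> t n = 0 by rewrite /t /shift ltnNge => /negbTE ->.
(* Both sums are extended to a common range: [t] vanishes above [l] and from [N] on. *)
transitivity (\sum_(0 <= n < l.+1 + N) t n).
  rewrite [RHS](big_cat_nat (n := l.+1))//= ?leq_addr// [X in _ + X]big_nat_cond.
  rewrite [X in _ + X]big1 ?addr0; last by move=> n /andP[/andP[/tl]].
  by rewrite !big_nat; apply: eq_bigr => n /= nl; rewrite /t /shift -ltnS nl.
rewrite [LHS](big_cat_nat (n := N))//= ?leq_addl// [X in _ + X]big_nat_cond.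
by rewrite [X in _ + X]big1 ?addr0// => n /andP[/andP[/tN]].
Qed.

Let orb_bound F : exists M : R, forall u r, ell2_gauge R u r ->
  ell2_gauge R (orb F u) (M * r).
Proof.
have [N FN] := covcoef_fin F.
have /choice[B BP] : forall n, exists B : R, 0 <= B /\
    forall z, cabs (covcoef F n z) <= B.
  by move=> n; have [B B0 BP] := cts_bounded (covcoef F n) cX; exists B.
exists (\sum_(n < N) B n) => u r ur; rewrite (orb_shift u FN) mulr_suml.
elim/big_rec2 : _ => [|i r' u' _ h]; first exact: gle0.
by apply: gleD => //; apply: shift_bound => //; case: (BP i).
Qed.

Let orb_dom F (v : ell2 R) : orb F v \in gdom (ell2_gauge R).
Proof.
apply/mem_set; have [M MP] := orb_bound F.
by exists (M * rnorm v); apply: MP; exact: gval_rnorm.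
Qed.

Definition orbit_rep F (v : ell2 R) : ell2 R := GSpace (orb_dom F v).

Lemma orbit_repE F (v : ell2 R) l : orbit_rep F v l =
  \sum_(m < l.+1) covcoef F (l - m)%N (y m) * v m.
Proof. by []. Qed.

Let ell2P (v w : ell2 R) : (forall l, v l = w l) -> v = w.
Proof. by move=> vw; apply/val_inj/funext. Qed.

Lemma orbit_rep_hom : is_hom orbit_rep.
Proof.
split=> [F k v w|F|k F G v|F G v].
- apply: ell2P => l; rewrite orbit_repE.
  rewrite [RHS](_ : _ = k * orbit_rep F v l + orbit_rep F w l)// !orbit_repE.
  rewrite mulr_sumr -big_split; apply: eq_bigr => m _ /=.
  transitivity (covcoef F (l - m)%N (y m) * (k * ell2_fun v m + ell2_fun w m)) => //.
  by rewrite mulrDr mulrCA.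
- have [M MP] := orb_bound F; exists M => v; apply/rnormP; apply: MP.
  exact: gval_rnorm.
- apply: ell2P => l.
  rewrite [RHS](_ : _ = k * orbit_rep F v l + orbit_rep G v l)// !orbit_repE.
  rewrite mulr_sumr -big_split; apply: eq_bigr => m _ /=.
  transitivity ((k * covcoef F (l - m)%N (y m) + covcoef G (l - m)%N (y m)) *
    ell2_fun v m) => //.
  by rewrite mulrDl mulrA.
- apply: ell2P => l; rewrite !orbit_repE.
  (* Matrix product over paths m <= p <= l: [G] leads from [m] to the intermediate index [p], and
     [F] from [p] to [l]. *)
  transitivity (\sum_(m < l.+1) \sum_(p < l.+1 | (m <= p)%N)
    covcoef F (l - p)%N (y p) * (covcoef G (p - m)%N (y m) * ell2_fun v m)).
    apply: eq_bigr => m _; rewrite covcoefM mulr_suml.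
    rewrite (reindex_inj rev_ord_inj) /=.
    have ml : (m <= l)%N by rewrite -ltnS.
    transitivity (\sum_(0 <= q < (l - m).+1)
      covcoef F (l - (q + m))%N (y (q + m)) * (covcoef G q (y m) * ell2_fun v m)).
      rewrite big_mkord; apply: eq_bigr => q _.
      have qlm : (q <= l - m)%N by rewrite -ltnS.
      by rewrite subSS subKn// -iterD mulrA subnDA subnAC.
    transitivity (\sum_(m <= p < l.+1)
      covcoef F (l - p)%N (y p) * (covcoef G (p - m)%N (y m) * ell2_fun v m)).
      rewrite -[in RHS](add0n m) big_addn !add0n subSn//.
      by apply: eq_bigr => q _; rewrite addnK.
    rewrite [LHS](@big_nat_widenl _ _ _ m 0)// [LHS]big_mkord.
    exact: eq_bigl.
  rewrite (exchange_big_dep predT)//=; apply: eq_bigr => p _.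
  rewrite -mulr_sumr; congr (_ * _).
  have pl : (p.+1 <= l.+1)%N by [].
  rewrite [RHS](big_ord_widen l.+1 (fun m => covcoef G (p - m) (y m) * ell2_fun v m))//.
Qed.

Lemma orbit_rep_cov : is_cov_rep orbit_rep.
Proof.
have funE f (v : ell2 R) l : orbit_rep (cov_fun phi f) v l = f (y l) * v l.
  rewrite orbit_repE big_ord_recr /= subnn big1 ?add0r// => i _.
  by rewrite ifN ?mul0r// subn_eq0 -ltnNge.
split; first exact: orbit_rep_hom.
- move=> f v w; apply: (cvs_unique (ell2_inner _ _)).
  apply: cvs_ext (ell2_inner _ _) => n; apply: eq_bigr => i _.
  by rewrite !funE rmorphM /= conjCK; ring.
- have genS (v : ell2 R) l : orbit_rep (cov_gen R phi) v l.+1 = v l.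
    rewrite orbit_repE big_ord_recr /= subnn cont0 mul0r addr0 big_ord_recr /=.
    rewrite subSnn cont1 mul1r big1 ?add0r// => i _.
    by rewrite ifN ?mul0r// subSn ?(ltnW (ltn_ord i))// eqSS
      subn_eq0 -ltnNge.
  have gen0 (v : ell2 R) : orbit_rep (cov_gen R phi) v 0 = 0.
    by rewrite orbit_repE big_ord1 [covcoef _ _ _](_ : _ = 0) ?mul0r.
  have genP (v : ell2 R) N :
      psum N.+1 (orbit_rep (cov_gen R phi) v) = psum N v.
    rewrite /psum big_ord_recl gen0 cabs0 expr0n add0r.
    by apply: eq_bigr => i _; rewrite lift0 genS.
  move=> v; apply/le_anti/andP; split; apply/ell2_le; split; rewrite ?rnorm_ge0//.
    move=> [|N]; first by rewrite /psum big_ord0 sqr_ge0.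
    by rewrite genP ell2_psum.
  by move=> N; rewrite -genP ell2_psum.
Qed.

(** The zeroth column of the matrix lists the coefficients at [x], so operator norms control all
    coefficients pointwise. *)
Lemma orbit_rep_e0 F n (e0 : ell2 R) :
  (forall l, e0 l = (l == 0%N)%:R) -> orbit_rep F e0 n = covcoef F n x.
Proof.
move=> e0E; rewrite orbit_repE big_ord_recl e0E eqxx mulr1 subn0 big1 ?addr0//.
by move=> i _; rewrite e0E mulr0.
Qed.

End Orbit.

(** * The polynomial algebra *)

Section CovariantAlgebra.
Context (R : realType) (X : topologicalType) (phi : continuousType X X).
Local Notation K := (cplx R).
Local Notation CX := (contfun X K).
Local Notation U := (cov_gen R phi).
Implicit Types F G : covalg K phi.

Lemma covcoef_gen n z : covcoef U n z = (n == 1%N)%:R.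
Proof. by rewrite covcoef_mono; case: eqP. Qed.

Lemma covcoef_genM F n z : covcoef (U ** F) n.+1 z = covcoef F n z.
Proof.
rewrite covcoefM !big_ord_recl big1 => [|i _]; last by rewrite covcoef_gen mul0r.
by rewrite !covcoef_gen mul0r add0r addr0 mul1r subn1.
Qed.

Lemma covcoef_genM0 F z : covcoef (U ** F) 0 z = 0.
Proof. by rewrite covcoefM big_ord1 covcoef_gen mul0r. Qed.

Lemma covcoef_Mgen F n z : covcoef (F ** U) n.+1 z = covcoef F n (phi z).
Proof.
rewrite covcoefM !big_ord_recr big1 => [|i _].
  by rewrite !covcoef_gen /= subnn subSnn mulr0 addr0 mulr1 add0r.
rewrite covcoef_gen /= subSn ?(ltnW (ltn_ord i))// eqSS.
by rewrite subn_eq0 leqNgt ltn_ord mulr0.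
Qed.

Lemma covcoef_Mgen0 F z : covcoef (F ** U) 0 z = 0.
Proof. by rewrite covcoefM big_ord1 covcoef_gen mulr0. Qed.

Lemma covcoef_funM (f : CX) F n z :
  covcoef (cov_fun phi f ** F) n z = f (iter n phi z) * covcoef F n z.
Proof.
rewrite covcoefM big_ord_recl big1 => [|i _]; last by rewrite covcoef_mono cont0 mul0r.
by rewrite addr0 subn0.
Qed.

Lemma covcoef_Mfun (f : CX) F n z :
  covcoef (F ** cov_fun phi f) n z = covcoef F n z * f z.
Proof.
rewrite covcoefM big_ord_recr big1 => [|i _]; first by rewrite /= subnn add0r.
by rewrite covcoef_mono /= subn_eq0 leqNgt ltn_ord cont0 mulr0.
Qed.

Lemma cov_funM (f g : CX) : cov_fun phi f ** cov_fun phi g = cov_fun phi (f * g).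
Proof.
apply: covalgP => n z; rewrite covcoef_funM !covcoef_mono.
by case: eqP => [->|_]; [rewrite contM|rewrite cont0 mulr0].
Qed.

Lemma cov_fun1 : cov_fun phi 1 = aone :> covalg K phi.
Proof. by []. Qed.

Lemma cov_fun_lin (k : K) (f g : CX) :
  cov_fun phi (k *: f + g) = k *: cov_fun phi f + cov_fun phi g.
Proof.
apply: covalgP => n z; rewrite covcoefD covcoefZ contD contZ !covcoef_mono.
by case: eqP => // _; rewrite !cont0 mulr0 addr0.
Qed.

Lemma cov_genX n (f : CX) : apow U n ** cov_fun phi f = covmonom phi n f.
Proof.
elim: n => [|n IH]; first by rewrite /= amul1a.
rewrite /= -amulA IH; apply: covalgP => -[|m] z; first by rewrite covcoef_genM0.
by rewrite covcoef_genM !covcoef_mono.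
Qed.

Lemma cov_decomp F N : (forall n, (N <= n)%N -> covcoef F n = 0) ->
  F = \sum_(n < N) covmonom phi n (covcoef F n).
Proof.
move=> FN; apply: covalgP => n z; rewrite covcoef_sum cont_sum.
have [nN|Nn] := ltnP n N.
  rewrite (bigD1 (Ordinal nN))// big1 => [|i /andP[_ ni]].
    by rewrite covcoef_mono /= eqxx addr0.
  by rewrite covcoef_mono ifN ?cont0// eq_sym.
rewrite FN// cont0 big1// => i _; rewrite covcoef_mono ifN ?cont0//.
by rewrite gtn_eqF// (leq_trans (ltn_ord i)).
Qed.

Lemma covcoef_genX n m z : covcoef (apow U n) m z = (m == n)%:R.
Proof.
rewrite -[apow U n]amula1 -cov_fun1 cov_genX covcoef_mono.
by case: eqP => // _; rewrite cont1.
Qed.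

Lemma real_cont (r : X -> R) : continuous r -> exists h : CX, forall z, h z = (r z)%:C.
Proof.
move=> rc; have hc : continuous (fun z => (r z)%:C : K).
  move=> z B /(@nbhs_rnorm R K^o)[e e0 eB].
  have /cvgrPdist_le/(_ e e0) := rc z; apply: filterS => t tz; apply: eB.
  by rewrite -[rnorm _]/(cabs _) -rmorphB cabs_real distrC.
pose h : CX := HB.pack (fun z => (r z)%:C : K) (isContinuous.Build _ _ _ hc).
by exists h.
Qed.

(** With h = sqrt(B^2 - |g|^2) continuous, g^* g + h^* h = B^2 gives |g x|^2 + |h x|^2 = B^2 |x|^2,
    without spectral theory. *)
Lemma cov_rep_fun_le (H : hilbertType K) (pi : covalg K phi -> H -> H) (g : CX) (B : R) x :
  is_cov_rep pi -> 0 <= B -> (forall z, cabs (g z) <= B) ->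
  rnorm (pi (cov_fun phi g) x) <= B * rnorm x.
Proof.
move=> pic B0 gB; have ph := cov_rep_hom pic.
have gB2 z : 0 <= B ^+ 2 - cabs (g z) ^+ 2.
  by rewrite subr_ge0 ler_sqr ?nnegrE ?cabs_ge0.
have [h hE] : exists h : CX, forall z,
    h z = (Num.sqrt (B ^+ 2 - cabs (g z) ^+ 2))%:C.
  apply: real_cont => z; apply: continuous_comp; last exact: sqrt_continuous.
  apply: cvgB; first exact: cvg_cst.
  by rewrite expr2; apply: cvgM; exact: cabs_continuous.
have sq (f : CX) : (rnorm (pi (cov_fun phi f) x) ^+ 2)%:C =
    inner (pi (cov_fun phi (contfun_conj f * f)) x) x.
  rewrite -cov_funM (hom_mul ph) -inner_rnorm (cov_rep_star pic (contfun_conj f)).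
  congr (inner _ (pi (cov_fun phi _) _)); apply/continuousEP => z.
  by rewrite !cont_conj conjCK.
have key : contfun_conj g * g + contfun_conj h * h = (B ^+ 2)%:C *: (1 : CX).
  apply/continuousEP => z.
  rewrite contD !contM contZ cont1 !cont_conj hE conj_real mulr1 mulrC -cabs_sqr.
  by rewrite -rmorphM -expr2 sqr_sqrtr// -rmorphD addrC subrK.
have : (rnorm (pi (cov_fun phi g) x) ^+ 2 + rnorm (pi (cov_fun phi h) x) ^+ 2)%:C =
   ((B * rnorm x) ^+ 2)%:C.
  rewrite rmorphD /= !sq -innerDl -(homD ph).
  have -> : cov_fun phi (contfun_conj g * g) + cov_fun phi (contfun_conj h * h) =
      (B ^+ 2)%:C *: (aone : covalg K phi).
    have := cov_fun_lin 1 (contfun_conj g * g) (contfun_conj h * h).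
    rewrite !scale1r => <-; rewrite key.
    have := cov_fun_lin (B ^+ 2)%:C 1 0; rewrite addr0 cov_fun1 => ->.
    rewrite (_ : cov_fun phi 0 = 0) ?addr0//.
    by apply: covalgP => n z; rewrite covcoef_mono; case: eqP.
  rewrite (homZ ph) (cov_rep_one pic) innerZl inner_rnorm -rmorphM.
  by rewrite exprMn.
move=> /complexI h2.
rewrite -ler_sqr ?nnegrE ?mulr_ge0 ?rnorm_ge0// -h2 lerDl; exact: sqr_ge0.
Qed.

Lemma cov_rep_iso_pow (H : hilbertType K) (pi : covalg K phi -> H -> H) n x :
  is_cov_rep pi -> rnorm (pi (apow U n) x) = rnorm x.
Proof.
move=> pic; elim: n => [|n IH] /=; first by rewrite (cov_rep_one pic).
by rewrite (hom_mul (cov_rep_hom pic)) (cov_rep_isometry pic).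
Qed.

Lemma monom_le (A : banachAlgType K) (iota : algMorphism (covalg K phi) A)
    n (g : CX) (B : R) : is_semicrossed iota -> 0 <= B ->
  (forall z, cabs (g z) <= B) -> rnorm (iota (covmonom phi n g)) <= B.
Proof.
move=> sc B0 gB; apply: (semicrossed_le sc) => // H pi pic x.
rewrite -cov_genX (hom_mul (cov_rep_hom pic)) cov_rep_iso_pow//.
exact: cov_rep_fun_le.
Qed.

End CovariantAlgebra.

Section Basis.
Context (R : realType).
Local Notation K := (cplx R).

Let d0 : nat -> K^o := fun l => (l == 0%N)%:R.
Let d0_bound : ell2_gauge R d0 1.
Proof.
split=> // -[|N]; first by rewrite /psum big_ord0 sqr_ge0.
rewrite /psum big_ord_recl big1 ?addr0 => [|i _].
  by rewrite /d0 eqxx cabs1.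
by rewrite /d0 /= cabs0 expr0n.
Qed.
Let d0_dom : d0 \in gdom (ell2_gauge R).
Proof. by apply/mem_set; exists 1; exact: d0_bound. Qed.

Definition ell2_delta : ell2 R := GSpace d0_dom.

Lemma ell2_deltaE l : ell2_delta l = (l == 0%N)%:R.
Proof. by []. Qed.

Lemma ell2_delta_le : rnorm ell2_delta <= 1.
Proof. by apply/rnormP; exact: d0_bound. Qed.

End Basis.

(** * Minimality from simplicity of the envelope *)

Section UniversalNorm.
Context (R : realType) (B : cstarAlgType (cplx R)).
Local Notation K := (cplx R).
Implicit Types b c : B.

(* The norm of [b] in the universal *-representation is at most [r]. *)
Definition rep_le b (r : R) : Prop :=
  forall (H : hilbertType K) (rho : B -> H -> H), is_star_rep rho ->
    forall x, rnorm (rho b x) <= r * rnorm x.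

Lemma rep_le_norm b : rep_le b (rnorm b).
Proof. by move=> H rho rhos x; exact: star_rep_contractive. Qed.

Lemma rep_le_mono b r s : rep_le b r -> r <= s -> rep_le b s.
Proof.
move=> br rs H rho rhos x; rewrite (le_trans (br H rho rhos x))//.
by rewrite ler_wpM2r// rnorm_ge0.
Qed.

Lemma rep_leD b c r s : rep_le b r -> rep_le c s -> rep_le (b + c) (r + s).
Proof.
move=> br cs H rho rhos x; rewrite (homD rhos.1) (le_trans (rnormD _ _))//.
by rewrite mulrDl lerD ?br ?cs.
Qed.

Lemma rep_leZ k b r : rep_le b r -> rep_le (k *: b) (cabs k * r).
Proof.
move=> br H rho rhos x; rewrite (homZ rhos.1) rnormZ -mulrA ler_wpM2l ?cabs_ge0//.
exact: br.
Qed.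

Lemma rep_leM b c r s : 0 <= r -> rep_le b r -> rep_le c s -> rep_le (b ** c) (r * s).
Proof.
move=> r0 br cs H rho rhos x; rewrite (hom_mul rhos.1).
by rewrite (le_trans (br H rho rhos _))// -mulrA ler_wpM2l// cs.
Qed.

Lemma rep_le_star b r : rep_le b r -> rep_le (star b) r.
Proof.
move=> br H rho rhos x.
exact: adjoint_bounded (rhos.2 b) (br H rho rhos) x.
Qed.

Lemma rep_le_star_sub b c r : rep_le (b - c) r -> rep_le (star b - star c) r.
Proof. by rewrite -starB; exact: rep_le_star. Qed.

(** One-by-one matrices translate complete isometry into statements about [rep_le]. *)
Lemma cstar_mxnorm1_le b r : 0 <= r ->
  (@cstar_mxnorm R B 1 (const_mx b) <= r%:E)%E -> rep_le b r.
Proof.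
move=> r0 br H rho rhos; apply: ball_bound => [k x|]; first exact: (hom_opZ rhos.1).
have : (mx_opnorm (map_mx rho (const_mx b) : 'M[H -> H]_1) <= r%:E)%E.
  by apply: le_trans br; apply: ereal_sup_ubound; exists H, rho.
by move/mx_opnorm1_le => h x /h; rewrite !mxE.
Qed.

Lemma rep_le_cstar_mxnorm1 b r : 0 <= r -> rep_le b r ->
  (@cstar_mxnorm R B 1 (const_mx b) <= r%:E)%E.
Proof.
move=> r0 br; apply: ge_ereal_sup => _ [H [rho [rhos ->]]].
apply/mx_opnorm1_le => x x1; rewrite !mxE (le_trans (br H rho rhos x))//.
by rewrite ler_piMr.
Qed.

End UniversalNorm.

Section Minimality.
Context (R : realType) (X : topologicalType) (phi : continuousType X X).
Local Notation K := (cplx R).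
Local Notation CX := (contfun X K).
Local Notation U := (cov_gen R phi).
Hypothesis cX : compact [set: X].
Context (A : banachAlgType K) (iota : algMorphism (covalg K phi) A).
Hypothesis sc : is_semicrossed iota.
Context (E : cstarAlgType K) (j : algMorphism A E).
Hypothesis jE : is_cstar_envelope (semicrossed_mxnorm iota) j.
Implicit Types (F G : covalg K phi) (b c d : E).

Let c F : E := j (iota F).

Let cM F G : c (F ** G) = c F ** c G. Proof. by rewrite /c !alg_morphM. Qed.
Let c1 : c aone = aone. Proof. by rewrite /c !alg_morph1. Qed.
Let cB F G : c (F - G) = c F - c G. Proof. by rewrite /c !raddfB. Qed.
Let cD F G : c (F + G) = c F + c G. Proof. by rewrite /c !raddfD. Qed.
Let c0 : c 0 = 0. Proof. by rewrite /c !raddf0. Qed.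
Let cX' n : c (apow U n) = apow (c U) n.
Proof. by elim: n => [|n IH] //=; rewrite cM IH. Qed.

Lemma envelope_star f : star (c (cov_fun phi f)) = c (cov_fun phi (contfun_conj f)).
Proof.
have [D [i [icov istar _]]] := exists_cover iota.
have [q [qstar qi]] := jE.2 D i icov.
by rewrite /c -!qi -qstar istar.
Qed.

Lemma envelope_iso : star (c U) ** c U = aone.
Proof.
have [D [i [icov _ iiso]]] := exists_cover iota.
have [q [qstar qi]] := jE.2 D i icov.
by rewrite /c -!qi -qstar -alg_morphM iiso alg_morph1.
Qed.

Lemma rep_le_j (a : A) : rep_le (j a) (rnorm a).
Proof.
apply: cstar_mxnorm1_le; first exact: rnorm_ge0.
have -> : (const_mx (j a) : 'M[E]_1) = map_mx j (const_mx a).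
  by apply/matrixP => k l; rewrite !mxE.
rewrite jE.1.1; apply: ge_ereal_sup => _ [H [pi [[ph _ pile] ->]]].
apply/mx_opnorm1_le => x x1; rewrite !mxE (le_trans (pile a x))//.
by rewrite ler_piMr// rnorm_ge0.
Qed.

(** Counterpart of [rep_le_j]: bounds return from the envelope to every representation of A,
    including those that do not factor through [j]. *)
Lemma j_rep_le (a : A) (r : R) (H : hilbertType K) (pi : A -> H -> H) x :
  0 <= r -> rep_le (j a) r -> is_semicrossed_rep iota pi ->
  rnorm (pi a x) <= r * rnorm x.
Proof.
move=> r0 jar pis; have [ph _ _] := pis.
have := rep_le_cstar_mxnorm1 r0 jar.
have -> : (const_mx (j a) : 'M[E]_1) = map_mx j (const_mx a).
  by apply/matrixP => k l; rewrite !mxE.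
rewrite jE.1.1 => ar; move: x; apply: ball_bound => [k x|]; first exact: hom_opZ.
have : (mx_opnorm (map_mx pi (const_mx a) : 'M[H -> H]_1) <= r%:E)%E.
  by apply: le_trans ar; apply: ereal_sup_ubound; exists H, pi.
by move/mx_opnorm1_le => h x /h; rewrite !mxE.
Qed.

(** The orbit representation is applied on A only; complete isometry carries the resulting bound to
    the envelope. *)
Lemma j_covcoef_le F (r : R) n x : 0 <= r -> rep_le (c F) r ->
  cabs (covcoef F n x) <= r.
Proof.
move=> r0 cr.
have [rho [rhos rhoE]] := extend_cov_rep sc (orbit_rep_cov R phi cX x).
rewrite -(@orbit_rep_e0 R X phi cX x F n (ell2_delta R))//.
rewrite (le_trans (ell2_coord _ _))// -rhoE.
by rewrite (le_trans (j_rep_le _ r0 cr rhos))// ler_piMr// ell2_delta_le.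
Qed.

Let rep_u : rep_le (c U) 1.
Proof.
apply: rep_le_mono (rep_le_j _) _.
by apply: monom_le => // z; rewrite cont1 cabs1.
Qed.

Section Ideal.
Context (x : X).

Let ker F : Prop := forall n l, covcoef F n (iter l phi x) = 0.

Let kerMr F G : ker F -> ker (F ** G).
Proof.
by move=> kF n l; rewrite covcoefM big1// => i _; rewrite -iterD kF mul0r.
Qed.
Let kerMl F G : ker F -> ker (G ** F).
Proof. by move=> kF n l; rewrite covcoefM big1// => i _; rewrite kF mulr0. Qed.
Let kerD F G : ker F -> ker G -> ker (F + G).
Proof. by move=> kF kG n l; rewrite covcoefD contD kF kG addr0. Qed.

(* The kernel of the orbit representation at [x], carried over to the envelope,
   where that representation itself need not extend. *)
Definition orbit_ideal : set E := [set b | forall e : R, 0 < e ->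
  exists (L : nat) (F : covalg K phi), ker F /\ rep_le (b ** apow (c U) L - c F) e].

(** The exponent can be raised at no cost, which gives two elements a common exponent before they
    are added. *)
Let shift b L F (e : R) : ker F -> rep_le (b ** apow (c U) L - c F) e -> 0 <= e ->
  forall n, exists G, ker G /\ rep_le (b ** apow (c U) (L + n) - c G) e.
Proof.
move=> kF be e0; elim=> [|n [G [kG bG]]]; first by rewrite addn0; exists F.
exists (G ** U); split; first exact: kerMr.
rewrite addnS apowSr amulA cM -amulBl -(mulr1 e).
exact: rep_leM.
Qed.

Let I0 : orbit_ideal 0.
Proof.
move=> e e0; exists 0%N, 0; split=> [n l|]; first by rewrite covcoef0 cont0.
rewrite amul0l c0 subr0 => H rho rhos y; rewrite (hom0 rhos.1) rnorm0.
by rewrite mulr_ge0 ?rnorm_ge0// ltW.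
Qed.

Let ID b d : orbit_ideal b -> orbit_ideal d -> orbit_ideal (b + d).
Proof.
move=> bI dI e e0; have he := ltW (half_gt0 e0).
have [L [F [kF bF]]] := bI _ (half_gt0 e0).
have [M [G [kG dG]]] := dI _ (half_gt0 e0).
have [F' [kF' bF']] := shift kF bF he M.
have [G' [kG' dG']] := shift kG dG he L.
exists (L + M)%N, (F' + G'); split; first exact: kerD.
rewrite amulDl cD opprD addrACA [e]splitr; apply: rep_leD => //.
by rewrite addnC.
Qed.

(** Closedness is needed for the universal norm: approximation of [a] by polynomials in A reaches
    [j a] through [rep_le_j], not through the norm of [E]. *)
Let Iadh b : (forall e : R, 0 < e -> exists2 d, orbit_ideal d & rep_le (d - b) e) ->
  orbit_ideal b.
Proof.
move=> h e e0; have [d dI db] := h _ (half_gt0 e0).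
have [L [F [kF dF]]] := dI _ (half_gt0 e0).
exists L, F; split=> //.
have -> : b ** apow (c U) L - c F =
   (-1 : K) *: ((d - b) ** apow (c U) L) + (d ** apow (c U) L - c F).
  by rewrite scaleN1r amulBl opprB addrA subrK.
rewrite [e]splitr; apply: rep_leD => //.
have := rep_leZ (-1) (rep_leM (ltW (half_gt0 e0)) db (_ : rep_le _ 1)).
rewrite cabsN cabs1 mul1r mulr1; apply; elim: (L) => [|n IH] /=.
  move=> H rho rhos y; rewrite mul1r; exact: star_rep_unit_le.
by rewrite -(mulr1 1); apply: rep_leM.
Qed.

(** The ideal property is proved by generation: the multipliers form an algebra closed in the
    universal norm and contain U, U^* and the functions. *)
Definition multiplier d : Prop :=
  forall b, orbit_ideal b -> orbit_ideal (d ** b) /\ orbit_ideal (b ** d).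

Let mult_u : multiplier (c U).
Proof.
move=> b bI; split=> e e0; have [L [F [kF bF]]] := bI _ e0.
  exists L, (U ** F); split; first exact: kerMl.
  by rewrite cM -amulA -amulBr -(mul1r e); apply: rep_leM.
have [G [kG bG]] := shift kF bF (ltW e0) 1%N.
by exists L, G; split=> //; rewrite -amulA -[c U ** _]/(apow (c U) L.+1) -addn1.
Qed.

(** The coefficients of [G] are those of [F] composed with [phi]; they vanish on the orbit because
    [phi] maps the forward orbit into itself. *)
Let tw F : exists G, F ** U = U ** G /\ (ker F -> ker G).
Proof.
have [N FN] := covcoef_fin F.
have gP : (fun n => @precomp X K phi (covcoef F n)) \in @finsuppseq X K.
  apply/mem_set; exists N => n Nn; rewrite FN//; exact/continuousEP.
exists (CovPoly gP); split=> [|kF n l]; last exact: (kF n l.+1).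
by apply: covalgP => -[|n] z;
  rewrite ?covcoef_genM0 ?covcoef_Mgen0// covcoef_genM covcoef_Mgen.
Qed.

(** On the left, the additional U on the right is moved through [F] by [tw] and cancelled by U^*. On
    the right, U^* U^(L+1) = U^L. Both uses raise the exponent by one. *)
Let mult_us : multiplier (star (c U)).
Proof.
move=> b bI; split=> e e0; have [L [F [kF bF]]] := bI _ e0.
  have [G [FG kG]] := tw F.
  exists L.+1, G; split; first exact: kG.
  have -> : star (c U) ** b ** apow (c U) L.+1 - c G =
      star (c U) ** (b ** apow (c U) L - c F) ** c U.
    rewrite apowSr amulBr amulBl !amulA -[star (c U) ** c F ** c U]amulA -cM FG cM.
    by rewrite amulA envelope_iso amul1a.
  rewrite -(mulr1 e) -(mul1r e); apply: rep_leM => //; first by rewrite mul1r ltW.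
  by apply: rep_leM => //; exact: rep_le_star.
exists L.+1, F; split=> //.
by rewrite /= -amulA [star _ ** _]amulA envelope_iso amul1a.
Qed.

Let mult_fun (g : CX) : multiplier (c (cov_fun phi g)).
Proof.
have [B0 B00 gB0] := cts_bounded g cX.
pose B := B0 + 1; have B1 : 0 < B by rewrite /B; lra.
have gB z : cabs (g z) <= B by rewrite (le_trans (gB0 z))// lerDl.
have gle (h : CX) : (forall z, cabs (h z) <= B) -> rep_le (c (cov_fun phi h)) B.
  move=> hB; apply: rep_le_mono (rep_le_j _) _.
  by apply: monom_le => //; exact: ltW.
move=> b bI; split=> e e0; have [L [F [kF bF]]] := bI _ (divr_gt0 e0 B1).
  exists L, (cov_fun phi g ** F); split; first exact: kerMl.
  rewrite cM -amulA -amulBr.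
  apply: rep_le_mono (rep_leM (ltW B1) (gle g gB) bF) _.
  by rewrite mulrC divfK// gt_eqF.
(* Right multiplication by [g] must cross U^L before it reaches the approximating polynomial, and
   becomes [g] composed with the [L]-th iterate of [phi]. *)
have twL n : cov_fun phi g ** apow U n =
    apow U n ** cov_fun phi (iter n (@precomp X K phi) g).
  rewrite cov_genX; apply: covalgP => m z.
  rewrite covcoef_funM covcoef_genX covcoef_mono.
  case: eqP => [->|_]; first by rewrite precomp_iter mulr1.
  by rewrite mulr0 cont0.
exists L, (F ** cov_fun phi (iter L (@precomp X K phi) g)); split; first exact: kerMr.
rewrite -amulA -cX' -cM twL cM cX' amulA cM -amulBl.
apply: rep_le_mono (rep_leM _ bF (gle _ _)) _.
- by rewrite divr_ge0 ?ltW.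
- by move=> z; rewrite precomp_iter.
- by rewrite divfK// gt_eqF.
Qed.

(** Stability of multipliers under [star] is not evident, so it is built in; this gives a
    *-subalgebra to which [generates] applies. *)
Let bimult : set E := [set d | multiplier d /\ multiplier (star d)].

(** A scalar acts as a constant function, so this is an instance of [mult_fun]. *)
Let IZ k b : orbit_ideal b -> orbit_ideal (k *: b).
Proof.
move=> bI; have [h _] := mult_fun (k *: (1 : CX)) bI; move: h.
have -> : c (cov_fun phi (k *: (1 : CX))) = k *: aone.
  rewrite -[k *: (1 : CX)]addr0 cov_fun_lin (_ : cov_fun phi 0 = 0) ?addr0.
    by rewrite /c !linearZ /= cov_fun1 !alg_morph1.
  by apply: covalgP => n z; rewrite covcoef_mono; case: eqP.
by rewrite amulZl amul1a.
Qed.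

Let mult_lin k d d' : multiplier d -> multiplier d' -> multiplier (k *: d + d').
Proof.
move=> md md' b bI; have [l r] := md b bI; have [l' r'] := md' b bI.
split; first by rewrite amulDl amulZl; apply: ID => //; exact: IZ.
by rewrite amulDr amulZr; apply: ID => //; exact: IZ.
Qed.

Let mult_mul d d' : multiplier d -> multiplier d' -> multiplier (d ** d').
Proof.
move=> md md' b bI; split.
  by rewrite -amulA; have [h _] := md' b bI; have [] := md _ h.
by rewrite amulA; have [_ h] := md b bI; have [] := md' _ h.
Qed.

Let mult_adh d : (forall e : R, 0 < e -> exists2 d', multiplier d' & rep_le (d' - d) e) ->
  multiplier d.
Proof.
move=> h b bI.
have nb : 0 < rnorm b + 1 by have := rnorm_ge0 b; lra.
have lb : rep_le b (rnorm b + 1).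
  by apply: rep_le_mono (rep_le_norm b) _; rewrite lerDl.
split; apply: Iadh => e e0; have [d' md' dd'] := h _ (divr_gt0 e0 nb).
  exists (d' ** b); first by have [] := md' b bI.
  rewrite -amulBl; apply: rep_le_mono (rep_leM _ dd' lb) _.
    by rewrite divr_ge0 ?ltW.
  by rewrite divfK// gt_eqF.
exists (b ** d'); first by have [] := md' b bI.
rewrite -amulBr; apply: rep_le_mono (rep_leM (ltW nb) lb dd') _.
by rewrite mulrC divfK// gt_eqF.
Qed.

Let bimult_all : bimult = setT.
Proof.
have bilin k d d' : bimult d -> bimult d' -> bimult (k *: d + d').
  move=> [m ms] [m' ms']; split; first exact: mult_lin.
  by rewrite starD starZ; exact: mult_lin.
have bimul d d' : bimult d -> bimult d' -> bimult (d ** d').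
  move=> [m ms] [m' ms']; split; first exact: mult_mul.
  by rewrite starM; exact: mult_mul.
have biadh d : (forall e : R, 0 < e -> exists2 d', bimult d' & rep_le (d' - d) e) ->
    bimult d.
  move=> h; split; apply: mult_adh => e /h[d' [m ms] dd'].
    by exists d'.
  by exists (star d') => //; exact: rep_le_star_sub.
have bifun g : bimult (c (cov_fun phi g)).
  by split; rewrite ?envelope_star; exact: mult_fun.
have bimono n g : bimult (c (covmonom phi n g)).
  rewrite -cov_genX cM cX'; apply: (bimul); last exact: bifun.
  elim: n => [|n IH] /=.
    by rewrite -c1 -cov_fun1; exact: bifun.
  by apply: (bimul) => //; split.
have bi0 : bimult 0.
  rewrite -c0 (_ : 0 = cov_fun phi 0) //; apply: covalgP => n z.
  by rewrite covcoef_mono; case: eqP.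
have bic F : bimult (c F).
  have [N FN] := covcoef_fin F; rewrite (cov_decomp FN).
  elim: N {FN} => [|N IH]; first by rewrite big_ord0 c0.
  rewrite big_ord_recr /= cD addrC -[c (covmonom _ _ _)]scale1r.
  exact: (bilin).
apply: (jE.1.2).
- by split=> // d [m ms]; split=> //; rewrite starK.
- apply/closedP => d dad; apply: biadh => e /dad[d' bd' dd'].
  by exists d' => //; apply: rep_le_mono (rep_le_norm _) _.
- move=> _ [a _ <-]; apply: biadh => e e0.
  have [_ [F _ <-] Fa] := dense_adh a sc.2 e0.
  exists (c F) => //; rewrite /c -raddfB.
  exact: rep_le_mono (rep_le_j _) Fa.
Qed.

Lemma orbit_ideal_total (f : CX) : is_simple E -> (exists z, f z <> 0) ->
  exists k, f (iter k phi x) <> 0.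
Proof.
move=> simpleE [z fz]; apply: contrapT => /forallNP fx.
have {}fx k : f (iter k phi x) = 0 by apply: contrapT => /(fx k).
have mult d : multiplier d.
  by have [] : bimult d by rewrite bimult_all.
have fI : orbit_ideal (c (cov_fun phi f)).
  move=> e e0; exists 0%N, (cov_fun phi f); split.
    by move=> n l; rewrite covcoef_mono; case: eqP.
  rewrite /= amula1 subrr => H rho rhos y; rewrite (hom0 rhos.1) rnorm0.
  by rewrite mulr_ge0 ?rnorm_ge0// ltW.
have [|||I0E|IT] := simpleE orbit_ideal.
- by split=> // b d bI; have [] := mult b d bI.
- by split=> // b d bI; have [] := mult d b bI.
- apply/closedP => b bad; apply: Iadh => e /bad[d dI db].
  by exists d => //; exact: rep_le_mono (rep_le_norm _) db.
(* If the ideal is zero, the coefficient bound with [r = 0] forces [f z = 0]. *)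
- have f0 : c (cov_fun phi f) = 0 by have : [set 0] (c (cov_fun phi f)) by rewrite -I0E.
  have := @j_covcoef_le (cov_fun phi f) 0 0%N z (lexx 0).
  rewrite f0 covcoef_mono /= => h; apply: fz; apply/cabs_eq0/le_anti.
  rewrite cabs_ge0 andbT; apply: h => H rho rhos y.
  by rewrite (hom0 rhos.1) rnorm0 mul0r.
(* If it contained 1, U^L - F would have norm at most 1/2 for some F in the kernel, although its
   coefficient of degree [L] at [x] is 1. *)
- have : orbit_ideal aone by rewrite IT.
  have h2 : 0 < 2^-1 :> R by rewrite invr_gt0.
  move=> /(_ _ h2)[L [F [kF]]].
  rewrite amul1a -cX' -cB => /(j_covcoef_le L x (ltW h2)).
  rewrite covcoefD covcoefN contD contN covcoef_genX eqxx (kF L 0%N) subr0 cabs1.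
  by rewrite leNgt invf_lt1// ltr1n.
Qed.

End Ideal.

Lemma uniform_return (f : CX) : is_simple E -> (exists z, f z <> 0) ->
  exists (N : nat) (e : R), 0 < e /\
    forall x, e <= \sum_(k < N) cabs (f (iter k phi x)) ^+ 2.
Proof.
move=> simpleE fz.
pose G N : CX := \sum_(k < N) iter k (@precomp X K phi) (f * contfun_conj f).
have GE N x : cabs (G N x) = \sum_(k < N) cabs (f (iter k phi x)) ^+ 2.
  rewrite /G cont_sum (eq_bigr (fun k : 'I_N => (cabs (f (iter k phi x)) ^+ 2)%:C)).
    by rewrite -rmorph_sum /= cabs_real ger0_norm// sumr_ge0// => i _; exact: sqr_ge0.
  by move=> k _; rewrite precomp_iter contM cont_conj cabs_sqr.
(* One index governs both the number of terms and the threshold, so these open sets increase and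
   compactness yields a single [N]. *)
pose V N := [set x | N.+1%:R^-1 < cabs (G N x)].
have Vopen N : open (V N).
  have := @open_comp _ _ (fun x => cabs (G N x) : R) [set t | N.+1%:R^-1 < t].
  by apply; [move=> x _; exact: cabs_continuous|exact: open_gt].
have Vmono N M : (N <= M)%N -> V N `<=` V M.
  move=> NM x; rewrite /V /= => h.
  apply: (@le_lt_trans _ _ N.+1%:R^-1); first by rewrite lef_pV2 ?posrE// ler_nat ltnS.
  rewrite (lt_le_trans h)// !GE -(subnKC NM) big_split_ord /= lerDl.
  by apply: sumr_ge0 => i _; exact: sqr_ge0.
have Vcov x : exists N, V N x.
  have [k fk] := orbit_ideal_total x simpleE fz.
  have f0 : 0 < cabs (f (iter k phi x)) ^+ 2.
    rewrite exprn_gt0// lt_neqAle cabs_ge0 andbT eq_sym.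
    by apply/eqP => /cabs_eq0.
  set t := _ ^+ 2 in f0.
  pose N := maxn k.+1 (Num.truncn t^-1); exists N.
  rewrite /V /= GE; apply: (@lt_le_trans _ _ t).
    rewrite invf_plt ?posrE//; apply: (lt_le_trans (truncnS_gt _)).
    by rewrite ler_nat ltnS leq_maxr.
  have kN : (k < N)%N by rewrite leq_maxl.
  rewrite (bigD1 (Ordinal kN))//= lerDl; apply: sumr_ge0 => i _; exact: sqr_ge0.
have /compact_near_coveringP cov := cX.
have [|N _ NP] := cov nat \oo V _.
  move=> x _; have [N VN] := Vcov x.
  exists (V N, [set n | (N <= n)%N]); first split.
  - by apply: open_nbhs_nbhs; split => //; exact: Vopen.
  - by exists N.
  - by move=> [z n] /= [Vz Nn]; exact: (Vmono N n).
exists N, N.+1%:R^-1; split=> [|x]; first by rewrite invr_gt0.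
by rewrite -GE ltW//; exact: (NP N (leqnn N) x I).
Qed.

End Minimality.

(** * The Jacobson radical and the gauge action *)

Section Jacobson.
Context (R : realType) (A : banachAlgType (cplx R)).
Local Notation K := (cplx R).
Local Notation J := (@jacobson_radical R A).
Implicit Types a b c : A.

Lemma left_ideal_one (I : set A) : is_left_ideal I -> I aone -> I = setT.
Proof.
move=> [_ _ IM] I1; apply/seteqP; split=> // a _.
by rewrite -[a]amula1; exact: IM.
Qed.

Lemma maximal_left_ideal_exists (L : set A) : is_left_ideal L -> ~ L aone ->
  exists2 I, is_maximal_left_ideal I & L `<=` I.
Proof.
move=> Lid L1.
pose P (I : set A) := I = set0 \/ [/\ is_left_ideal I, ~ I aone & L `<=` I].
have [F FP Ftot|I [[I0|[Iid I1 LI]] Imax]] := @Zorn_bigcup A P.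
- have [F0|] := pselect (forall I, F I -> I = set0).
    by left; apply/seteqP; split=> // a [I /F0 ->].
  move=> /existsNP[I0 /not_implyP[FI0 I0n]]; right.
  have get I a : F I -> I a -> [/\ is_left_ideal I, ~ I aone & L `<=` I].
    by move=> /FP[-> []|].
  have [I0id _ LI0] : [/\ is_left_ideal I0, ~ I0 aone & L `<=` I0].
    by have [/I0n|] := FP _ FI0.
  split; first split.
  + by exists I0 => //; case: I0id.
  + move=> a b [I FI Ia] [I' FI' I'b].
    have [Iid _ _] := get _ _ FI Ia; have [I'id _ _] := get _ _ FI' I'b.
    case: (Ftot _ _ FI FI') => sub.
      by exists I' => //; case: I'id => _ h _; apply: h => //; exact: sub.
    by exists I => //; case: Iid => _ h _; apply: h => //; exact: sub.
  + move=> a b [I FI Ib]; exists I => //.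
    by have [[_ _ h] _ _] := get _ _ FI Ib; exact: h.
  + by move=> [I FI I1]; have [] := get _ _ FI I1.
  + by move=> a La; exists I0 => //; exact: LI0.
- exfalso; apply: (Imax L); last by right; split.
  rewrite I0; split=> // h; have [L0 _ _] := Lid.
  by have := h _ L0.
- exists I => //; split=> // [IT|I' I'id II']; first by apply: I1; rewrite IT.
  have [I'1|I'1] := pselect (I' aone); first by right; exact: left_ideal_one.
  left; apply/seteqP; split=> //; apply: contrapT => n.
  apply: (Imax I'); first by split.
  by right; split=> //; exact: subset_trans II'.
Qed.

(** Otherwise the left ideal generated by 1 - b a lies in a maximal one, which also contains b a and
    therefore 1. *)
Lemma jacobson_left_inverse a b : J a -> exists c, c ** (aone - b ** a) = aone.
Proof.
move=> Ja; apply: contrapT => /forallNP nc.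
pose L : set A := [set x | exists c, x = c ** (aone - b ** a)].
have Lid : is_left_ideal L.
  split; first by exists 0; rewrite amul0l.
    by move=> _ _ [c ->] [d ->]; exists (c + d); rewrite amulDl.
  by move=> d _ [c ->]; exists (d ** c); rewrite amulA.
have [|I [Iid InT Imax] LI] := maximal_left_ideal_exists Lid.
  by move=> [c /esym]; exact: nc.
apply: (InT); apply: left_ideal_one => //.
have [_ ID IM] := Iid.
rewrite -(subrK (b ** a) aone); apply: ID; last exact: IM (Ja I (And3 Iid InT Imax)).
by apply: LI; exists aone; rewrite amul1a.
Qed.

(** If a maximal [I] missed [a], then 1 = m + b a with m in [I], and m = 1 - b a would be left
    invertible. *)
Lemma left_inverse_jacobson a :
  (forall b, exists c, c ** (aone - b ** a) = aone) -> J a.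
Proof.
move=> h I [Iid InT Imax]; apply: contrapT => nIa.
pose L : set A := [set x | exists m b, I m /\ x = m + b ** a].
have [I0 ID IM] := Iid.
have Lid : is_left_ideal L.
  split; first by exists 0, 0; rewrite amul0l addr0.
    move=> _ _ [m [b [Im ->]]] [m' [b' [Im' ->]]].
    exists (m + m'), (b + b'); rewrite amulDl addrACA; split=> //; exact: ID.
  move=> c _ [m [b [Im ->]]]; exists (c ** m), (c ** b).
  by rewrite amulDr amulA; split=> //; exact: IM.
have [|LI|LT] := Imax L Lid.
- by move=> m Im; exists m, 0; rewrite amul0l addr0.
- by apply: nIa; rewrite -LI; exists 0, aone; rewrite amul1a add0r.
- have : L aone by rewrite LT.
  move=> [m [b [Im e]]]; have [c ce] := h b.
  apply: (InT); apply: left_ideal_one => //; rewrite -ce e addrK; exact: IM.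
Qed.

(** The left inverse satisfies c = 1 + c b a, so it has a left inverse too; being invertible on both
    sides, it is a two-sided inverse of 1 - b a. *)
Lemma jacobson_inverse a b : J a ->
  exists c, c ** (aone - b ** a) = aone /\ (aone - b ** a) ** c = aone.
Proof.
move=> Ja; have [c ce] := jacobson_left_inverse b Ja; exists c; split=> //.
have [d de] := jacobson_left_inverse (- (c ** b)) Ja.
have cE : aone - (- (c ** b)) ** a = c.
  by rewrite amulNl opprK -amulA -{1}ce amulBr amula1 subrK.
have dE : d = aone - b ** a.
  by rewrite -[RHS]amul1a -{1}de cE -amulA ce amula1.
by rewrite -dE -[RHS]de cE.
Qed.

Lemma jacobsonD a b : J a -> J b -> J (a + b).
Proof. by move=> Ja Jb I Imax; case: (Imax) => -[_ ID _] _ _; apply: ID; [exact: Ja|exact: Jb]. Qed.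

Lemma jacobson0 : J 0.
Proof. by move=> I [[I0 _ _] _ _]. Qed.

Lemma jacobson_mull a b : J a -> J (b ** a).
Proof. by move=> Ja I Imax; case: (Imax) => -[_ _ IM] _ _; apply: IM; exact: Ja. Qed.

Lemma jacobsonZ k a : J a -> J (k *: a).
Proof. by move=> Ja; rewrite -[a]amul1a -amulZl; exact: jacobson_mull. Qed.

Lemma jacobson_sum (I : Type) (r : seq I) (P : pred I) (F : I -> A) :
  (forall i, P i -> J (F i)) -> J (\sum_(i <- r | P i) F i).
Proof. by move=> h; apply: big_ind => //; [exact: jacobson0|exact: jacobsonD]. Qed.

Lemma jacobson_mulr a c : J a -> J (a ** c).
Proof.
move=> Ja; apply: left_inverse_jacobson => b.
have [u ue] := jacobson_left_inverse (c ** b) Ja.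
(* The classical passage from an inverse u of 1 - (c b) a to one of 1 - (b a) c, found by expanding
   geometric series. *)
exists (aone + b ** a ** u ** c).
rewrite amulDl amul1a amulBr amula1.
have -> : b ** a ** u ** c - b ** a ** u ** c ** (b ** (a ** c)) =
    b ** a ** (u ** (aone - c ** b ** a)) ** c.
  by rewrite amulBr amula1 amulBr amulBl !amulA.
by rewrite ue amula1 amulA subrK.
Qed.

(** Maximal left ideals are closed: the closure is again a left ideal, and a proper one because
    elements near 1 are invertible. *)
Lemma jacobson_adh a : adh J a -> J a.
Proof.
move=> Ja I Imax; have [Iid InT max] := Imax; have [I0 ID IM] := Iid.
have Ia : adh I a by move=> e /Ja[b Jb ba]; exists b => //; exact: Jb.
have sub : I `<=` adh I.
  by move=> b Ib e e0; exists b => //; rewrite subrr rnorm0 ltW.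
have aid : is_left_ideal (adh I).
  split; first exact: sub.
    move=> b c bI cI e e0.
    have [b' Ib' bb'] := bI _ (half_gt0 e0); have [c' Ic' cc'] := cI _ (half_gt0 e0).
    exists (b' + c'); first exact: ID.
    by rewrite opprD addrACA (le_trans (rnormD _ _))// [leRHS]splitr lerD.
  move=> c b bI e e0.
  have D0 : 0 < rnorm c + 1 by have := rnorm_ge0 c; lra.
  have [b' Ib' bb'] := bI _ (divr_gt0 e0 D0); exists (c ** b'); first exact: IM.
  rewrite -amulBr (le_trans (rnormM _ _))//.
  move: bb'; rewrite ler_pdivlMr//; have := rnorm_ge0 (b' - b); nra.
have [aI|aT] := max _ aid sub; first by rewrite -aI.
exfalso; apply: (InT); apply: left_ideal_one => //.
have : adh I aone by rewrite aT.
have h2 : 0 < 2^-1 :> R by rewrite invr_gt0.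
move=> /(_ _ h2)[m Im m1].
have [|c [ce _]] := @neumann _ A (aone - m).
  by rewrite rnormC (le_lt_trans m1)// invf_lt1// ltr1n.
by rewrite -ce opprB addrC subrK; exact: IM.
Qed.

End Jacobson.

Section Rotation.
Context (R : realType).
Local Notation K := (cplx R).

(** A point of the unit circle of infinite order; the triple 3, 4, 5 gives it rational coordinates,
    so an argument on integers proves the infinite order. *)
Definition rot : K := Complex (3 / 5) (4 / 5).

Lemma cabs_rot : cabs rot = 1.
Proof.
have e : (3 / 5) ^+ 2 + (4 / 5) ^+ 2 = 1 :> R by field.
by rewrite cabsE /rot /= e sqrtr1.
Qed.

(* Modulo 5, every power of [3 + 4 i] is [3 + 4 i]. *)
Lemma rot_power n : rot ^+ n.+1 != 1.
Proof.
have h : exists p q : int, (5 : K) ^+ n.+1 * rot ^+ n.+1 =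
    Complex ((5 * p + 3)%:~R) ((5 * q + 4)%:~R).
  rewrite -exprMn (_ : 5 * rot = Complex 3 4); last first.
    by apply/eqP; rewrite eq_complex /=; apply/andP; split; apply/eqP; field.
  elim: n => [|n [p [q IH]]]; first by exists 0, 0.
  exists (3 * p - 4 * q - 2), (4 * p + 3 * q + 4); rewrite exprS IH.
  apply/eqP; rewrite eq_complex /=.
  by apply/andP; split; apply/eqP; rewrite !(rmorphD, rmorphB, rmorphM) /=; ring.
apply/eqP => r1; have [p [q]] := h; rewrite r1 mulr1.
have -> : (5 : K) ^+ n.+1 = (5 ^+ n.+1 : R)%:C by rewrite rmorphXn /= rmorph_nat.
move=> /(congr1 (@complex.Im R)) /= /esym/eqP; rewrite intr_eq0 => /eqP; lia.
Qed.

End Rotation.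

Section Gauge.
Context (R : realType) (X : topologicalType) (phi : continuousType X X).
Local Notation K := (cplx R).
Local Notation CX := (contfun X K).
Local Notation U := (cov_gen R phi).
Context (A : banachAlgType K) (iota : algMorphism (covalg K phi) A).
Hypothesis sc : is_semicrossed iota.
Implicit Types (F G : covalg K phi) (a b : A).

Let gauge_dom (k : K) F : (fun n => k ^+ n *: covcoef F n) \in @finsuppseq X K.
Proof.
apply/mem_set; have [N FN] := covcoef_fin F.
by exists N => n Nn; rewrite FN// scaler0.
Qed.

Definition cov_gauge (k : K) F : covalg K phi := CovPoly (gauge_dom k F).

Lemma cov_gaugeE k F n z : covcoef (cov_gauge k F) n z = k ^+ n * covcoef F n z.
Proof. by []. Qed.

Lemma cov_gauge_lin k : linear (cov_gauge k).
Proof.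
move=> l F G; apply: covalgP => n z.
rewrite covcoefD covcoefZ contD contZ !cov_gaugeE covcoefD covcoefZ contD contZ.
by rewrite mulrDr mulrCA.
Qed.

Lemma cov_gaugeM k F G : cov_gauge k (F ** G) = cov_gauge k F ** cov_gauge k G.
Proof.
apply: covalgP => n z; rewrite cov_gaugeE !covcoefM mulr_sumr.
apply: eq_bigr => i _; rewrite !cov_gaugeE mulrACA -exprD subnKC//.
by rewrite -ltnS.
Qed.

Lemma cov_gauge_mono k n (f : CX) :
  cov_gauge k (covmonom phi n f) = k ^+ n *: covmonom phi n f.
Proof.
apply: covalgP => m z; rewrite cov_gaugeE covcoefZ contZ covcoef_mono.
by case: eqP => [->//|_]; rewrite cont0 !mulr0.
Qed.

Lemma cov_gaugeK k F : k != 0 -> cov_gauge k (cov_gauge k^-1 F) = F.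
Proof.
move=> k0; apply: covalgP => n z.
by rewrite !cov_gaugeE mulrA -exprMn mulfV// expr1n mul1r.
Qed.

Lemma cov_gauge1 k : cov_gauge k aone = aone.
Proof. by have := cov_gauge_mono k 0 1; rewrite expr0 scale1r. Qed.

Lemma cov_gauge_rep k (H : hilbertType K) (pi : covalg K phi -> H -> H) :
  cabs k = 1 -> is_cov_rep pi -> is_cov_rep (pi \o cov_gauge k).
Proof.
move=> k1 pic; have ph := cov_rep_hom pic; split.
- split=> [F|F|l F G x|F G x] /=.
  + exact: hom_op_linear.
  + exact: hom_op_bounded.
  + by rewrite cov_gauge_lin (hom_linear ph).
  + by rewrite cov_gaugeM (hom_mul ph).
- by move=> f x y /=; rewrite !cov_gauge_mono !expr0 !scale1r; exact: cov_rep_star.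
- move=> x /=; rewrite cov_gauge_mono expr1 (homZ ph) rnormZ k1 mul1r.
  exact: cov_rep_isometry.
Qed.

Lemma cov_gauge_le k F : cabs k = 1 -> rnorm (iota (cov_gauge k F)) <= rnorm (iota F).
Proof.
move=> k1; apply: (semicrossed_le sc); last exact: rnorm_ge0.
move=> H pi pic x; exact: (cov_rep_le sc F x (cov_gauge_rep k1 pic)).
Qed.

Record gauge_action (k : K) (S : A -> A) : Prop := GaugeAction {
  ga_iota : forall F, S (iota F) = iota (cov_gauge k F);
  ga_lin : linear S;
  ga_mul : forall a b, S (a ** b) = S a ** S b;
  ga_le : forall a, rnorm (S a) <= rnorm a
}.

Lemma gauge_action_exists k : cabs k = 1 -> exists S, gauge_action k S.
Proof.
move=> k1.
pose T : {linear covalg K phi -> A} := HB.pack (iota \o cov_gauge k)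
  (GRing.isLinear.Build _ _ _ _ (iota \o cov_gauge k) (fun l F G =>
     etrans (congr1 iota (cov_gauge_lin k l F G)) (linearP iota l _ _))).
have [|S [Si Sc Sle]] := @extend_bounded _ _ _ _ iota T 1 ler01 sc.2.
  by move=> F; rewrite mul1r; exact: cov_gauge_le.
have Slin : linear S.
  move=> l a b; have [u ua] := dense_seq sc a; have [v vb] := dense_seq sc b.
  apply: (cvs_unique (Sc (fun n => l *: u n + v n) _ _)).
    by apply: cvs_ext (cvsD (cvsZ l ua) vb) => n /=; rewrite linearP.
  apply: cvs_ext (cvsD (cvsZ l (Sc _ _ ua)) (Sc _ _ vb)) => n.
  by rewrite /= cov_gauge_lin linearP.
have SB a b : S (a - b) = S a - S b.
  by rewrite addrC -scaleN1r Slin scaleN1r addrC.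
have SMi a G : S (a ** iota G) = S a ** S (iota G).
  have [u ua] := dense_seq sc a.
  apply: (cvs_unique (Sc (fun n => u n ** G) _ _)).
    by apply: cvs_ext (cvsMl (iota G) ua) => n /=; rewrite alg_morphM.
  apply: cvs_ext (cvsMl (S (iota G)) (Sc _ _ ua)) => n /=.
  by rewrite Si /= cov_gaugeM alg_morphM.
exists S; split=> // [a b|a]; last by have := Sle a; rewrite mul1r.
have [v vb] := dense_seq sc b.
have Sct := @cvs_bounded _ _ _ S 1 _ _ ler01 _.
have SL x y : rnorm (S x - S y) <= 1 * rnorm (x - y) by rewrite -SB.
apply: (cvs_unique (Sct _ _ SL (cvsMr a vb))).
by apply: cvs_ext (cvsMr (S a) (Sct _ _ SL vb)) => n /=; rewrite SMi.
Qed.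

(** The action [T] of [k^-1] is a right inverse of [S], so every b is S (T b), and [S] carries a
    left inverse of 1 - (T b) a to one of 1 - b (S a). *)
Lemma gauge_action_jacobson k S a : cabs k = 1 -> gauge_action k S ->
  jacobson_radical a -> jacobson_radical (S a).
Proof.
move=> k1 [Si Sl SM Sle] Ja; apply: left_inverse_jacobson => b.
have k0 : k != 0 by apply/eqP => k0; move: k1; rewrite k0 cabs0; lra.
have kV : cabs k^-1 = 1 by rewrite cabsV k1 invr1.
have [T [Ti Tl TM Tle]] := gauge_action_exists kV.
have SB x y : S (x - y) = S x - S y.
  by rewrite addrC -scaleN1r Sl scaleN1r addrC.
have TB x y : T (x - y) = T x - T y.
  by rewrite addrC -scaleN1r Tl scaleN1r addrC.
have ST x : S (T x) = x.
  have [u ux] := dense_seq sc x.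
  apply: (@cvs_unique _ _ (iota \o u)) => //.
  apply: cvs_ext (@cvs_bounded _ _ _ (S \o T) 1 (iota \o u) x ler01 _ ux).
    by move=> n /=; rewrite Ti Si cov_gaugeK.
  by move=> y z /=; rewrite mul1r -SB (le_trans (Sle _))// -TB.
have S1 : S aone = aone by have := Si aone; rewrite cov_gauge1 !alg_morph1.
have [d de] := jacobson_left_inverse (T b) Ja.
by exists (S d); rewrite -S1 -{1}(ST b) -SM -SB -SM de.
Qed.

End Gauge.

(** * Fourier coefficients *)

Section Cesaro.
Context (R : realType).
Local Notation K := (cplx R).

Definition cesaro (mu : K) (L : nat) : K := L.+1%:R^-1 * \sum_(l < L.+1) mu ^+ l.

Lemma cesaro1 L : cesaro 1 L = 1.
Proof.
rewrite /cesaro (eq_bigr (fun=> 1)) => [|i _]; last by rewrite expr1n.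
by rewrite sumr_const card_ord mulVf// pnatr_eq0.
Qed.

(** For mu other than 1 the geometric sums stay below 2 / |mu - 1|, so their means decay like
    1/L. *)
Lemma cesaro_cvs (mu : K) : cabs mu = 1 ->
  cvs (fun L => cesaro mu L : K^o) ((mu == 1)%:R : K).
Proof.
move=> mu1; have [->|mun] := eqVneq mu 1.
  by apply: cvs_ext (cvs_cst _) => L; rewrite cesaro1.
have D0 : 0 < cabs (mu - 1).
  rewrite lt_neqAle cabs_ge0 andbT eq_sym; apply/eqP => /cabs_eq0/eqP.
  by rewrite subr_eq0 (negbTE mun).
move=> e e0; pose C := 2 / cabs (mu - 1).
exists (Num.truncn (C / e)) => L nL; rewrite subr0 -[rnorm _]/(cabs _).
rewrite /cesaro cabsM cabsV -(rmorph_nat (real_complex R)) cabs_real ger0_norm//.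
rewrite ler_pdivrMl// -ler_pdivrMr//.
have sC : cabs (\sum_(l < L.+1) mu ^+ l) <= C.
  rewrite /C ler_pdivlMr// -cabsM mulrC -subrX1 (le_trans (cabsD _ _))//.
  by rewrite cabsN cabsX mu1 expr1n cabs1.
rewrite (@le_trans _ _ (C / e))//; first by rewrite ler_pM2r ?invr_gt0.
by rewrite ltW// (lt_le_trans (truncnS_gt _))// ler_nat ltnS.
Qed.

Lemma cvs_sum (V : normedModType K) (I : Type) (r : seq I) (P : pred I)
    (u : I -> nat -> V) (l : I -> V) : (forall i, P i -> cvs (u i) (l i)) ->
  cvs (fun n => \sum_(i <- r | P i) u i n) (\sum_(i <- r | P i) l i).
Proof.
move=> ul; elim: r => [|i r IH].
  by rewrite big_nil; apply: cvs_ext (cvs_cst _) => n; rewrite big_nil.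
rewrite big_cons; case: ifP => Pi.
  by apply: cvs_ext (cvsD (ul i Pi) IH) => n; rewrite big_cons Pi.
by apply: cvs_ext IH => n; rewrite big_cons Pi.
Qed.

Lemma cvsZl (V : normedModType K) (k : nat -> K^o) (c : K) (v : V) :
  cvs k (c : K^o) -> cvs (fun n => (k n : K) *: v) (c *: v).
Proof.
move=> kc e e0; have D0 : 0 < rnorm v + 1 by have := rnorm_ge0 v; lra.
have [n0 nP] := kc _ (divr_gt0 e0 D0); exists n0 => n /nP.
rewrite -[rnorm (k n - c)]/(cabs (k n - c)) ler_pdivlMr// => h.
rewrite -scalerBl rnormZ.
by have := rnorm_ge0 v; have := cabs_ge0 (k n - c); nra.
Qed.

Lemma rot_neq0 : rot R != 0.
Proof. by apply/eqP => r0; have := cabs_rot R; rewrite r0 cabs0; lra. Qed.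

Lemma rot_conj : (rot R)^* = (rot R)^-1.
Proof.
have := cabs_sqr (rot R); rewrite cabs_rot expr1n => h.
by apply: (mulfI rot_neq0); rewrite -h mulfV// rot_neq0.
Qed.

Lemma rot_eq1 m n : ((rot R)^-1 ^+ n * rot R ^+ m == 1) = (m == n).
Proof.
have r0 := rot_neq0; rewrite exprVn.
have [mn|nm|->] := ltngtP m n.
- rewrite -(subnK (ltnW mn)) exprD invfM -mulrA mulVf ?expf_neq0// mulr1.
  have : (0 < n - m)%N by rewrite subn_gt0.
  by case: (n - m)%N => // k _; rewrite invr_eq1; apply/negbTE; exact: rot_power.
- rewrite -(subnKC (ltnW nm)) exprD mulrA mulVf ?expf_neq0// mul1r.
  have : (0 < m - n)%N by rewrite subn_gt0.
  by case: (m - n)%N => // k _; apply/negbTE; exact: rot_power.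
- by rewrite mulVf ?expf_neq0// eqxx.
Qed.

End Cesaro.

Section Fourier.
Context (R : realType) (X : topologicalType) (phi : continuousType X X).
Local Notation K := (cplx R).
Local Notation CX := (contfun X K).
Hypothesis cX : compact [set: X].
Context (A : banachAlgType K) (iota : algMorphism (covalg K phi) A).
Hypothesis sc : is_semicrossed iota.
Local Notation lam := (rot R).
Local Notation kap := (rot R)^-1.
Local Notation mono := (covmonom phi).
Context (S : A -> A).
Hypothesis gS : gauge_action iota lam S.
Implicit Types (F G : covalg K phi) (a b : A).

Let Sit_lin l k a b : iter l S (k *: a + b) = k *: iter l S a + iter l S b.
Proof. by elim: l => //= l ->; rewrite (ga_lin gS). Qed.

Let Sit_le l a : rnorm (iter l S a) <= rnorm a.
Proof. by elim: l => //= l IH; rewrite (le_trans (ga_le gS _)). Qed.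

Let S0 : S 0 = 0.
Proof. by apply: rnorm_le0; rewrite (le_trans (ga_le gS 0))// rnorm0. Qed.

Let SZ k a : S (k *: a) = k *: S a.
Proof. by rewrite -[k *: a]addr0 (ga_lin gS) S0 addr0. Qed.

Let Sit_mono l m f : iter l S (iota (mono m f)) = (lam ^+ m) ^+ l *: iota (mono m f).
Proof.
elim: l => [|l IH] /=; first by rewrite expr0 scale1r.
by rewrite IH SZ (ga_iota gS) cov_gauge_mono linearZ scalerA -exprSr.
Qed.

(** For [mu = kap ^+ n] this discretises the integral defining the [n]-th Fourier component, with
    the powers of [rot] in place of the circle. *)
Definition avg (mu : K) (L : nat) a : A :=
  (L.+1%:R^-1 : K) *: \sum_(l < L.+1) mu ^+ l *: iter l S a.

Lemma avg_lin mu L k a b : avg mu L (k *: a + b) = k *: avg mu L a + avg mu L b.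
Proof.
rewrite /avg !scaler_sumr -big_split; apply: eq_bigr => l _ /=.
by rewrite Sit_lin !scalerDr !scalerA; congr (_ *: _ + _); ring.
Qed.

Lemma avg_sum mu L (I : Type) (r : seq I) (P : pred I) (F : I -> A) :
  avg mu L (\sum_(i <- r | P i) F i) = \sum_(i <- r | P i) avg mu L (F i).
Proof.
have av0 : avg mu L 0 = 0.
  by have := avg_lin mu L (-1) 0 0; rewrite scaler0 addr0 scaleN1r addNr.
apply: (big_morph (avg mu L) _ av0) => a b.
by have := avg_lin mu L 1 a b; rewrite !scale1r.
Qed.

Lemma avgB mu L a b : avg mu L (a - b) = avg mu L a - avg mu L b.
Proof. by rewrite addrC -scaleN1r avg_lin scaleN1r addrC. Qed.

Lemma avg_le mu L a : cabs mu = 1 -> rnorm (avg mu L a) <= rnorm a.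
Proof.
move=> mu1; rewrite /avg rnormZ cabsV -(rmorph_nat (real_complex R)) cabs_real.
rewrite ger0_norm// ler_pdivrMl// (le_trans (rnorm_sum _ _ _))//.
apply: (@le_trans _ _ (\sum_(l < L.+1) rnorm a)).
  by apply: ler_sum => l _; rewrite rnormZ cabsX mu1 expr1n mul1r.
by rewrite sumr_const card_ord mulr_natl.
Qed.

Lemma avg_mono mu L m f :
  avg mu L (iota (mono m f)) = cesaro (mu * lam ^+ m) L *: iota (mono m f).
Proof.
rewrite /avg /cesaro -scalerA scaler_suml; congr (_ *: _).
by apply: eq_bigr => l _; rewrite Sit_mono scalerA exprMn.
Qed.

Lemma avg_poly mu F N : cabs mu = 1 -> (forall n, (N <= n)%N -> covcoef F n = 0) ->
  cvs (fun L => avg mu L (iota F))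
    (\sum_(m < N) ((mu * lam ^+ m == 1)%:R : K) *: iota (mono m (covcoef F m))).
Proof.
move=> mu1 FN; apply: (@cvs_ext _ _ (fun L => \sum_(m < N)
    cesaro (mu * lam ^+ m) L *: iota (mono m (covcoef F m)))).
  by move=> L; rewrite [in RHS](cov_decomp FN) linear_sum avg_sum;
    apply: eq_bigr => m _; rewrite avg_mono.
apply: cvs_sum => m _; apply: cvsZl; apply: cesaro_cvs.
by rewrite cabsM cabsX cabs_rot expr1n mulr1.
Qed.

Lemma avg_approx mu a t : cabs mu = 1 ->
  (forall e : R, 0 < e -> exists F l, [/\ rnorm (iota F - a) <= e,
     cvs (fun L => avg mu L (iota F)) l & rnorm (l - t) <= e]) ->
  cvs (fun L => avg mu L a) t.
Proof.
move=> mu1 h e e0; have e3 : 0 < e / 3 by rewrite divr_gt0.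
have [F [l [Fa Fl lt]]] := h _ e3.
have [n0 nP] := Fl _ e3; exists n0 => L /nP nL.
have := rnorm_tri (avg mu L (iota F)) (avg mu L a) t.
have := rnorm_tri l (avg mu L (iota F)) t.
have := avg_le L (a - iota F) mu1; rewrite avgB [rnorm (a - _)]rnormC; lra.
Qed.

(** The contractive extension of the coefficient maps from polynomials to A, phrased without limits;
    density makes [f] unique. *)
Definition fourier a (f : nat -> CX) : Prop :=
  forall n F x, cabs (f n x - covcoef F n x) <= rnorm (a - iota F).

(** The values at [x] are the coordinates of [a] applied to the first basis vector in the orbit
    representation at [x]. They are uniform limits of polynomial coefficients, hence continuous in
    [x]. *)
Lemma fourier_exists a : exists f, fourier a f.
Proof.
have /choice[rho rhoP] : forall x, exists rho : A -> ell2 R -> ell2 R,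
    is_semicrossed_rep iota rho /\ forall F, rho (iota F) = orbit_rep cX x F.
  move=> x; have [r [rs rE]] := extend_cov_rep sc (orbit_rep_cov R phi cX x).
  by exists r.
pose g n x : K := rho x a (ell2_delta R) n.
have gP n F x : cabs (g n x - covcoef F n x) <= rnorm (a - iota F).
  have [[rh _ rle] rE] := rhoP x.
  rewrite -(@orbit_rep_e0 R X phi cX x F n (ell2_delta R))// -rE.
  rewrite [g n x - _](_ : _ =
    ell2_fun (rho x a (ell2_delta R) - rho x (iota F) (ell2_delta R)) n)//.
  rewrite -(homB rh) (le_trans (ell2_coord _ _))// (le_trans (rle _ _))//.
  by rewrite ler_piMr ?rnorm_ge0// ell2_delta_le.
have gc n : continuous (g n).
  move=> x B /(@nbhs_rnorm R K^o)[e e0 eB].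
  have e3 : 0 < e / 3 by rewrite divr_gt0.
  have [_ [F _ <-] Fa] := dense_adh a sc.2 e3.
  have := cts_near (covcoef F n) x e3; apply: filterS => z zx; apply: eB.
  rewrite -[rnorm _]/(cabs (g n z - g n x)).
  have := gP n F z; have := gP n F x; rewrite rnormC.
  have -> : g n z - g n x = (g n z - covcoef F n z) +
     (covcoef F n z - covcoef F n x) - (g n x - covcoef F n x) by ring.
  move=> h1 h2; rewrite (le_trans (cabsD _ _))// cabsN.
  have := cabsD (g n z - covcoef F n z) (covcoef F n z - covcoef F n x); lra.
pose h n : CX := HB.pack (g n) (isContinuous.Build _ _ (g n) (gc n)).
exists h; by move=> n F x; exact: gP.
Qed.

Lemma mono0 n : mono n (0 : CX) = 0.
Proof. by apply: covalgP => m z; rewrite covcoef_mono; case: eqP. Qed.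

Lemma monoB n (f g : CX) : mono n f - mono n g = mono n (f - g).
Proof.
apply: covalgP => m z; rewrite covcoefD covcoefN contD contN !covcoef_mono.
by case: eqP => // _; rewrite !cont0 subr0.
Qed.

Lemma avg_fourier a f n : fourier a f ->
  cvs (fun L => avg (kap ^+ n) L a) (iota (mono n (f n))).
Proof.
move=> fa; have k1 : cabs (kap ^+ n) = 1 by rewrite cabsX cabsV cabs_rot invr1 expr1n.
apply: avg_approx => // e e0.
have [_ [F _ <-] Fa] := dense_adh a sc.2 e0.
have [N0 FN0] := covcoef_fin F; pose N := maxn N0 n.+1.
have FN m : (N <= m)%N -> covcoef F m = 0.
  by rewrite geq_max => /andP[/FN0].
exists F, (iota (mono n (covcoef F n))); split=> //.
  have nN : (n < N)%N by rewrite leq_maxr.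
  have := avg_poly k1 FN; rewrite (bigD1 (Ordinal nN))//= rot_eq1 eqxx scale1r.
  rewrite big1 ?addr0// => i ni; rewrite rot_eq1 (_ : (i == n :> nat) = false) ?scale0r//.
  by apply/negbTE; apply: contra_neq ni => ni; exact/val_inj.
rewrite -raddfB monoB; apply: monom_le => //; first exact: ltW.
move=> z; rewrite contD contN cabsC (le_trans (fa n F z))//.
by rewrite rnormC.
Qed.

(** Polynomials have no negative frequencies, and density passes this on to A. *)
Lemma avg_negative a n : cvs (fun L => avg (lam ^+ n.+1) L a) 0.
Proof.
have l1 : cabs (lam ^+ n.+1) = 1 by rewrite cabsX cabs_rot expr1n.
apply: avg_approx => // e e0.
have [_ [F _ <-] Fa] := dense_adh a sc.2 e0.
have [N FN] := covcoef_fin F; exists F, 0; split=> //.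
  have := avg_poly l1 FN; rewrite big1// => i _.
  by rewrite -exprD addSn (negbTE (rot_power R _)) scale0r.
by rewrite subrr rnorm0 ltW.
Qed.

Let nu (k i : nat) : K := kap ^+ k * lam ^+ i.

Let nu1 k i : cabs (nu k i) = 1.
Proof. by rewrite /nu cabsM !cabsX cabsV cabs_rot invr1 !expr1n mulr1. Qed.

(** The pairs counted are those with k = i + m; divided by N, their number is the Fejer weight of
    frequency m. *)
Let count_shift N m : (m <= N)%N ->
  \sum_(k < N) \sum_(i < N) ((nu k i * lam ^+ m == 1)%:R : K) = (N - m)%:R.
Proof.
move=> mN; rewrite exchange_big /=.
transitivity (\sum_(i < N) ((i < N - m)%N%:R : K)).
  apply: eq_bigr => i _; rewrite (eq_bigr (fun k : 'I_N => ((k == i + m :> nat)%N%:R : K))).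
    have [im|im] := ltnP i (N - m).
      have imN : (i + m < N)%N by lia.
      rewrite (bigD1 (Ordinal imN))//= eqxx big1 ?addr0// => k kn.
      rewrite (_ : (k == i + m :> nat)%N = false)//.
      by apply/negbTE; apply: contra_neq kn => kn; exact/val_inj.
    rewrite big1// => k _; rewrite (_ : (k == i + m :> nat)%N = false)//.
    by apply/negbTE; rewrite neq_ltn; have := ltn_ord k; lia.
  by move=> k _; rewrite /nu -mulrA -exprD rot_eq1 eq_sym.
transitivity (\sum_(i < N - m) (1 : K)); last by rewrite sumr_const card_ord.
rewrite (big_ord_widen N (fun=> 1))// ?leq_subr// [RHS]big_mkcond /=.
by apply: eq_bigr => i _; case: ltnP.
Qed.

(* Fejer's kernel [N^-1 |\sum_(k < N) z^k|^2 >= 0] tested along the powers of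
   [rot], so that only one automorphism is needed. *)
Lemma fourier_unique a : fourier a (fun=> 0) -> a = 0.
Proof.
move=> fa.
have avg0 k i : cvs (fun L => avg (nu k i) L a) 0.
  rewrite /nu; have [ik|ki] := leqP i k.
    have := avg_fourier (k - i) fa; rewrite mono0 raddf0.
    apply: cvs_ext => L; congr avg.
    rewrite -{2}(subnK ik) exprD -mulrA -exprMn mulVf ?rot_neq0//.
    by rewrite expr1n mulr1.
  have := avg_negative a (i - k).-1; rewrite prednK ?subn_gt0//.
  apply: cvs_ext => L; congr avg.
  rewrite -{2}(subnKC (ltnW ki)) exprD mulrA -exprMn mulVf ?rot_neq0//.
  by rewrite expr1n mul1r.
(* The Fejer means of [a] tend to 0 and those of F nearly recover F, while averaging hardly
   increases the norm of F - a. Letting F approach [a] then gives a = 0. *)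
have key F : rnorm (iota F) <= rnorm (a - iota F).
  have [D FD] := covcoef_fin F.
  pose t m := iota (mono m (covcoef F m)).
  pose C := \sum_(m < D) m%:R * rnorm (t m).
  have C0 : 0 <= C by apply: sumr_ge0 => m _; rewrite mulr_ge0// rnorm_ge0.
  have FE : iota F = \sum_(m < D) t m.
    by rewrite {1}(cov_decomp FD) linear_sum.
  apply/ler_addgt0Pr => e e0.
  (* The Fejer weight of frequency m falls short of 1 by m/N, so the total loss on F is at most C/N;
     [N >= D] keeps all weights defined by honest subtraction. *)
  pose N := (D + (Num.truncn (C / e)).+1)%N.
  have N0 : 0 < N%:R :> R by rewrite ltr0n /N addnS.
  have CN : C / N%:R <= e.
    rewrite ler_pdivrMr// mulrC -ler_pdivrMr// ltW// (lt_le_trans (truncnS_gt _))//.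
    by rewrite ler_nat leq_addl.
  pose sig L b := (N%:R^-1 : K) *: \sum_(k < N) \sum_(i < N) avg (nu k i) L b.
  pose T := (N%:R^-1 : K) *: \sum_(k < N) \sum_(i < N) \sum_(m < D)
     ((nu k i * lam ^+ m == 1)%:R : K) *: t m.
  have siga : cvs (fun L => sig L a) 0.
    rewrite -[0](scaler0 _ (N%:R^-1 : K)); apply: cvsZ.
    have := @cvs_sum _ _ _ (index_enum 'I_N) xpredT
      (fun k L => \sum_(i < N) avg (nu k i) L a) (fun=> 0) _.
    rewrite big1//; apply=> k _.
    have := @cvs_sum _ _ _ (index_enum 'I_N) xpredT
      (fun i L => avg (nu k i) L a) (fun=> 0) _.
    by rewrite big1//; apply=> i _; exact: avg0.
  have sigF : cvs (fun L => sig L (iota F)) T.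
    by apply: cvsZ; apply: cvs_sum => k _; apply: cvs_sum => i _; exact: avg_poly.
  (* The double sum of [nu k i ^+ l] is |z l|^2, so [sig] combines iterates of [S] with nonnegative
     weights and its norm is at most their total. *)
  pose z l : K := \sum_(i < N) (lam ^+ i) ^+ l.
  pose w L l : R := L.+1%:R^-1 * (N%:R^-1 * cabs (z l) ^+ 2).
  have w0 L l : 0 <= w L l by rewrite /w mulr_ge0 ?invr_ge0// mulr_ge0 ?invr_ge0// sqr_ge0.
  have wE L l : (w L l)%:C = \sum_(k < N) \sum_(i < N)
      (N%:R^-1 * (L.+1%:R^-1 * nu k i ^+ l) : K).
    rewrite /w rmorphM /= rmorphM /= !fmorphV !rmorph_nat cabs_sqr /z.
    rewrite rmorph_sum mulr_suml mulrCA exchange_big !mulr_sumr /=.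
    apply: eq_bigr => i _; rewrite !mulr_sumr; apply: eq_bigr => k _.
    rewrite !rmorphXn /= rot_conj /nu exprMn; ring.
  have sigE L b : sig L b = \sum_(l < L.+1) (w L l)%:C *: iter l S b.
    rewrite /sig scaler_sumr.
    transitivity (\sum_(k < N) \sum_(i < N) \sum_(l < L.+1)
        (N%:R^-1 * (L.+1%:R^-1 * nu k i ^+ l) : K) *: iter l S b).
      apply: eq_bigr => k _; rewrite scaler_sumr; apply: eq_bigr => i _.
      by rewrite /avg !scaler_sumr; apply: eq_bigr => l _; rewrite !scalerA mulrA.
    under eq_bigr => k _ do rewrite exchange_big /=.
    rewrite exchange_big /=; apply: eq_bigr => l _.
    by rewrite wE scaler_suml; apply: eq_bigr => k _; rewrite scaler_suml.
  (* Only the diagonal pairs k = i survive in the limit; there are N of them, divided by N. *)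
  have sumw : cvs (fun L => ((\sum_(l < L.+1) w L l)%:C : K^o)) 1.
    have c1 : cvs (fun L => ((N%:R^-1 : K) *: \sum_(k < N) \sum_(i < N)
        (cesaro (nu k i) L : K^o)))
        ((N%:R^-1 : K) *: \sum_(k < N) \sum_(i < N) ((nu k i == 1)%:R : K^o)).
      apply: cvsZ; apply: cvs_sum => k _; apply: cvs_sum => i _.
      exact: cesaro_cvs.
    have e1 : (N%:R^-1 : K) *: \sum_(k < N) \sum_(i < N) ((nu k i == 1)%:R : K^o) = 1.
      have := count_shift (leq0n N); rewrite subn0 expr0.
      under eq_bigr => k _ do under eq_bigr => i _ do rewrite mulr1.
      move=> ->; rewrite -[_ *: _]/(_ * _) mulVf//.
      by rewrite pnatr_eq0 /N addnS.
    rewrite e1 in c1; apply: cvs_ext c1 => L.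
    rewrite rmorph_sum /= -[_ *: _]/(_ * _) mulr_sumr.
    transitivity (\sum_(k < N) \sum_(i < N) \sum_(l < L.+1)
        (N%:R^-1 * (L.+1%:R^-1 * nu k i ^+ l) : K)).
      apply: eq_bigr => k _; rewrite mulr_sumr; apply: eq_bigr => i _.
      by rewrite /cesaro !mulr_sumr.
    symmetry; transitivity (\sum_(l < L.+1) \sum_(k < N) \sum_(i < N)
        (N%:R^-1 * (L.+1%:R^-1 * nu k i ^+ l) : K)).
      by apply: eq_bigr => l _; rewrite wE.
    by rewrite exchange_big /=; apply: eq_bigr => k _; exact: exchange_big.
  pose r := rnorm (a - iota F).
  have sigle L b : rnorm (sig L b) <= (\sum_(l < L.+1) w L l) * rnorm b.
    rewrite sigE (le_trans (rnorm_sum _ _ _))// mulr_suml; apply: ler_sum => l _.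
    by rewrite rnormZ cabs_real ger0_norm// ler_wpM2l.
  have sigB L : sig L (iota F) + (-1 : K) *: sig L a = sig L (iota F - a).
    rewrite !sigE scaler_sumr -big_split; apply: eq_bigr => l _ /=.
    rewrite [iota F - a]addrC -[- a]scaleN1r Sit_lin scalerDr addrC; congr (_ + _).
    by rewrite !scalerA mulrC.
  have Tr : rnorm T <= r.
    apply/ler_addgt0Pr => d d0.
    have r1 : 0 < r + 1 by have := rnorm_ge0 (a - iota F); rewrite /r; lra.
    have := cvsD sigF (cvsZ (-1) siga); rewrite scaler0 addr0 => /cvs_le; apply.
    have [n0 nP] := sumw _ (divr_gt0 d0 r1); exists n0 => L /nP.
    rewrite -[rnorm _]/(cabs _) -(rmorph1 (real_complex R)) -rmorphB cabs_real.
    rewrite ler_pdivlMr// sigB => h.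
    rewrite (le_trans (sigle _ _))// [rnorm (iota F - a)]rnormC -/r.
    have r0 : 0 <= r by exact: rnorm_ge0.
    have := ler_norm (\sum_(l < L.+1) w L l - 1); nra.
  have TE : T = \sum_(m < D) (((N - m)%:R / N%:R)%:C : K) *: t m.
    rewrite /T; under eq_bigr => k _ do rewrite exchange_big /=.
    rewrite exchange_big /= scaler_sumr; apply: eq_bigr => m _.
    under eq_bigr => k _ do rewrite -scaler_suml.
    rewrite -scaler_suml count_shift ?scalerA; last first.
      by rewrite (leq_trans (ltnW (ltn_ord m)))// leq_addr.
    by rewrite rmorphM /= fmorphV !rmorph_nat mulrC.
  have FT : rnorm (iota F - T) <= C / N%:R.
    rewrite FE TE -sumrB (le_trans (rnorm_sum _ _ _))// /C mulr_suml.
    apply: ler_sum => m _; rewrite -{1}[t m]scale1r -scalerBl rnormZ mulrAC.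
    rewrite ler_wpM2r ?rnorm_ge0// -(rmorph1 (real_complex R)) -rmorphB cabs_real.
    have mN : (m <= N)%N by rewrite (leq_trans (ltnW (ltn_ord m)))// leq_addr.
    rewrite natrB// (_ : 1 - _ = m%:R / N%:R) ?ger0_norm//.
    by field; rewrite gt_eqF.
  have := rnorm_lb (iota F) T; rewrite -/r; lra.
apply: small_eq0 => e e0.
have [_ [F _ <-] Fa] := dense_adh a sc.2 (half_gt0 e0).
have := key F; rewrite rnormC => kF.
have := rnorm_lb a (iota F); rewrite [rnorm (a - _)]rnormC; lra.
Qed.

Lemma avg_jacobson mu L a : jacobson_radical a -> jacobson_radical (avg mu L a).
Proof.
move=> Ja; apply: jacobsonZ; apply: jacobson_sum => l _; apply: jacobsonZ.
elim: (nat_of_ord l) => //= n; apply: gauge_action_jacobson gS => //.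
exact: cabs_rot.
Qed.

Lemma fourier_jacobson a f n : jacobson_radical a -> fourier a f ->
  jacobson_radical (iota (mono n (f n))).
Proof.
move=> Ja fa; apply: jacobson_adh => e e0.
have [n0 nP] := avg_fourier n fa e0.
by exists (avg (kap ^+ n) n0 a); [exact: avg_jacobson|exact: nP].
Qed.

End Fourier.

(** * Conclusion *)

Section Growth.
Context (R : realType).
Local Notation K := (cplx R).

(* The recurrence forces the partial sums of [w] to double over each block of
   [m + N] indices, too fast for a bounded sequence. *)
Lemma renewal_unbounded (w : nat -> K) (t : nat -> nat -> K) (m N : nat) (d B : R) :
  (0 < m)%N -> 0 < d -> (forall k p, 0 <= t k p) ->
  (forall p, d%:C <= \sum_(k < N) t k p) ->
  (forall l, w l = (l == 0%N)%:R + (2 / d)%:C *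
     \sum_(k < N) (if (m + k <= l)%N then t k (l - (m + k))%N * w (l - (m + k))%N else 0)) ->
  (forall l, cabs (w l) <= B) -> False.
Proof.
move=> m0 d0 t0 td wE wB.
have z0 : 0 <= (2 / d)%:C :> K by rewrite ler0c divr_ge0 ?(ltW d0).
have w0 l : 0 <= w l.
  (* Strong induction applies because [m > 0] makes every index on the right strictly smaller than
     [l]. *)
  elim/ltn_ind: l => l IH; rewrite wE addr_ge0 ?ler0n// mulr_ge0// sumr_ge0// => k _.
  by case: ifP => // mk; rewrite mulr_ge0// IH//; lia.
pose u k l : K := if (m + k <= l)%N then t k (l - (m + k))%N * w (l - (m + k))%N else 0.
have u0 k l : 0 <= u k l by rewrite /u; case: ifP => // _; rewrite mulr_ge0.
pose s L := \sum_(l < L) w l; pose P := (m + N)%N.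
have su L (k : 'I_N) : \sum_(p < L) t k p * w p <= \sum_(l < L + P) u k l.
  have -> : (L + P = (m + k) + (L + (N - k)))%N by have := ltn_ord k; rewrite /P; lia.
  rewrite big_split_ord /= [X in _ <= _ + X]big_split_ord /=.
  rewrite (eq_bigr (fun p : 'I_L => u k (m + k + p)%N)) => [|p _].
    by rewrite addrCA lerDl addr_ge0// sumr_ge0.
  by rewrite /u leq_addr addKn.
(* Summing the recurrence up to [L + P] picks up every term of index p < L for all delays k; their
   coefficients add up to at least [d], and 2/d makes the factor 2. *)
have step L : 2 * s L <= s (L + P)%N.
  have -> : 2 * s L = (2 / d)%:C * \sum_(p < L) d%:C * w p.
    rewrite -mulr_sumr mulrA -rmorphM divfK ?gt_eqF//.
    by rewrite rmorph_nat.
  apply: (@le_trans _ _ ((2 / d)%:C * \sum_(k < N) \sum_(p < L) t k p * w p)).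
    rewrite ler_wpM2l// exchange_big; apply: ler_sum => p _ /=.
    by rewrite -mulr_suml ler_wpM2r.
  apply: (@le_trans _ _ ((2 / d)%:C * \sum_(k < N) \sum_(l < L + P) u k l)).
    by rewrite ler_wpM2l//; apply: ler_sum => k _.
  rewrite exchange_big mulr_sumr; apply: ler_sum => l _.
  by rewrite [leRHS]wE lerDr ler0n.
have w1 : 1 <= w 0%N.
  by rewrite wE eqxx lerDl mulr_ge0// sumr_ge0// => k _; exact: (u0 k 0%N).
have grow i : 2 ^+ i <= s (1 + i * P)%N.
  elim: i => [|i IH]; first by rewrite expr0 mul0n addn0 /s big_ord1.
  rewrite exprS mulSn addnCA addnA [(P + 1)%N]addnC -addnA [(P + _)%N]addnC addnA.
  by rewrite (le_trans _ (step _))// ler_wpM2l// ler0n.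
have sB L : s L <= (L%:R * B)%:C.
  rewrite /s (@le_trans _ _ (\sum_(l < L) B%:C))//.
    by apply: ler_sum => l _; rewrite -(ger0_norm (w0 l)) normr_cabs lecR.
  by rewrite sumr_const card_ord rmorphM /= rmorph_nat mulr_natl.
have B0 : 0 <= B by rewrite (le_trans _ (wB 0%N))// cabs_ge0.
(* 2j blocks give 2^(2j) <= (1 + 2jP) B, and j < 2^j bounds the right side by 2^j (1 + 2P) B; one
   factor 2^j cancels. *)
have key j : 2 ^+ j <= (1 + 2 * P)%N%:R * B.
  have := le_trans (grow (j + j)%N) (sB _).
  have -> : 2 ^+ (j + j) = (2 ^+ (j + j))%:C :> K by rewrite rmorphXn /= rmorph_nat.
  rewrite lecR => h.
  have pj : 0 < 2 ^+ j :> R by rewrite exprn_gt0.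
  rewrite -(ler_pM2l pj) -exprD (le_trans h)// mulrA ler_wpM2r//.
  rewrite -natrX -natrM ler_nat.
  have := ltn_expl j (ltnSn 1); nia.
pose j := (Num.truncn ((1 + 2 * P)%N%:R * B)).+1.
have := key j; rewrite leNgt => /negP; apply.
rewrite (lt_le_trans (truncnS_gt _))// -/j -natrX ler_nat ltnW//.
exact: ltn_expl.
Qed.

End Growth.

Section Semisimple.
Context (R : realType) (X : topologicalType) (phi : continuousType X X).
Local Notation K := (cplx R).
Local Notation CX := (contfun X K).
Local Notation mono := (covmonom phi).
Local Notation U := (cov_gen R phi).
Hypothesis cX : compact [set: X].

Lemma orbit_rep_mono x q (h : CX) (v : ell2 R) l :
  orbit_rep cX x (mono q h) v l =
  if (q <= l)%N then h (iter (l - q) phi x) * v (l - q)%N else 0.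
Proof.
rewrite orbit_repE; case: leqP => [ql|lq].
  have lql : (l - q < l.+1)%N by rewrite ltnS leq_subr.
  rewrite (bigD1 (Ordinal lql))// big1 => [|p /andP[_ pn]].
    by rewrite covcoef_mono /= subKn// eqxx addr0.
  rewrite covcoef_mono ifN ?cont0 ?mul0r//; apply: contra_neq pn => pq.
  by apply/val_inj => /=; rewrite -pq subKn// -ltnS.
rewrite big1// => p _; rewrite covcoef_mono ifN ?cont0 ?mul0r//.
by rewrite neq_ltn (leq_ltn_trans (leq_subr _ _)).
Qed.

Context (A : banachAlgType K) (iota : algMorphism (covalg K phi) A).
Hypothesis sc : is_semicrossed iota.

Lemma monomial_not_jacobson (f : CX) m (N : nat) (d : R) (x : X) : (0 < m)%N ->
  0 < d -> (forall y, d <= \sum_(k < N) cabs (f (iter k phi y)) ^+ 2) ->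
  ~ jacobson_radical (iota (mono m f)).
Proof.
move=> m0 d0 df Jf.
pose g : CX := f * contfun_conj f.
pose gk k : CX := iter k (@precomp X K phi) g.
have gkE k y : gk k y = (cabs (f (iter k phi y)) ^+ 2)%:C.
  by rewrite precomp_iter contM cont_conj cabs_sqr.
have Jk k : jacobson_radical (iota (mono (m + k) (gk k))).
  (* This is U^m f times conj(f) U^k in normal form: the radical being a right ideal, the delayed
     terms stay in it. *)
  have -> : mono (m + k) (gk k) = mono m f ** (cov_fun phi (contfun_conj f) ** apow U k).
    rewrite -(cov_genX phi m f) -(cov_genX phi (m + k) (gk k)) apowD -!amulA.
    congr (_ ** _); rewrite [RHS]amulA cov_funM.
    apply: covalgP => n y; rewrite covcoef_Mfun covcoef_funM !covcoef_genX.
    by case: eqP => [->|_]; rewrite ?mul0r ?mulr0// mulr1 mul1r precomp_iter.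
  by rewrite alg_morphM; exact: jacobson_mulr.
pose C := \sum_(k < N) mono (m + k) (gk k).
have JC : jacobson_radical (iota C).
  by rewrite /C linear_sum; apply: jacobson_sum => k _; exact: Jk.
(* The scale 2/d is the one for which [renewal_unbounded] doubles the partial sums. *)
have [b [_ bC]] := jacobson_inverse ((2 / d)%:C *: aone) JC.
have [rho [rhos rhoE]] := extend_cov_rep sc (orbit_rep_cov R phi cX x).
have [rh _ _] := rhos.
pose w := rho b (ell2_delta R).
have wE : w = ell2_delta R + (2 / d)%:C *: orbit_rep cX x C w.
  have := congr1 (fun c => rho c (ell2_delta R)) bC.
  rewrite /= (hom_mul rh) -/w (homB rh) !(semicrossed_rep_one _ rhos).
  by rewrite amulZl amul1a (homZ rh) rhoE => <-; rewrite subrK.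
refine (@renewal_unbounded R (ell2_fun w) (fun k p => gk k (iter p phi x))
  m N d (rnorm w) m0 d0 _ _ _ _).
- by move=> k p; rewrite gkE ler0c sqr_ge0.
- move=> p; rewrite (eq_bigr (fun k : 'I_N =>
    (cabs (f (iter k phi (iter p phi x))) ^+ 2)%:C)) => [|k _]; last exact: gkE.
  by rewrite -rmorph_sum lecR.
- move=> l; rewrite {1}wE.
  transitivity (ell2_delta R l + (2 / d)%:C * orbit_rep cX x C w l) => //.
  rewrite ell2_deltaE; congr (_ + _ * _).
  have -> : orbit_rep cX x C w = \sum_(k < N) orbit_rep cX x (mono (m + k) (gk k)) w.
    by rewrite /C (hom_sum (orbit_rep_hom R phi cX x)).
  transitivity (\sum_(k < N) orbit_rep cX x (mono (m + k) (gk k)) w l).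
    exact: (big_morph (fun v : ell2 R => ell2_fun v l) (fun _ _ => erefl) erefl).
  by apply: eq_bigr => k _; rewrite orbit_rep_mono.
- exact: ell2_coord.
Qed.

End Semisimple.

Theorem proposition3 (R : realType) (X : topologicalType)
    (phi : continuousType X X) :
  compact [set: X] -> hausdorff_space X ->
  (forall y : X, exists x : X, phi x = y) ->
  forall (A : banachAlgType (cplx R))
    (iota : algMorphism (covalg (cplx R) phi) A),
  is_semicrossed iota ->
  forall (E : cstarAlgType (cplx R)) (j : algMorphism A E),
  is_cstar_envelope (semicrossed_mxnorm iota) j ->
  is_simple E ->
  is_semisimple A.
Proof.
move=> cX _ _ A iota sc E j jE simpleE; apply/seteqP; split=> [a Ja|_ ->]; last first.
  exact: jacobson0.
have [S gS] := gauge_action_exists sc (cabs_rot R).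
have [f fa] := fourier_exists cX sc a.
apply: contrapT => a0.
have [n [x fx]] : exists n x, f n x <> 0.
  apply: contrapT => nf; apply: a0; apply: (fourier_unique sc gS) => n F y.
  have -> : (fun=> 0 : contfun X (cplx R)) n y = f n y.
    by symmetry; apply: contrapT => fy; apply: nf; exists n, y.
  exact: fa.
have [N [d [d0 dP]]] := uniform_return cX sc jE simpleE (ex_intro _ x fx).
apply: (monomial_not_jacobson cX sc x (ltn0Sn n) d0 dP).
(* U is applied for every [n], which makes the degree positive without a case distinction. *)
have -> : covmonom phi n.+1 (f n) = cov_gen R phi ** covmonom phi n (f n).
  by rewrite -!cov_genX /= amulA.
rewrite alg_morphM; apply: jacobson_mull.
exact: (fourier_jacobson sc gS n Ja fa).
Qed.
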